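(* Let $(X,\mu)$ be a non-atomic measure space with a dyadic grid $\mathcal{D}$, and let $\tau=1_{\mathcal{S}}$ for a sparse collection $\mathcal{S}\subset\mathcal{D}$. Let $m\geq 2$ and, for $i=1,\dots,m$, let $0<r_i<\infty$, $0\leq\rho_i<1$, $1<t_i<1/\rho_i$ (with $1/0=\infty$), and suppose $$\sum_{i=1}^m r_i(1/t_i-\rho_i)=1.$$ Let $\{1,\dots,m\}=J_s\cup J_r$ be a partition with $J_s$ non-empty ($J_r$ may be empty). Then for every tuple of weights $\vec w=(w_1,\dots,w_m)$ and all non-negative measurable functions $f_1,\dots,f_m$ on $X$, $$\mathcal{B}^{\vec r}_{\vec\rho}(\tau,(f_1w_1,\dots,f_mw_m))\lesssim [\vec w]^{(r_i/t_i')_i}\sum_{j\in J_s}[\vec w]_{FW}^{(r_i(1/t_i-\rho_i))_{i\neq j}}\prod_{i\in J_s}\|f_i\|_{L^{t_i}(w_i)}^{r_i}\prod_{i\in J_r}\|f_i\|_{L^{t_i,r_i}(w_i)}^{r_i}.$$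
   Context: Write $|E|=\mu(E)$ for measurable $E\subset X$. A dyadic grid is a (countable) collection $\mathcal{D}$ of measurable subsets of $X$ (''cubes'') with $0<|Q|<\infty$ such that for all $Q,Q'\in\mathcal{D}$ either $Q\subseteq Q'$, $Q'\subseteq Q$ or $Q\cap Q'=\emptyset$. All functions are non-negative. A weight is a non-negative measurable function on $X$; $L^p(w)$ and $L^{p,r}(w)$ are the Lebesgue and Lorentz spaces with respect to the measure $w\,d\mu$. $t'=t/(t-1)$, and $(w)_Q=|Q|^{-1}\int_Q w\,d\mu$. A collection $\mathcal{S}\subset\mathcal{D}$ is $\eta$-sparse ($0<\eta\le 1$) if there are pairwise disjoint measurable subsets $E(Q)\subset Q$, $Q\in\mathcal{S}$, with $|E(Q)|\geq\eta|Q|$; it is sparse if it is $\eta$-sparse for some fixed $\eta$. Equivalently, $\tau=1_{\mathcal{S}}$ satisfies $\|\tau\|_{\mathrm{Car}}:=\sup_{Q\in\mathcal{D}}|Q|^{-1}\sum_{Q'\in\mathcal{D},\,Q'\subseteq Q}\tau_{Q'}|Q'|\le 1/\eta$. Sparse form: $$\mathcal{B}^{\vec r}_{\vec\rho}(\tau,(g_1,\dots,g_m))=\sum_{Q\in\mathcal{D}}\tau_Q|Q|\prod_{i=1}^m\Big(|Q|^{-(1-\rho_i)}\int_Q g_i\,d\mu\Big)^{r_i}.$$ For exponents $r_1,\dots,r_k\ge0$ let $\mathcal{M}^{\vec r}(f_1,\dots,f_k)(x)=\sup_{Q\in\mathcal{D},\,x\in Q}\prod_{i=1}^k\big(|Q|^{-1}\int_Q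 f_i\,d\mu\big)^{r_i}$; a factor with exponent $0$ is omitted. Multilinear Muckenhoupt characteristic: for $\vec q=(q_1,\dots,q_m)$ with $0\le q_i<\infty$, $[\vec w]^{\vec q}=\sup_{Q\in\mathcal{D}}\prod_{i=1}^m (w_i)_Q^{q_i}$. Multilinear Fujii--Wilson characteristic: for $\vec\beta=(\beta_1,\dots,\beta_m)$ with $0\le\beta_i<\infty$ and $\beta=\sum_i\beta_i$, $$[\vec w]_{FW}^{\vec\beta}=\sup_{Q\in\mathcal{D}}\Big(\int_Q \mathcal{M}^{\vec\beta/\beta}(1_Qw_1,\dots,1_Qw_m)\,d\mu\Big)^{\beta}\Big(\int_Q\prod_{i=1}^m w_i^{\beta_i/\beta}\,d\mu\Big)^{-\beta}.$$ $(\beta_i)_{i\neq j}$ denotes the vector of length $m$ whose $i$-th entry is $\beta_i$ for $i\neq j$ and $0$ for $i=j$. $A\lesssim B$ means $A\le CB$ with $C$ depending only on $m,\vec r,\vec\rho,\vec t$ and the sparsity/Carleson constant of $\mathcal{S}$ (not on $X,\mu,\mathcal{D}$, the weights or the functions). *)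

(* Defs.v *)
From HB Require Import structures.
From mathcomp Require Import all_boot all_order all_algebra.
From mathcomp Require Import all_classical all_reals all_analysis.
Set Implicit Arguments.
Unset Strict Implicit.
Unset Printing Implicit Defensive.
Import Order.TTheory GRing.Theory Num.Theory.
Import numFieldNormedType.Exports.

Local Open Scope classical_set_scope.
Local Open Scope ring_scope.
Local Open Scope ereal_scope.

Definition nonatomic (R : realType) (d : measure_display)
    (T : measurableType d) (mu : {measure set T -> \bar R}) : Prop :=
  forall A : set T, measurable A -> 0 < mu A ->
    exists B : set T, [/\ measurable B, B `<=` A & 0 < mu B < mu A].

Definition dyadic_grid (R : realType) (d : measure_display)
    (T : measurableType d) (mu : {measure set T -> \bar R})
    (D : set (set T)) : Prop :=
  [/\ countable D,
      forall Q, D Q -> measurable Q /\ 0 < mu Q < +oo &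
      forall Q Q', D Q -> D Q' ->
        [\/ Q `<=` Q', Q' `<=` Q | Q `&` Q' = set0]].

Definition sparse (R : realType) (d : measure_display)
    (T : measurableType d) (mu : {measure set T -> \bar R})
    (eta : R) (S : set (set T)) : Prop :=
  exists E : set T -> set T,
    (forall Q, S Q ->
      [/\ measurable (E Q), E Q `<=` Q & eta%:E * mu Q <= mu (E Q)])
    /\ trivIset S E.

(* A weight is finite-valued; it need not be locally integrable. *)
Definition weight (R : realType) (d : measure_display)
    (T : measurableType d) (w : T -> R) : Prop :=
  measurable_fun setT w /\ forall x, (0 <= w x)%R.

Definition dual_exponent (R : realType) (t : R) : R := (t / (t - 1))%R.

(* Supremum in [0, +oo]: the supremum of an empty family is 0, whereas
   ereal_sup set0 = -oo. *)
Definition nnsup (R : realType) (I : Type) (P : set I) (F : I -> \bar R) :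
    \bar R :=
  ereal_sup (0 |` [set F i | i in P]).

Definition average (R : realType) (d : measure_display)
    (T : measurableType d) (mu : {measure set T -> \bar R})
    (f : T -> R) (Q : set T) : \bar R :=
  (mu Q)^-1 * \int[mu]_(x in Q) (f x)%:E.

(* Products in [0, +oo] use 0 * +oo = 0 throughout. *)
Definition sparse_form (R : realType) (d : measure_display)
    (T : measurableType d) (mu : {measure set T -> \bar R})
    (D : set (set T)) (m : nat) (r rho : 'I_m -> R)
    (tau : set T -> R) (g : 'I_m -> T -> R) : \bar R :=
  \esum_(Q in D)
    ((tau Q)%:E * mu Q *
     \prod_(i < m)
       ((mu Q `^ (- (1 - rho i))) * \int[mu]_(x in Q) (g i x)%:E) `^ r i).

(* x `^ 0 = 1 for every x in [0, +oo], so factors with exponent 0 are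
   omitted. *)
Definition maximal (R : realType) (d : measure_display)
    (T : measurableType d) (mu : {measure set T -> \bar R})
    (D : set (set T)) (k : nat) (r : 'I_k -> R) (f : 'I_k -> T -> R)
    (x : T) : \bar R :=
  nnsup [set Q | D Q /\ Q x] (fun Q => \prod_(i < k) average mu (f i) Q `^ r i).

Definition muckenhoupt (R : realType) (d : measure_display)
    (T : measurableType d) (mu : {measure set T -> \bar R})
    (D : set (set T)) (m : nat) (q : 'I_m -> R) (w : 'I_m -> T -> R) : \bar R :=
  nnsup D (fun Q => \prod_(i < m) average mu (w i) Q `^ q i).

(* Quotient of a, b in [0, +oo] with a / 0 = +oo for a > 0, 0 / 0 = 0 and
   +oo / +oo = +oo. In the library +oo / +oo = 0; with that value the
   Fujii-Wilson characteristic of tuples of non-locally-integrable weights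
   could be 0. *)
Definition quotient0y (R : realType) (a b : \bar R) : \bar R :=
  if a == +oo then +oo else a / b.

Definition fujii_wilson (R : realType) (d : measure_display)
    (T : measurableType d) (mu : {measure set T -> \bar R})
    (D : set (set T)) (m : nat) (beta : 'I_m -> R) (w : 'I_m -> T -> R) :
    \bar R :=
  let b := (\sum_(i < m) beta i)%R in
  let v := fun i => (beta i / b)%R in
  nnsup D (fun Q =>
    quotient0y
      ((\int[mu]_(x in Q)
          maximal mu D v (fun i y => (\1_Q y * w i y)%R) x) `^ b)
      ((\int[mu]_(x in Q) (\prod_(i < m) (w i x `^ v i)%R)%R%:E) `^ b)).

(* The vector (beta_i)_{i <> j}, with entry 0 at j. *)
Definition omit (R : realType) (m : nat) (j : 'I_m) (beta : 'I_m -> R) :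
    'I_m -> R :=
  fun i => if i == j then 0%R else beta i.

(* The norm of L^p(w), for 0 < p < oo and f >= 0. *)
Definition weighted_Lnorm (R : realType) (d : measure_display)
    (T : measurableType d) (mu : {measure set T -> \bar R})
    (w : T -> R) (p : R) (f : T -> R) : \bar R :=
  (\int[mu]_x (f x `^ p * w x)%R%:E) `^ p^-1.

Definition distribution_function (R : realType) (d : measure_display)
    (T : measurableType d) (mu : {measure set T -> \bar R})
    (w : T -> R) (f : T -> R) (s : R) : \bar R :=
  \int[mu]_(x in [set x | (s < f x)%R]) (w x)%:E.

(* The quasi-norm of L^{p,q}(w), for 0 < p, q < oo and f >= 0:
   p^(1/q) (\int_0^oo (s (w mu){f > s}^(1/p))^q ds/s)^(1/q), which equals
   (\int_0^oo (s^(1/p) f^*(s))^q ds/s)^(1/q) for the decreasing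
   rearrangement f^* with respect to w mu. *)
Definition lorentz_norm (R : realType) (d : measure_display)
    (T : measurableType d) (mu : {measure set T -> \bar R})
    (w : T -> R) (p q : R) (f : T -> R) : \bar R :=
  (p `^ q^-1)%R%:E *
  (\int[@lebesgue_measure R]_(s in `]0%R, +oo[)
     ((s%:E * distribution_function mu w f s `^ p^-1) `^ q * (s^-1)%R%:E))
    `^ q^-1.

(* Main.v *)
(* For every index i let kap_i(Q) be the integer part of t_i ln of the largest
   w_i-average of f_i over the chosen cubes containing Q, and let Om_i(k) be the
   union of the cubes with kap_i = k. Since the r_i (1/t_i - rho_i) sum to 1, the
   term of a cube Q is at most a constant times
     prod_i (w_i)_Q^(r_i/t_i') * prod_i (w_i(Q) e^(kap_i(Q)))^(r_i/t_i).
   The first product is constant up to a factor e on each of the level sets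
   e^a <= . < e^(a+1), and these bounds sum to a geometric series in a with
   largest term [w]^(r_i/t_i').
   Split r_i/t_i = beta_i + r_i rho_i, with sum beta_i = 1. The excess r_i rho_i is
   estimated by the mass n_i = sum_k e^k w_i(Om_i(k)). For the remaining exponents,
   freeze the levels kap_i, i in J_r, and attach to every Q the largest cube G above
   it with the same levels. The cubes Q attached to G are summed by Kolmogorov's
   inequality, which needs exponents of sum < 1; these come from the lower bound e^a.
   Above G some level kap_j, j in J_s, jumps. The cubes G with the same jumping j and
   the same kap_j are disjoint, so sum_G w_j(G) e^(kap_j(G)) <= n_j, while the other
   factors are summed by the Fujii-Wilson condition without w_j and the Carleson
   embedding theorem; Hoelder's inequality joins the two.
   Finally n_i is bounded by the t_i-th power of the L^(t_i)-norm of f_i, and for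
   i in J_r the sum over the frozen levels of (e^k w_i(Om_i(k)))^(r_i/t_i) is
   bounded by the r_i-th power of the Lorentz norm. *)

Require Import Defs.
From HB Require Import structures.
From mathcomp Require Import all_boot all_order all_algebra.
From mathcomp Require Import all_classical all_reals all_analysis.
From mathcomp Require Import measurable_realfun zify ring lra.
Import Order.TTheory GRing.Theory Num.Theory.
Import numFieldNormedType.Exports.
Set Implicit Arguments.
Unset Strict Implicit.
Unset Printing Implicit Defensive.
Local Open Scope classical_set_scope.
Local Open Scope ring_scope.

(** * Real sums and powers *)

(** The sparse form is a supremum over finite subfamilies, so a finite list of cubes is fixed;
    largest cubes and finite maxima then exist. Since 0 * oo = 0, a vanishing factor on the right
    could hide an infinite one. Cubes on which some f_i w_i has integral 0 are therefore discarded.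
    If a cube remains, every factor on the right is positive, an infinite right side is trivial, and
    otherwise the estimate is one between positive reals. The obstacle is that the exponents beta_i
    add up to exactly 1, the endpoint at which Kolmogorov's inequality is lost. On one level of the
    Muckenhoupt product a small power of that product is constant up to a factor, so it can be
    traded for smaller exponents. Freezing is what produces the Lorentz norms: a level that varies
    inside the core estimate contributes the power r_i/t_i of a sum over k, a frozen one the sum
    over k of the powers r_i/t_i. A frozen level cannot jump, which is why the Fujii-Wilson
    characteristics run over J_s alone. *)

(** Union bound: an index may be counted for several [j]. It sorts cubes by level, by jump, or by
    tuple of frozen levels. *)
Lemma ler_sum_cover (R : numDomainType) (I : eqType) (J : Type)
    (s : seq I) (c : seq J) (h : I -> J -> bool) (g : I -> R) :
  (forall i, i \in s -> 0 <= g i) -> (forall i, i \in s -> has (h i) c) ->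
  \sum_(i <- s) g i <= \sum_(j <- c) \sum_(i <- s | h i j) g i.
Proof.
move=> g0 hc.
under [leRHS]eq_bigr do rewrite big_mkcond/=.
rewrite exchange_big/= big_seq [leRHS]big_seq; apply: ler_sum => i si.
have := hc _ si; elim: c {hc} => //= j c IH.
rewrite big_cons; case: (h i j) => /= [_|/IH]; last by rewrite add0r.
by rewrite lerDl sumr_ge0// => k _; case: ifP => // _; exact: g0.
Qed.

Lemma ler_sum_uniq_sub (R : numDomainType) (I : eqType) (s s' : seq I)
    (g : I -> R) :
  uniq s -> {subset s <= s'} -> (forall i, i \in s' -> 0 <= g i) ->
  \sum_(i <- s) g i <= \sum_(i <- s') g i.
Proof.
elim: s s' => [|x s IH] s' /=; first by move=> _ _ g0; rewrite big_nil big_seq sumr_ge0.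
move=> /andP[xs us] ss' g0; have xs' : x \in s' by apply: ss'; rewrite mem_head.
rewrite big_cons (perm_big _ (perm_to_rem xs')) big_cons lerD2l IH//.
- move=> y ys; have := ss' y; rewrite inE ys orbT => /(_ isT).
  rewrite (perm_mem (perm_to_rem xs')) inE => /orP[/eqP yx|//].
  by rewrite -yx ys in xs.
- by move=> y /mem_rem; exact: g0.
Qed.

Lemma powR_prod (R : realType) (I : Type) (s : seq I) (P : pred I)
    (x : I -> R) (p : R) : (forall i, 0 <= x i) ->
  (\prod_(i <- s | P i) x i) `^ p = \prod_(i <- s | P i) x i `^ p.
Proof.
move=> x0; elim: s => [|i s IH]; first by rewrite !big_nil powR1.
rewrite !big_cons; case: ifP => // _.
by rewrite powRM ?IH// prodr_ge0.
Qed.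

Lemma powR_sum (R : realType) (I : Type) (s : seq I) (P : pred I)
    (x : R) (p : I -> R) : 0 < x ->
  x `^ (\sum_(i <- s | P i) p i) = \prod_(i <- s | P i) x `^ p i.
Proof.
move=> x0; apply: (big_morph (fun q => x `^ q)); last exact: powRr0.
by move=> a b; rewrite powRD// (gt_eqF x0) implybT.
Qed.

(** A crude weighted AM-GM inequality: every [x i] is at most the sum M, so the product is at most M
    to the power 1. *)
Lemma prod_powR_le_sum (R : realType) (I : finType) (x th : I -> R) :
  (forall i, 0 <= x i) -> (forall i, 0 <= th i) -> \sum_i th i = 1 ->
  \prod_i x i `^ th i <= \sum_i x i.
Proof.
move=> x0 th0 th1; set M := \sum_i x i.
have xM i : x i <= M by rewrite /M (bigD1 i)//= lerDl sumr_ge0.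
(* For M = 0 the powers cannot be collected, as a zero base to the power 0 is 1. Some exponent is
   nonzero because they add up to 1, and its factor vanishes. *)
have : 0 <= M by exact: sumr_ge0.
rewrite le_eqVlt => /predU1P[M0|M0].
  have [i thi] : exists i, th i != 0.
    apply: contrapT => /forallNP h.
    move: th1; rewrite big1 => [/eqP|i _]; first by rewrite eq_sym oner_eq0.
    by apply/eqP/negPn/negP/h.
  rewrite (bigD1 i)//= (_ : x i = 0) ?powR0 ?mul0r -?M0//.
  by apply/eqP; rewrite eq_le x0 M0 xM.
have -> : M = \prod_i M `^ th i by rewrite -powR_sum// th1 powRr1// ltW.
apply: ler_prod => i _.
by rewrite powR_ge0/= ge0_ler_powR ?nnegrE ?x0 ?xM// ltW.
Qed.

Lemma powR_interp_le_sum (R : realType) (x y b : R) :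
  0 <= x -> 0 <= y -> 0 < b < 1 -> x `^ b * y `^ (1 - b) <= x + y.
Proof.
move=> x0 y0 /andP[b0 b1].
have := @prod_powR_le_sum R bool (fun i => if i then x else y)
  (fun i => if i then b else 1 - b).
rewrite !big_bool /=; apply=> [[]|[]|] //; lra.
Qed.

(** Hölder's inequality with a constant 2: after division by [X] and [Y] the pointwise interpolation
    bound is summed, and each normalised sum is at most 1. *)
Lemma sum_interp_le (R : realType) (I : Type) (s : seq I) (P : pred I)
    (x y : I -> R) (X Y b : R) :
  (forall i, P i -> 0 <= x i) -> (forall i, P i -> 0 <= y i) -> 0 < b < 1 ->
  0 < X -> 0 < Y -> \sum_(i <- s | P i) x i <= X ->
  \sum_(i <- s | P i) y i <= Y ->
  \sum_(i <- s | P i) x i `^ b * y i `^ (1 - b) <= 2 * (X `^ b * Y `^ (1 - b)).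
Proof.
move=> x0 y0 b01 X0 Y0 xX yY.
apply: (@le_trans _ _ (\sum_(i <- s | P i)
    (X `^ b * Y `^ (1 - b)) * (x i / X + y i / Y))).
  apply: ler_sum => i Pi; rewrite -[in x i `^ b](divfK (lt0r_neq0 X0) (x i)).
  rewrite -[in y i `^ (1 - b)](divfK (lt0r_neq0 Y0) (y i)).
  have xi0 : 0 <= x i / X by rewrite divr_ge0 ?x0// ltW.
  have yi0 : 0 <= y i / Y by rewrite divr_ge0 ?y0// ltW.
  rewrite (powRM _ xi0 (ltW X0)) (powRM _ yi0 (ltW Y0)) mulrACA [leLHS]mulrC.
  rewrite ler_wpM2l ?mulr_ge0 ?powR_ge0//.
  exact: powR_interp_le_sum.
rewrite -mulr_sumr mulrC ler_wpM2r ?mulr_ge0 ?powR_ge0// big_split/=.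
rewrite -!mulr_suml (_ : 2 = 1 + 1 :> R)// lerD// ler_pdivrMr// mul1r//.
Qed.

Lemma sum_geom_le (R : realType) (q : R) (s : seq nat) :
  0 <= q < 1 -> uniq s -> \sum_(n <- s) q ^+ n <= (1 - q)^-1.
Proof.
move=> /andP[q0 q1] us; pose N := (\max_(n <- s) n).+1.
apply: (@le_trans _ _ (\sum_(n <- iota 0 N) q ^+ n)).
  apply: ler_sum_uniq_sub => // [n ns|n _]; last exact: exprn_ge0.
  by rewrite mem_iota/= add0n ltnS (big_rem n)//= leq_maxl.
have q1' : 0 < 1 - q by rewrite subr_gt0.
rewrite -(ler_pM2l q1') divff ?gt_eqF//.
have -> : iota 0 N = index_iota 0 N by rewrite /index_iota subn0.
rewrite big_mkord -opprB mulNr -subrX1 opprB.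
by rewrite lerBlDr lerDl exprn_ge0.
Qed.

(** The distances of the distinct integers k to the floor of z are distinct naturals, so the sum is
    a part of a geometric series of ratio expR (- e), scaled by its largest possible term. *)
Lemma sum_expR_int_le (R : realType) (e : R) : 0 < e ->
  exists2 C : R, 0 < C & forall (K : seq int) (z : R), uniq K ->
    (forall k, k \in K -> k%:~R <= z) ->
    \sum_(k <- K) expR (e * k%:~R) <= C * expR (e * z).
Proof.
move=> e0; pose q : R := expR (- e).
have q01 : 0 <= q < 1 by rewrite expR_ge0/= /q expR_lt1 oppr_lt0.
have q1 : 0 < 1 - q by case/andP: q01 => _; rewrite subr_gt0.
exists (1 - q)^-1; first by rewrite invr_gt0.
move=> K z uK Kz; pose h k := `|Num.floor z - k|%N.
have Kf k : k \in K -> k <= Num.floor z by move=> /Kz; rewrite floor_ge_int.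
have hE k : k \in K -> (h k)%:R = (Num.floor z)%:~R - k%:~R :> R.
  by move=> /Kf kf; rewrite /h natr_absz ger0_norm ?subr_ge0// intrB.
apply: (@le_trans _ _ (\sum_(k <- K) expR (e * z) * q ^+ h k)).
  rewrite big_seq [leRHS]big_seq; apply: ler_sum => k kK.
  rewrite /q -expRM_natr -expRD ler_expR (hE _ kK).
  have : (Num.floor z)%:~R <= z by exact: floor_le.
  move=> fz; have := ler_wpM2l (ltW e0) fz; lra.
rewrite -mulr_sumr mulrC ler_wpM2r ?expR_ge0//.
rewrite -(big_map h predT (fun n => q ^+ n)); apply: sum_geom_le => //.
rewrite map_inj_in_uniq// => j k jK kK hjk.
have := hE _ jK; rewrite hjk hE// => /addrI/oppr_inj/intr_inj.
by move=> ->.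
Qed.

(** * Laminar families *)

Lemma seq_max_rel (I : eqType) (r : rel I) (s : seq I) :
  transitive r -> s != [::] ->
  exists2 x, x \in s & forall y, y \in s -> r x y -> r y x.
Proof.
move=> rtr; elim: s => // a [|b s] IH _.
  by exists a; rewrite ?mem_head// => y; rewrite inE => /eqP ->.
have [//|m ms mmax] := IH; have [rma|rma] := boolP (r m a).
  exists a; rewrite ?mem_head// => y; rewrite inE => /predU1P[->//|ys ray].
  apply: (rtr m _ _ _ rma); apply: mmax => //; exact: rtr ray.
exists m; first by rewrite inE ms orbT.
by move=> y; rewrite inE => /predU1P[->|]; [rewrite (negbTE rma)|exact: mmax].
Qed.

Definition subsetb (T : Type) : rel (set T) := fun P Q => `[< P `<=` Q >].

Lemma subsetb_trans (T : Type) : transitive (@subsetb T).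
Proof. by move=> B A C /asboolP AB /asboolP BC; apply/asboolP; exact: subset_trans BC. Qed.

Lemma subsetb_refl (T : Type) : reflexive (@subsetb T).
Proof. by move=> A; apply/asboolP. Qed.

Lemma subsetb_anti (T : Type) (A B : set T) : subsetb A B -> subsetb B A -> A = B.
Proof. by move=> /asboolP AB /asboolP BA; apply/seteqP. Qed.

Definition laminar (T : Type) (s : seq (set T)) :=
  forall P Q : set T, P \in s -> Q \in s ->
    [\/ P `<=` Q, Q `<=` P | P `&` Q = set0].

Lemma laminar_sub (T : Type) (s s' : seq (set T)) :
  {subset s' <= s} -> laminar s -> laminar s'.
Proof. by move=> ss lam P Q /ss Ps /ss Qs; exact: lam. Qed.

Lemma laminar_chain (T : Type) (s : seq (set T)) (P Q : set T) (x : T) :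
  laminar s -> P \in s -> Q \in s -> P x -> Q x -> subsetb P Q || subsetb Q P.
Proof.
move=> lam Ps Qs Px Qx; case: (lam _ _ Ps Qs) => [PQ|QP|PQ0].
- by apply/orP; left; apply/asboolP.
- by apply/orP; right; apply/asboolP.
- by have : (P `&` Q) x by []; rewrite PQ0.
Qed.

Lemma seq_min_subset (T : Type) (s : seq (set T)) : s != [::] ->
  exists2 P, P \in s & forall Q : set T, Q \in s -> subsetb Q P -> Q = P.
Proof.
move=> s0; have [] := @seq_max_rel _ (fun P Q => subsetb Q P) _ _ s0.
  by move=> B A C /[swap]; exact: subsetb_trans.
by move=> P Ps Pmin; exists P => // Q Qs QP; apply: subsetb_anti => //; exact: Pmin.
Qed.

Lemma seq_max_subset (T : Type) (s : seq (set T)) : s != [::] ->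
  exists2 P, P \in s & forall Q : set T, Q \in s -> subsetb P Q -> Q = P.
Proof.
move=> s0; have [|P Ps Pmax] := @seq_max_rel _ (@subsetb T) _ _ s0.
  exact: subsetb_trans.
by exists P => // Q Qs PQ; apply: subsetb_anti => //; exact: Pmax.
Qed.

(* In a laminar family the sets containing x form a chain, so there is a
   smallest one. *)
Lemma laminar_smallest (T : Type) (s : seq (set T)) (p : pred (set T)) (x : T) :
  laminar s -> (forall P : set T, P \in s -> p P -> P x) -> has p s ->
  exists Q : set T, [/\ Q \in s, p Q & forall P : set T, P \in s -> p P -> subsetb Q P].
Proof.
move=> lam px hs; have [|Q] := @seq_min_subset _ [seq P <- s | p P].
  by rewrite -has_filter.
rewrite mem_filter => /andP[pQ Qs] Qmin; exists Q; split=> // P Ps pP.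
have := laminar_chain lam Ps Qs (px _ Ps pP) (px _ Qs pQ).
by case/orP => // /[dup] PQ /Qmin ->; rewrite ?subsetb_refl// mem_filter pP.
Qed.

(** [delta] is the increment of [phi] from the parent of a set to the set, so summing it over the
    ancestors of Q returns [phi Q]. The induction removes an inclusion-minimal set, which is an
    ancestor of no other member. *)
Lemma laminar_telescope (R : realDomainType) (T : Type) (s : seq (set T))
    (phi : set T -> R) :
  uniq s -> laminar s -> (forall P : set T, P \in s -> P !=set0) ->
  (forall P : set T, P \in s -> 0 <= phi P) ->
  (forall P Q : set T, P \in s -> Q \in s -> subsetb P Q -> phi Q <= phi P) ->
  exists delta : set T -> R, (forall P : set T, P \in s -> 0 <= delta P) /\
    forall Q : set T, Q \in s -> \sum_(P <- s | subsetb Q P) delta P = phi Q.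
Proof.
have [n] := ubnP (size s); elim: n s => // n IH s.
have [->|sn0] := eqVneq s [::]; first by exists (fun=> 0); split.
rewrite ltnS => sn us lam s0 phi0 phia.
have [Q0 Q0s Q0min] := seq_min_subset sn0.
pose s' := rem Q0 s.
have s's : {subset s' <= s} by exact: mem_rem.
have Q0s' : Q0 \notin s' by rewrite mem_rem_uniq// inE eqxx.
have /= [||||||d [d0 dphi]] := IH s'.
- by rewrite size_rem// -subn1; case: (s) sn0 sn => //= a l _; rewrite subn1.
- exact: rem_uniq.
- exact: laminar_sub lam.
- by move=> P /s's; exact: s0.
- by move=> P /s's; exact: phi0.
- by move=> P Q /s's Ps /s's Qs; exact: phia.
(* By induction [S0] is the value of [phi] at the parent of [Q0], or 0 if there is none. The parent
   exists because all supersets of [Q0] share a point of it and hence form a chain. *)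
pose S0 := \sum_(P <- s' | subsetb Q0 P) d P.
have S0phi : S0 <= phi Q0.
  have [hs|/hasPn hs] := boolP (has (subsetb Q0) s'); last first.
    by rewrite /S0 big_seq_cond big1 ?phi0// => P /andP[/hs/negbTE ->].
  have [x Q0x] := s0 _ Q0s.
  have lam' := laminar_sub s's lam.
  have [|P0 [P0s P0Q P0min]] := laminar_smallest lam' (x := x) _ hs.
    by move=> P _ /asboolP; apply.
  have -> : S0 = phi P0.
    rewrite -dphi// /S0 big_seq_cond [RHS]big_seq_cond; apply: eq_bigl => P.
    have [Ps|//] := boolP (P \in s'); apply/idP/idP; first exact: P0min.
    exact: subsetb_trans.
  exact: phia (s's _ P0s) _.
exists (fun P => if P == Q0 then phi Q0 - S0 else d P); split.
  move=> P Ps; case: eqVneq => [_|PQ0]; first by rewrite subr_ge0.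
  by apply: d0; rewrite mem_rem_uniq// inE PQ0.
move=> Q Qs; rewrite (big_rem _ Q0s)/= eqxx.
have h : \sum_(P <- s' | subsetb Q P) (if P == Q0 then phi Q0 - S0 else d P)
    = \sum_(P <- s' | subsetb Q P) d P.
  rewrite big_seq_cond [RHS]big_seq_cond; apply: eq_bigr => P /andP[Ps' _].
  by case: eqVneq => // PQ0; rewrite PQ0 (negbTE Q0s') in Ps'.
rewrite -/s' h; have [->|QQ0] := eqVneq Q Q0; first by rewrite subsetb_refl subrK.
rewrite ifF ?add0r; last first.
  by apply: contraNF QQ0 => /(Q0min _ Qs) ->.
by apply: dphi; rewrite mem_rem_uniq// inE QQ0.
Qed.

(** * Integrals over finite laminar families and the Carleson embedding *)

Local Open Scope ereal_scope.

(** The integral of a nonnegative function is a supremum over the simple functions below it, so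
    monotonicity holds for arbitrary functions. In this form it applies to [maximal]. *)
Lemma le_integral_ge0 d (T : measurableType d) (R : realType)
    (mu : {measure set T -> \bar R}) (D : set T) (f g : T -> \bar R) :
  (forall x, D x -> 0 <= f x) -> (forall x, D x -> f x <= g x) ->
  \int[mu]_(x in D) f x <= \int[mu]_(x in D) g x.
Proof.
move=> f0 fg; have g0 x : D x -> 0 <= g x by move=> Dx; rewrite (le_trans _ (fg _ Dx)) ?f0.
rewrite !ge0_integralE//; apply: ereal_sup_le => _ [h /= hf <-]; exists h => //= x.
by apply: le_trans (hf x) _; exact: lee_restrict.
Qed.

Lemma bigsetU_seqP (T : Type) (I : choiceType) (s : seq I) (F : I -> set T) (x : T) :
  (\big[setU/set0]_(i <- s) F i) x <-> exists2 i, i \in s & F i x.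
Proof. by rewrite -bigcup_seq; split=> -[i si Fi]; exists i. Qed.

Lemma ge0_integral_sum_seq d (T : measurableType d) (R : realType)
    (mu : {measure set T -> \bar R}) (D : set T) (I : eqType) (s : seq I)
    (f : I -> T -> \bar R) : measurable D ->
  (forall i, i \in s -> measurable_fun D (f i)) ->
  (forall i x, i \in s -> D x -> 0 <= f i x) ->
  \int[mu]_(x in D) (\sum_(i <- s) f i x) =
  \sum_(i <- s) \int[mu]_(x in D) f i x.
Proof.
move=> mD mf f0; pose g i := if i \in s then f i else cst 0.
transitivity (\int[mu]_(x in D) (\sum_(i <- s) g i x)).
  apply: eq_integral => x _; rewrite big_seq [RHS]big_seq.
  by apply: eq_bigr => i si; rewrite /g si.
rewrite ge0_integral_sum//.
- by rewrite big_seq [RHS]big_seq; apply: eq_bigr => i si; rewrite /g si.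
- by move=> i; rewrite /g; case: ifPn => // /mf.
- by move=> i x Dx; rewrite /g; case: ifPn => // si; exact: f0.
Qed.

Definition wmass d (T : measurableType d) (R : realType)
    (mu : {measure set T -> \bar R}) (w : T -> R) (A : set T) : \bar R :=
  \int[mu]_(x in A) (w x)%:E.

Section weighted_mass.
Context d (T : measurableType d) (R : realType) (mu : {measure set T -> \bar R}).
Implicit Types (w g : T -> R) (A B : set T) (s : seq (set T)).

Lemma weight_measurable w A : weight w -> measurable_fun A (EFin \o w).
Proof. by move=> [mw _]; apply/measurable_EFinP; exact: measurable_funTS. Qed.

Lemma wmass_ge0 w A : weight w -> 0 <= wmass mu w A.
Proof. by move=> [_ w0]; apply: integral_ge0 => x _; rewrite lee_fin. Qed.

Lemma wmassU w A B : weight w -> measurable A -> measurable B ->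
  A `&` B = set0 -> wmass mu w (A `|` B) = wmass mu w A + wmass mu w B.
Proof.
move=> ww mA mB AB; rewrite /wmass ge0_integral_setU//.
- exact: weight_measurable.
- by move=> x _; rewrite lee_fin; exact: ww.2.
- exact/disj_set2P.
Qed.

Lemma le_wmass w A B : weight w -> measurable A -> measurable B -> A `<=` B ->
  wmass mu w A <= wmass mu w B.
Proof.
move=> ww mA mB; apply: ge0_subset_integral => //; first exact: weight_measurable.
by move=> x _; rewrite lee_fin; exact: ww.2.
Qed.

Lemma wmass_indic w A B : measurable A -> measurable B ->
  wmass mu (fun x => \1_B x * w x)%R A = wmass mu w (A `&` B).
Proof.
move=> mA mB; rewrite /wmass integral_mkcondr; apply: eq_integral => x _.
rewrite patchE indicE; by case: (x \in B); rewrite ?mul1r ?mul0r.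
Qed.

Lemma weight_mul w g : weight w -> weight g -> weight (fun x => w x * g x)%R.
Proof.
move=> [mw w0] [mg g0]; split; first exact: measurable_funM.
by move=> x; rewrite mulr_ge0.
Qed.

Lemma weight_indic B : measurable B -> weight (\1_B : T -> R).
Proof. by move=> mB; split=> // x; rewrite indicE. Qed.

Lemma wmass_cst A : measurable A -> wmass mu (cst 1%R) A = mu A.
Proof. by move=> mA; rewrite /wmass (integral_cst mu mA 1) mul1e. Qed.

(* The weak type (1,1) estimate: the maximal sets of the family are disjoint. *)
Lemma laminar_wmass_le w g s (c : R) : weight w -> weight g -> (0 <= c)%R ->
  laminar s -> (forall Q, Q \in s -> measurable Q) ->
  (forall Q, Q \in s -> c%:E * wmass mu w Q <= wmass mu g Q) ->
  c%:E * wmass mu w (\big[setU/set0]_(Q <- s) Q) <=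
  wmass mu g (\big[setU/set0]_(Q <- s) Q).
Proof.
move=> ww wg c0; have [n] := ubnP (size s); elim: n s => // n IH [|Q s].
  by move=> *; rewrite big_nil /wmass !integral_set0 mule0.
rewrite /= ltnS => sn lam ms cQ; rewrite big_cons.
have ss P : P \in s -> P \in Q :: s by rewrite inE orbC => ->.
have [/hasP[P Ps /asboolP QP]|/hasPn nQ] := boolP (has (subsetb Q) s).
  have QU : Q `<=` \big[setU/set0]_(Q <- s) Q.
    by move=> x Qx; apply/bigsetU_seqP; exists P => //; exact: QP.
  rewrite (setUidr QU); apply: IH => //.
  - exact: laminar_sub lam.
  - by move=> A /ss; exact: ms.
  - by move=> A /ss; exact: cQ.
pose s' := [seq P <- s | ~~ subsetb P Q].
have s's P : P \in s' -> P \in s by rewrite mem_filter => /andP[].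
have -> : Q `|` \big[setU/set0]_(P <- s) P = Q `|` \big[setU/set0]_(P <- s') P.
  apply/seteqP; split=> x [Qx|/bigsetU_seqP[P Ps Px]]; try by left.
    have [/asboolP PQ|PQ] := boolP (subsetb P Q); first by left; exact: PQ.
    by right; apply/bigsetU_seqP; exists P => //; rewrite mem_filter PQ.
  by right; apply/bigsetU_seqP; exists P => //; exact: s's.
have Qs : Q \in Q :: s by rewrite mem_head.
have mU : measurable (\big[setU/set0]_(P <- s') P).
  by rewrite big_seq; apply: bigsetU_measurable => P /s's/ss; exact: ms.
have QU0 : Q `&` \big[setU/set0]_(P <- s') P = set0.
  apply/seteqP; split=> // x [Qx /bigsetU_seqP[P Ps' Px]].
  have Ps := s's _ Ps'; move: Ps'; rewrite mem_filter => /andP[PQ _].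
  have /orP[|/negPn] := laminar_chain lam Qs (ss _ Ps) Qx Px.
    by apply/negP; exact: nQ.
  by rewrite PQ.
rewrite !wmassU//; [|exact: ms|exact: ms].
rewrite ge0_muleDr ?wmass_ge0//; apply: leeD; first exact: cQ.
apply: IH.
- by apply: leq_ltn_trans sn; rewrite size_filter count_size.
- by apply: laminar_sub lam => P /s's/ss.
- by move=> A /s's/ss; exact: ms.
- by move=> A /s's/ss; exact: cQ.
Qed.

(** The sets [E Q] are disjoint, lie in the union, and each carries the fraction [eta] of the mass
    of Q. *)
Lemma sparse_sum_le (eta : R) (S : set (set T)) (E : set T -> set T) s :
  (0 <= eta)%R -> uniq s -> (forall Q, Q \in s -> S Q) ->
  (forall Q, Q \in s -> measurable Q) ->
  (forall Q, S Q -> [/\ measurable (E Q), E Q `<=` Q & eta%:E * mu Q <= mu (E Q)]) ->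
  trivIset S E ->
  eta%:E * \sum_(Q <- s) mu Q <= mu (\big[setU/set0]_(Q <- s) Q).
Proof.
move=> eta0 us sS ms SE tE.
rewrite ge0_sume_distrr//.
apply: (@le_trans _ _ (\sum_(Q <- s) mu (E Q))).
  by rewrite big_seq [leRHS]big_seq; apply: lee_sum => Q /sS /SE[].
have mE Q : Q \in s -> measurable (E Q) by move=> /sS /SE[].
apply: (@le_trans _ _ (mu (\big[setU/set0]_(Q <- s) E Q))); last first.
  apply: le_measure; rewrite ?inE ?big_seq; try exact: bigsetU_measurable.
  rewrite -!big_seq => x /bigsetU_seqP[Q Qs EQx]; apply/bigsetU_seqP.
  by exists Q => //; have [_ + _] := SE _ (sS _ Qs); apply.
elim: s us sS {ms} mE => [|Q s IH] /= us sS mE; first by rewrite !big_nil.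
move: us => /andP[Qs us]; rewrite !big_cons measureU.
- by rewrite leeD2l// IH// => P Ps; [apply: sS|apply: mE]; rewrite inE Ps orbT.
- by apply: mE; rewrite mem_head.
- by rewrite big_seq; apply: bigsetU_measurable => P Ps; apply: mE; rewrite inE Ps orbT.
- apply/seteqP; split=> // x [EQx /bigsetU_seqP[P Ps EPx]].
  suff QP : Q = P by rewrite QP Ps in Qs.
  apply: tE; [by apply: sS; rewrite mem_head| |by exists x].
  by apply: sS; rewrite inE Ps orbT.
Qed.

(** Summation by parts: [phi Q] is expanded into increments over the ancestors P of Q and the sums
    are exchanged. The Carleson hypothesis bounds the sum of [c] below each P, and at a point x the
    increments add up again to a single value of [phi], which [N x] dominates. *)
Lemma carleson_embedding s (c phi : set T -> R) (K : R) (h N : T -> R) :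
  uniq s -> laminar s -> (forall Q, Q \in s -> Q !=set0) ->
  (forall Q, Q \in s -> measurable Q) -> weight h -> (0 <= K)%R ->
  (forall Q, Q \in s -> (0 <= c Q)%R) -> (forall Q, Q \in s -> (0 <= phi Q)%R) ->
  (forall P Q, P \in s -> Q \in s -> subsetb P Q -> (phi Q <= phi P)%R) ->
  (forall P, P \in s ->
    (\sum_(Q <- s | subsetb Q P) c Q)%R%:E <= K%:E * wmass mu h P) ->
  (forall x, (0 <= N x)%R) ->
  (forall Q x, Q \in s -> Q x -> (phi Q <= N x)%R) ->
  (\sum_(Q <- s) c Q * phi Q)%R%:E <= K%:E * \int[mu]_x (N x * h x)%R%:E.
Proof.
move=> us lam s0 ms wh K0 c0 phi0 phia cK N0 phiN.
have [del0 [del0_ge0 dphi0]] := laminar_telescope us lam s0 phi0 phia.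
(* Extension by 0 makes the increments nonnegative for all sets, not only for members of [s]. *)
pose del P := if P \in s then del0 P else 0%R.
have d0 P : (0 <= del P)%R by rewrite /del; case: ifP => // /del0_ge0.
have dphi Q : Q \in s -> (\sum_(P <- s | subsetb Q P) del P)%R = phi Q.
  move=> Qs; rewrite -dphi0// big_seq_cond [RHS]big_seq_cond.
  by apply: eq_bigr => P /andP[Ps _]; rewrite /del Ps.
have -> : (\sum_(Q <- s) c Q * phi Q =
    \sum_(P <- s) del P * \sum_(Q <- s | subsetb Q P) c Q)%R.
  transitivity (\sum_(Q <- s) \sum_(P <- s | subsetb Q P) c Q * del P)%R.
    by rewrite big_seq [RHS]big_seq; apply: eq_bigr => Q Qs; rewrite -mulr_sumr dphi.
  rewrite (exchange_big_dep predT)//=; apply: eq_bigr => P _.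
  by rewrite mulr_sumr; apply: eq_bigr => Q _; rewrite mulrC.
apply: (@le_trans _ _ (\sum_(P <- s) K%:E * ((del P)%:E * wmass mu h P))).
  rewrite -sumEFin big_seq [leRHS]big_seq; apply: lee_sum => P Ps.
  rewrite EFinM muleCA; apply: lee_wpmul2l; last exact: cK.
  by rewrite lee_fin d0.
have wh0 P : 0 <= wmass mu h P by exact: wmass_ge0.
rewrite -ge0_sume_distrr => [|P _]; last by rewrite mule_ge0// lee_fin.
apply: lee_wpmul2l; first by rewrite lee_fin.
have [mh h0] := wh.
have hP P : P \in s ->
    (del P)%:E * wmass mu h P = \int[mu]_x ((del P)%:E * (\1_P x * h x)%R%:E).
  move=> Ps; rewrite ge0_integralZl ?lee_fin//; last 2 first.
  - by apply/measurable_EFinP/measurable_funM => //; exact/measurable_indic/ms.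
  - by move=> x _; rewrite lee_fin mulr_ge0.
  by congr (_ * _); rewrite -[LHS]/(wmass mu _ _) -[P in LHS]setTI -wmass_indic//; exact: ms.
rewrite big_seq (eq_bigr _ hP) -big_seq -ge0_integral_sum_seq//; last 2 first.
- move=> P Ps; apply/measurable_EFinP/measurable_funM => //.
  by apply: measurable_funM => //; exact/measurable_indic/ms.
- by move=> P x _ _; rewrite mule_ge0// lee_fin// mulr_ge0.
apply: le_integral_ge0 => [x _|x _].
  by apply: sume_ge0 => P _; rewrite mule_ge0// lee_fin// mulr_ge0.
under eq_bigr do rewrite -EFinM mulrA.
rewrite sumEFin -mulr_suml lee_fin ler_wpM2r//.
have -> : (\sum_(P <- s) del P * \1_P x = \sum_(P <- s | x \in P) del P)%R.
  rewrite [RHS]big_mkcond/=; apply: eq_bigr => P _.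
  by rewrite indicE; case: (x \in P); rewrite ?mulr1 ?mulr0.
(* The members containing x are exactly the ancestors of the smallest one, Q, so the sum telescopes
   to [phi Q]. If no member contains x, it is 0. *)
have [hs|/hasPn hs] := boolP (has (fun P => x \in P) s); last first.
  by rewrite big_seq_cond big1// => P /andP[/hs/negbTE ->].
have [|Q [Qs Qx Qmin]] := laminar_smallest lam (x := x) _ hs.
  by move=> P _; rewrite inE.
rewrite inE in Qx; apply: le_trans (phiN _ _ Qs Qx); rewrite -dphi//.
rewrite big_seq_cond [leRHS]big_seq_cond le_eqVlt; apply/orP; left; apply/eqP.
apply: eq_bigl => P; have [Ps/=|//] := boolP (P \in s).
apply/idP/idP => [|/asboolP QP]; first exact: Qmin.
by rewrite inE; exact: QP.
Qed.

(** * The Fujii-Wilson characteristic *)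

Lemma maximal_ge (D : set (set T)) (k : nat) (v : 'I_k -> R) (f : 'I_k -> T -> R)
    (x : T) (Q : set T) : D Q -> Q x ->
  \prod_(i < k) average mu (f i) Q `^ v i <= maximal mu D v f x.
Proof. by move=> DQ Qx; apply: ereal_sup_ubound; right; exists Q. Qed.

Lemma maximal_ge0 (D : set (set T)) (k : nat) (v : 'I_k -> R) (f : 'I_k -> T -> R)
    (x : T) : 0 <= maximal mu D v f x.
Proof. by apply: ereal_sup_ubound; left. Qed.

Lemma prode_ge0 (I : Type) (r : seq I) (P : pred I) (F : I -> \bar R) :
  (forall i, P i -> 0 <= F i) -> 0 <= \prod_(i <- r | P i) F i.
Proof. by move=> F0; elim/big_ind : _ => // x y; exact: mule_ge0. Qed.

Lemma prode_gt0 (I : Type) (r : seq I) (P : pred I) (F : I -> \bar R) :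
  (forall i, P i -> 0 < F i) -> 0 < \prod_(i <- r | P i) F i.
Proof. by move=> F0; elim/big_ind : _ => // x y; exact: mule_gt0. Qed.

(** By disjointness at most one indicator is nonzero at x. *)
Lemma sum_disjoint_indic_le (U : Type) (I : eqType) (l : seq I) (F : I -> set U)
    (m : I -> \bar R) (B : \bar R) (x : U) :
  uniq l -> trivIset [set` l] F -> 0 <= B ->
  (forall i, i \in l -> F i x -> m i <= B) ->
  \sum_(i <- l) m i * (\1_(F i) x)%:E <= B.
Proof.
move=> ul tF B0; elim: l ul tF => [|i l IH] /=; first by rewrite big_nil.
move=> /andP[il ul] tF mB; rewrite big_cons.
have sub j : j \in l -> j \in i :: l by rewrite inE orbC => ->.
have [Fix|Fix] := pselect (F i x); last first.
  rewrite indicE memNset// mule0 add0e; apply: IH => //.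
    by apply: sub_trivIset tF => j; exact: sub.
  by move=> j /sub; exact: mB.
rewrite big_seq big1 ?adde0.
  by rewrite indicE mem_set// mule1; apply: mB => //; rewrite mem_head.
move=> j jl; rewrite indicE memNset ?mule0// => Fjx.
suff ij : i = j by rewrite ij jl in il.
by apply: tF; [rewrite /= mem_head|exact: sub|exists x].
Qed.

Lemma average_subset_indic w P Q : measurable P -> measurable Q -> Q `<=` P ->
  average mu (fun y => \1_P y * w y)%R Q = average mu w Q.
Proof.
move=> mP mQ QP; rewrite /average; congr (_ * _).
by rewrite -[LHS]/(wmass mu _ _) wmass_indic// setIidl.
Qed.

(** On [E Q] the maximal function is at least the product of averages over Q, and the sets [E Q] are
    disjoint. For Q inside P, cutting the weights off to P does not change these averages. *)
Lemma sparse_sum_le_maximal (eta : R) (S D : set (set T)) (E : set T -> set T) s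
    (k : nat) (v : 'I_k -> R) (w : 'I_k -> T -> R) (P : set T) :
  uniq s -> (forall Q, Q \in s -> S Q) -> S `<=` D ->
  (forall Q, Q \in s -> measurable Q) -> measurable P ->
  (forall Q, S Q -> [/\ measurable (E Q), E Q `<=` Q & eta%:E * mu Q <= mu (E Q)]) ->
  trivIset S E -> (0 <= eta)%R ->
  eta%:E * \sum_(Q <- s | subsetb Q P)
    mu Q * \prod_(i < k) average mu (w i) Q `^ v i <=
  \int[mu]_(x in P) maximal mu D v (fun i y => \1_P y * w i y)%R x.
Proof.
move=> us sS SD ms mP SE tE eta0.
pose m Q := \prod_(i < k) average mu (w i) Q `^ v i.
have m0 Q : 0 <= m Q by apply: prode_ge0 => i _; exact: poweR_ge0.
pose s' := [seq Q <- s | subsetb Q P].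
have s's Q : Q \in s' -> Q \in s by rewrite mem_filter => /andP[].
have s'P Q : Q \in s' -> Q `<=` P by rewrite mem_filter => /andP[/asboolP].
have mE Q : Q \in s' -> measurable (E Q) by move=> /s's/sS/SE[].
have EQ Q : Q \in s' -> E Q `<=` Q by move=> /s's/sS/SE[].
apply: (@le_trans _ _ (\int[mu]_(x in P) \sum_(Q <- s') m Q * (\1_(E Q) x)%:E)).
  rewrite ge0_integral_sum_seq//; last 2 first.
  - move=> Q Qs'; apply: emeasurable_funM => //.
    by apply/measurable_EFinP/measurable_indic/mE.
  - by move=> Q x Qs' Px; rewrite mule_ge0// lee_fin.
  rewrite -big_filter ge0_sume_distrr => [|Q _]; last by apply: mule_ge0 => //; exact: m0.
  rewrite big_seq [leRHS]big_seq; apply: lee_sum => Q Qs'.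
  rewrite ge0_integralZl//; last by apply/measurable_EFinP/measurable_indic/mE.
  rewrite integral_indic//; last exact: mE.
  rewrite setIidl; last by apply: subset_trans (EQ _ Qs') _; exact: s'P.
  rewrite muleA muleC lee_wpmul2l//.
    exact: m0.
  by have [] := SE _ (sS _ (s's _ Qs')).
apply: le_integral_ge0 => x Px.
  by apply: sume_ge0 => Q _; rewrite mule_ge0// lee_fin.
apply: sum_disjoint_indic_le.
- exact: filter_uniq.
- by apply: sub_trivIset tE => Q /s's/sS.
- exact: maximal_ge0.
move=> Q Qs' EQx; have Qs := s's _ Qs'.
apply: le_trans (@maximal_ge D k v _ x Q (SD _ (sS _ Qs)) (EQ _ Qs' _ EQx)).
rewrite /m le_eqVlt; apply/orP; left; apply/eqP; apply: eq_bigr => i _.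
by rewrite average_subset_indic//; [exact: ms|exact: s'P].
Qed.

(** The conventions of [quotient0y] make it possible to clear the denominator: an infinite numerator
    gives an infinite quotient, and a zero denominator forces [a] to be 0. *)
Lemma quotient0y_le (a b : \bar R) (K : R) : 0 <= a -> 0 <= b -> (0 < K)%R ->
  quotient0y a b <= K%:E -> a <= K%:E * b.
Proof.
rewrite /quotient0y; case: eqVneq => [->|ay] a0 b0 K0; first by rewrite leye_eq.
case: b b0 => [b| |//]; last first.
  by move=> _; rewrite gt0_muley ?leey// lte_fin.
rewrite lee_fin inver; case: eqVneq => [->|b0 bge].
  move: a0; rewrite le_eqVlt => /predU1P[<-|a0]; first by rewrite mule_ge0// ?lee_fin ltW.
  by rewrite gt0_muley// leye_eq.
have bgt : (0 < b)%R by rewrite lt_neqAle eq_sym b0.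
case: a a0 ay => [a| |//] //= a0 _; rewrite -!EFinM !lee_fin => aK.
by rewrite -ler_pdivrMr.
Qed.

Lemma fujii_wilson_integral_le (D : set (set T)) (k : nat) (beta : 'I_k -> R)
    (w : 'I_k -> T -> R) (K : R) (P : set T) :
  let b := (\sum_(i < k) beta i)%R in let v := fun i => (beta i / b)%R in
  D P -> (0 < b)%R -> (0 < K)%R -> (forall i, weight (w i)) ->
  fujii_wilson mu D beta w <= K%:E ->
  \int[mu]_(x in P) maximal mu D v (fun i y => \1_P y * w i y)%R x <=
  (K `^ b^-1)%:E * \int[mu]_(x in P) (\prod_(i < k) w i x `^ v i)%R%:E.
Proof.
move=> b v DP b0 K0 ww FW.
set M := integral _ _ _; set N := integral _ _ _.
have M0 : 0 <= M by apply: integral_ge0 => x _; exact: maximal_ge0.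
have N0 : 0 <= N.
  by apply: integral_ge0 => x _; rewrite lee_fin prodr_ge0// => i _; exact: powR_ge0.
have : M `^ b <= K%:E * N `^ b.
  apply: quotient0y_le; rewrite ?poweR_ge0//; apply: le_trans FW.
  by apply: ereal_sup_ubound; right; exists P.
have binv : (0 <= b^-1)%R by rewrite invr_ge0 ltW.
have inoo (x : \bar R) : 0 <= x -> x \in `[0, +oo] by move=> x0; rewrite in_itv/= x0 leey.
move=> /(gt0_ler_poweR binv (inoo _ (poweR_ge0 _ _))) => /(_ _)/wrap[].
  by apply: inoo; rewrite mule_ge0 ?poweR_ge0// lee_fin ltW.
by rewrite poweRM ?poweR_ge0 ?lee_fin ?(ltW K0)// -!poweRrM divff ?gt_eqF// !poweRe1.
Qed.

(** Guards against a right side of the form 0 * oo. The maximal function is bounded below on Q by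
    the positive product of averages, so the numerator is positive; the quotient could vanish only
    through a finite numerator over an infinite denominator. *)
Lemma fujii_wilson_gt0 (D : set (set T)) (k : nat) (beta : 'I_k -> R)
    (w : 'I_k -> T -> R) (Q : set T) :
  D Q -> measurable Q -> 0 < mu Q < +oo -> (0 < \sum_(i < k) beta i)%R ->
  (forall i, (0 <= beta i)%R) ->
  (forall i, weight (w i)) -> (forall i, 0 < wmass mu (w i) Q) ->
  0 < fujii_wilson mu D beta w.
Proof.
move=> DQ mQ /andP[muQ0 muQy] b0 beta0 ww w0; set b := (\sum_(i < k) beta i)%R in b0 *.
pose v i := (beta i / b)%R.
have v0 i : (0 <= v i)%R by rewrite divr_ge0// ltW.
pose M := \int[mu]_(x in Q) maximal mu D v (fun i y => \1_Q y * w i y)%R x.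
pose N := \int[mu]_(x in Q) (\prod_(i < k) w i x `^ v i)%R%:E.
have N0 : 0 <= N.
  by apply: integral_ge0 => x _; rewrite lee_fin prodr_ge0// => i _; exact: powR_ge0.
suff : 0 < quotient0y (M `^ b) (N `^ b).
  by move=> /lt_le_trans; apply; apply: ereal_sup_ubound; right; exists Q.
have muQf : mu Q \is a fin_num by rewrite ge0_fin_numE.
have av0 i : 0 < average mu (w i) Q.
  apply: mule_gt0; last exact: w0.
  by rewrite inve_gt0 ?(gt_eqF muQ0)// (lt_eqF muQy).
pose c := \prod_(i < k) average mu (w i) Q `^ v i.
have c0 : 0 < c by apply: prode_gt0 => i _; exact: poweR_gt0.
have cM : c * mu Q <= M.
  rewrite -integral_cst//; apply: le_integral_ge0 => x Qx; first exact: ltW.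
  apply: le_trans (@maximal_ge D k v _ x Q DQ Qx); rewrite /cst /c le_eqVlt.
  by apply/orP; left; apply/eqP; apply: eq_bigr => i _; rewrite average_subset_indic.
have M0 : 0 < M by apply: lt_le_trans cM; exact: mule_gt0.
rewrite /quotient0y; case: ifPn => // Mby.
have My : M != +oo by apply: contra Mby => /eqP ->; rewrite poweRyr// gt_eqF.
(* A finite numerator makes the product of averages finite, hence also the mass of every weight with
   nonzero exponent, and the denominator is dominated by the sum of these masses. *)
have Ny : N < +oo.
  have cy : c < +oo.
    rewrite ltey; apply: contra My => /eqP cy; rewrite -leye_eq -(gt0_mulye muQ0) -cy.
    exact: cM.
  have wy i : v i != 0%R -> wmass mu (w i) Q < +oo.
    move=> vi; rewrite ltey; apply: contraTN cy => /eqP wy.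
    rewrite -leNgt leye_eq /c (bigD1 i)//= /average -/(wmass mu (w i) Q) wy.
    rewrite gt0_muley ?inve_gt0 ?(gt_eqF muQ0) ?(lt_eqF muQy)// poweRyr// gt0_mulye//.
    by apply: prode_gt0 => j _; apply: poweR_gt0; exact: av0.
  pose r0 := [seq i <- index_enum 'I_k | v i != 0%R].
  apply: (@le_lt_trans _ _ (\int[mu]_(x in Q) \sum_(i <- r0) (w i x)%:E)).
    apply: le_integral_ge0 => x _.
      by rewrite lee_fin prodr_ge0// => i _; exact: powR_ge0.
    rewrite sumEFin lee_fin big_filter.
    (* A factor with exponent 0 equals 1 for every base. Replacing its base by 0 removes that
       weight, whose mass may be infinite, from the bounding sum. *)
    apply: (@le_trans _ _ (\prod_(i < k) (if v i == 0 then 0 else w i x) `^ v i)%R).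
      rewrite le_eqVlt; apply/orP; left; apply/eqP; apply: eq_bigr => i _.
      by case: eqVneq => [->|//]; rewrite !powRr0.
    rewrite [leRHS]big_mkcond/=; under [leRHS]eq_bigr do rewrite if_neg.
    apply: prod_powR_le_sum => //.
    - by move=> i; case: ifP => // _; exact: (ww i).2.
    - by rewrite -mulr_suml divff// gt_eqF.
  rewrite ge0_integral_sum_seq//; last 2 first.
  - by move=> i _; exact: weight_measurable.
  - by move=> i x _ _; rewrite lee_fin; exact: (ww i).2.
  by rewrite big_filter; apply: lte_sum_pinfty => i vi; exact: wy.
have Nf : N \is a fin_num by rewrite ge0_fin_numE.
rewrite -(fineK Nf) poweR_EFin inver; case: ifPn => [_|Nb0].
  by rewrite gt0_muley// poweR_gt0.
by rewrite mule_gt0 ?poweR_gt0// lte_fin invr_gt0 lt_neqAle eq_sym Nb0 powR_ge0.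
Qed.

(** * Kolmogorov's inequality for sparse families *)

Definition ravg w Q : R := (fine (wmass mu w Q) / fine (mu Q))%R.

(* Kolmogorov's inequality for sparse sums: since gam < 1, the weak type (1,1)
   bound on each level set expR n <= x < expR (n + 1) suffices. *)
Lemma kolmogorov_sum_le (eta gam : R) (S : set (set T)) (E : set T -> set T) s
    (w : T -> R) (G : set T) :
  (0 < eta)%R -> (0 < gam < 1)%R ->
  uniq s -> laminar s -> (forall Q, Q \in s -> S Q) ->
  (forall Q, Q \in s -> measurable Q) ->
  (forall Q, S Q -> [/\ measurable (E Q), E Q `<=` Q & eta%:E * mu Q <= mu (E Q)]) ->
  trivIset S E -> weight w ->
  measurable G -> (forall Q, Q \in s -> Q `<=` G) ->
  (forall Q, Q \in s -> 0 < mu Q) -> 0 < mu G < +oo -> 0 < wmass mu w G < +oo ->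
  (\sum_(Q <- s) fine (mu Q) * (ravg w Q / ravg w G) `^ gam <=
   eta^-1 * (expR gam / (1 - expR (gam - 1))) * fine (mu G))%R.
Proof.
move=> eta0 /andP[g0 g1] us lam sS ms SE tE ww mG sG mu0 /andP[G0 Gy] /andP[W0 Wy].
pose u Q := fine (mu Q); pose x Q := (ravg w Q / ravg w G)%R.
have le_mu Q : Q \in s -> mu Q <= mu G.
  by move=> Qs; apply: le_measure; rewrite ?inE//; [exact: ms|exact: sG].
have muf Q : Q \in s -> mu Q \is a fin_num.
  by move=> Qs; rewrite ge0_fin_numE// (le_lt_trans (le_mu _ Qs)).
have le_w Q : Q \in s -> wmass mu w Q <= wmass mu w G.
  by move=> Qs; apply: le_wmass => //; [exact: ms|exact: sG].
have wf Q : Q \in s -> wmass mu w Q \is a fin_num.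
  by move=> Qs; rewrite ge0_fin_numE ?wmass_ge0// (le_lt_trans (le_w _ Qs)).
have Gf : mu G \is a fin_num by rewrite ge0_fin_numE.
have Wf : wmass mu w G \is a fin_num by rewrite ge0_fin_numE// ltW.
have uG0 : (0 < u G)%R by rewrite fine_gt0// G0.
have WG0 : (0 < fine (wmass mu w G))%R by rewrite fine_gt0// W0.
have aG0 : (0 < ravg w G)%R by rewrite divr_gt0.
have u0 Q : Q \in s -> (0 < u Q)%R.
  by move=> Qs; rewrite fine_gt0// mu0//= (le_lt_trans (le_mu _ Qs)).
have x0 Q : Q \in s -> (0 <= x Q)%R.
  move=> Qs; rewrite divr_ge0 ?(ltW aG0)// divr_ge0 ?fine_ge0 ?wmass_ge0//.
(* All values of [x Q] below e land in level 0, including [x Q = 0], where [ln] is 0. On that level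
   only the trivial bound by the measure of G is used. *)
pose n Q := Num.truncn (ln (x Q)).
have xn Q : Q \in s -> (x Q `^ gam <= expR (gam * (n Q).+1%:R))%R.
  move=> Qs; rewrite /powR; case: eqP => [_|/eqP xQ].
    by rewrite gt_eqF//= expR_ge0.
  by rewrite ler_expR ler_wpM2l// ?(ltW g0)//; apply: ltW; exact: truncnS_gt.
have nx Q : Q \in s -> (0 < n Q)%N -> (expR (n Q)%:R <= x Q)%R.
  move=> Qs nQ; have xQ : (0 < x Q)%R.
    rewrite lt_neqAle x0// andbT eq_sym; apply: contraTneq nQ => xQ.
    by rewrite /n xQ ln0// truncn0.
  rewrite -[leRHS](lnK (_ : x Q \is Num.pos)) ?posrE// ler_expR truncn_le.
  by move: nQ; rewrite truncn_gt0; exact: le_trans.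
(* The weak type bound controls the measure of the union of the cubes of level k; sparseness turns
   it into a bound for the sum of their measures. *)
have level k : (\sum_(Q <- s | n Q == k) u Q <= eta^-1 * (expR (- k%:R) * u G))%R.
  rewrite -big_filter; set s' := [seq Q <- s | n Q == k].
  have s's Q : Q \in s' -> Q \in s by rewrite mem_filter => /andP[].
  have mU : measurable (\big[setU/set0]_(Q <- s') Q).
    by rewrite big_seq; apply: bigsetU_measurable => Q /s's; exact: ms.
  have UG : \big[setU/set0]_(Q <- s') Q `<=` G.
    by move=> y /bigsetU_seqP[Q /s's Qs]; exact: sG.
  have muU : mu (\big[setU/set0]_(Q <- s') Q) <= (expR (- k%:R) * u G)%:E.
    have [k0|k0] := posnP k.
      rewrite k0 oppr0 expR0 mul1r fineK//.
      by apply: le_measure; rewrite ?inE.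
    have : (expR k%:R * ravg w G)%:E * wmass mu (cst 1%R) (\big[setU/set0]_(Q <- s') Q)
        <= wmass mu w (\big[setU/set0]_(Q <- s') Q).
      apply: laminar_wmass_le => //.
      - by rewrite mulr_ge0// ?expR_ge0// ltW.
      - exact: laminar_sub lam.
      - by move=> Q /s's; exact: ms.
      move=> Q Qs'; have Qs := s's _ Qs'; rewrite wmass_cst; last exact: ms.
      rewrite -(fineK (muf _ Qs)) -(fineK (wf _ Qs)) -EFinM lee_fin.
      rewrite -ler_pdivlMr; last exact: u0.
      rewrite -ler_pdivlMr//; move: Qs'; rewrite mem_filter => /andP[/eqP nQ _].
      by rewrite -nQ; apply: nx => //; rewrite nQ.
    rewrite wmass_cst// => /le_trans/(_ (le_wmass ww mU mG UG)).
    have Uf : mu (\big[setU/set0]_(Q <- s') Q) \is a fin_num.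
      by rewrite ge0_fin_numE// (le_lt_trans _ Gy)//; apply: le_measure; rewrite ?inE.
    rewrite -(fineK Uf) -(fineK Wf) -EFinM !lee_fin expRN -/(u G) => h.
    rewrite ler_pdivlMl ?expR_gt0// -(ler_pM2r aG0) mulrAC (le_trans h)//.
    by rewrite /ravg mulrCA mulfV ?mulr1// gt_eqF.
  have := sparse_sum_le (ltW eta0) (filter_uniq _ us) (fun Q Qs => sS Q (s's _ Qs))
    (fun Q Qs => ms Q (s's _ Qs)) SE tE.
  move=> /le_trans /(_ muU).
  have -> : \sum_(Q <- s') mu Q = (\sum_(Q <- s') u Q)%R%:E.
    rewrite -sumEFin big_seq [RHS]big_seq; apply: eq_bigr => Q /s's Qs.
    by rewrite fineK// muf.
  by rewrite -EFinM lee_fin ler_pdivlMl.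
apply: (@le_trans _ _ (\sum_(Q <- s) u Q * expR (gam * (n Q).+1%:R))%R).
  rewrite big_seq [leRHS]big_seq; apply: ler_sum => Q Qs.
  by rewrite ler_wpM2l ?xn// ltW// u0.
apply: le_trans (@ler_sum_cover _ _ _ s (undup (map n s)) (fun Q k => n Q == k) _ _ _) _.
- by move=> Q Qs; rewrite mulr_ge0 ?expR_ge0// ltW// u0.
- by move=> Q Qs; apply/hasP; exists (n Q) => //; rewrite mem_undup map_f.
(* Level k contributes expR (gam (k + 1)) expR (- k), a geometric sequence of ratio expR (gam - 1),
   which is below 1 because gam < 1. *)
apply: (@le_trans _ _ (\sum_(k <- undup (map n s))
    (eta^-1 * expR gam * u G) * expR (gam - 1) ^+ k)%R).
  apply: ler_sum => k _.
  apply: (@le_trans _ _ (\sum_(Q <- s | n Q == k) u Q * expR (gam * k.+1%:R))%R).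
    by rewrite le_eqVlt; apply/orP; left; apply/eqP/eq_bigr => Q /eqP ->.
  rewrite -mulr_suml; apply: le_trans (ler_wpM2r (expR_ge0 _) (level k)) _.
  rewrite le_eqVlt; apply/orP; left; apply/eqP.
  have -> : (expR (gam * k.+1%:R) = expR gam * expR (gam * k%:R))%R.
    by rewrite -expRD -natr1 mulrDr mulr1 addrC.
  rewrite -expRM_natr mulrBl mul1r expRD; ring.
rewrite -mulr_sumr -/(u G).
have -> : (eta^-1 * (expR gam / (1 - expR (gam - 1))) * u G =
  (eta^-1 * expR gam * u G) * (1 - expR (gam - 1))^-1)%R by ring.
rewrite ler_wpM2l//.
  by rewrite !mulr_ge0 ?expR_ge0 ?invr_ge0// ltW.
apply: sum_geom_le; last exact: undup_uniq.
by rewrite expR_ge0/= expR_lt1 subr_lt0.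
Qed.

(** Hölder's inequality for k functions up to the factor k: each [g i] is divided by the bound
    [n i], and the product is then bounded pointwise by the sum. *)
Lemma integral_prod_powR_le (k : nat) (g : 'I_k -> T -> R) (v n : 'I_k -> R) :
  (forall i, weight (g i)) -> (forall i, (0 <= v i)%R) -> (\sum_i v i = 1)%R ->
  (forall i, (0 < n i)%R) ->
  (forall i, \int[mu]_x (g i x)%:E <= (n i)%:E) ->
  \int[mu]_x (\prod_(i < k) g i x `^ v i)%R%:E <=
  (k%:R * \prod_(i < k) n i `^ v i)%R%:E.
Proof.
move=> wg v0 v1 n0 gn; pose c := (\prod_(i < k) n i `^ v i)%R.
have c0 : (0 <= c)%R by rewrite prodr_ge0// => i _; exact: powR_ge0.
have g0 i x : (0 <= g i x)%R by exact: (wg i).2.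
apply: (@le_trans _ _ (\int[mu]_x \sum_(i < k) (c / n i)%:E * (g i x)%:E)).
  apply: le_integral_ge0 => x _.
    by rewrite lee_fin prodr_ge0// => i _; exact: powR_ge0.
  under [leRHS]eq_bigr do rewrite -EFinM; rewrite sumEFin lee_fin.
  have -> : (\prod_(i < k) g i x `^ v i = c * \prod_(i < k) (g i x / n i) `^ v i)%R.
    rewrite /c -big_split/=; apply: eq_bigr => i _.
    by rewrite -powRM ?divr_ge0 ?(ltW (n0 i))// mulrC divfK// gt_eqF.
  under [leRHS]eq_bigr do rewrite -mulrA.
  rewrite -mulr_sumr ler_wpM2l//; under [leRHS]eq_bigr do rewrite mulrC.
  by apply: prod_powR_le_sum => // i; rewrite divr_ge0// ltW.
have cn0 i : (0 <= c / n i)%R by rewrite divr_ge0// ltW.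
rewrite ge0_integral_sum_seq//; last 2 first.
- move=> i _; apply: emeasurable_funM => //; exact: weight_measurable.
- by move=> i x _ _; rewrite mule_ge0// lee_fin.
apply: (@le_trans _ _ (\sum_(i < k) c%:E)).
  apply: lee_sum => i _; rewrite ge0_integralZl_EFin//; last 2 first.
  - by move=> x _; rewrite lee_fin.
  - exact: weight_measurable.
  apply: le_trans (lee_wpmul2l _ (gn i)) _; first by rewrite lee_fin.
  by rewrite -EFinM divfK// gt_eqF.
by rewrite sumEFin sumr_const card_ord mulr_natl.
Qed.

Lemma wmass_disjoint_sum_le w s (A : set T) : weight w -> uniq s ->
  trivIset [set` s] id -> (forall Q, Q \in s -> measurable Q) -> measurable A ->
  (forall Q, Q \in s -> Q `<=` A) ->
  \sum_(Q <- s) wmass mu w Q <= wmass mu w A.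
Proof.
move=> ww us ts ms mA sA.
have -> : \sum_(Q <- s) wmass mu w Q =
    \sum_(Q <- s) \int[mu]_(x in A) ((w x)%:E * (\1_Q x)%:E).
  rewrite big_seq [RHS]big_seq; apply: eq_bigr => Q Qs.
  rewrite -[Q in LHS](setIidl (sA _ Qs)) setIC -wmass_indic//; last exact: ms.
  by apply: eq_integral => x _; rewrite -EFinM mulrC.
rewrite -ge0_integral_sum_seq//; last 2 first.
- move=> Q Qs; apply: emeasurable_funM; first exact: weight_measurable.
  by apply/measurable_EFinP/measurable_indic/ms.
- by move=> Q x _ _; rewrite mule_ge0// lee_fin; exact: ww.2.
apply: le_integral_ge0 => x _.
  by apply: sume_ge0 => Q _; rewrite mule_ge0// lee_fin; exact: ww.2.
by apply: (sum_disjoint_indic_le (m := fun=> (w x)%:E)) => //; rewrite lee_fin; exact: ww.2.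
Qed.

(** The properties of grid and sparse collection that a finite list inherits. They pass to sublists,
    as needed when cubes are sorted by levels. *)
Record sparse_family (eta : R) (E : set T -> set T) s : Prop := SparseFamily {
  sf_uniq : uniq s;
  sf_laminar : laminar s;
  sf_measurable : forall Q, Q \in s -> measurable Q;
  sf_mu : forall Q, Q \in s -> 0 < mu Q < +oo;
  sf_sparse : forall Q, Q \in s ->
    [/\ measurable (E Q), E Q `<=` Q & eta%:E * mu Q <= mu (E Q)];
  sf_trivIset : trivIset [set` s] E }.

Lemma sparse_family_sub eta E s s' : sparse_family eta E s ->
  uniq s' -> {subset s' <= s} -> sparse_family eta E s'.
Proof.
move=> [us lam ms mus SE tE] us' s's; split=> //.
- exact: laminar_sub lam.
- by move=> Q /s's; exact: ms.
- by move=> Q /s's; exact: mus.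
- by move=> Q /s's; exact: SE.
- exact: sub_trivIset tE.
Qed.

Definition kolmogorov_const (eta gam : R) : R :=
  (eta^-1 * (expR gam / (1 - expR (gam - 1))))%R.

(* On a level set of prod_i (avg w_i)^(q_i) the exponents beta_i, of sum 1, can be
   lowered to gam_i := beta_i - sig q_i > 0, of sum < 1. *)
Lemma level_sum_le (eta : R) E s (k : nat) (w : 'I_k -> T -> R)
    (beta q : 'I_k -> R) (sig a : R) (G : set T) :
  (0 < eta)%R -> (0 < k)%N -> sparse_family eta E s -> (forall i, weight (w i)) ->
  (forall i Q, Q \in s -> 0 < wmass mu (w i) Q < +oo) ->
  (\sum_i beta i = 1)%R -> (forall i, (0 < q i)%R) -> (0 < sig)%R ->
  (forall i, (sig * q i < beta i)%R) ->
  (forall Q, Q \in s ->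
    (expR a <= \prod_i ravg (w i) Q `^ q i <= expR (a + 1))%R) ->
  G \in s ->
  (\sum_(Q <- s | subsetb Q G) \prod_i fine (wmass mu (w i) Q) `^ beta i <=
   expR sig * k%:R * kolmogorov_const eta (1 - sig * \sum_i q i) *
   \prod_i fine (wmass mu (w i) G) `^ beta i)%R.
Proof.
move=> eta0 k0 sf ww wpos b1 q0 sig0 sigq lev Gs.
have [us lam ms mus SE tE] := sf.
have V0 i Q : Q \in s -> (0 < fine (wmass mu (w i) Q))%R by move=> /(wpos i)/fine_gt0.
have u0 Q : Q \in s -> (0 < fine (mu Q))%R by move=> /mus/fine_gt0.
have r0 i Q : Q \in s -> (0 < ravg (w i) Q)%R by move=> Qs; rewrite divr_gt0 ?V0 ?u0.
have VE Q : Q \in s -> (\prod_i fine (wmass mu (w i) Q) `^ beta i =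
    fine (mu Q) * \prod_i ravg (w i) Q `^ beta i)%R.
  move=> Qs; have -> : (fine (mu Q) = \prod_i fine (mu Q) `^ beta i)%R.
    by rewrite -powR_sum ?u0// b1 powRr1// ltW// u0.
  rewrite -big_split/=; apply: eq_bigr => i _.
  rewrite -powRM ?(ltW (u0 _ Qs)) ?(ltW (r0 i _ Qs))//.
  by rewrite mulrC divfK// gt_eqF ?u0.
pose gm i := (beta i - sig * q i)%R.
have gm0 i : (0 < gm i)%R by rewrite subr_gt0.
have gmE : (\sum_i gm i = 1 - sig * \sum_i q i)%R by rewrite sumrB b1 mulr_sumr.
set gam := (1 - sig * \sum_i q i)%R in gmE *.
have gam0 : (0 < gam)%R.
  rewrite -gmE (bigD1 (Ordinal k0))//= ltr_wpDr ?gm0// sumr_ge0// => i _; exact: ltW.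
have gam1 : (gam < 1)%R.
  rewrite /gam gtrBl mulr_gt0// (bigD1 (Ordinal k0))//= ltr_wpDr ?q0//.
  by rewrite sumr_ge0// => i _; exact: ltW.
pose A Q := (\prod_i ravg (w i) Q `^ q i)%R.
have A0 Q : (0 <= A Q)%R by rewrite prodr_ge0// => i _; exact: powR_ge0.
have rE Q : Q \in s -> (\prod_i ravg (w i) Q `^ beta i =
    \prod_i ravg (w i) Q `^ gm i * A Q `^ sig)%R.
  move=> Qs; rewrite /A powR_prod; last by move=> i; exact: powR_ge0.
  rewrite -big_split/=; apply: eq_bigr => i _.
  by rewrite -powRrM -powRD ?(gt_eqF (r0 i _ Qs)) ?implybT// /gm mulrC subrK.
(* The part [A Q] to the power [sig] split off from the exponents is comparable to its value at G,
   since both products lie in the same interval of ratio e. *)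
have AA Q : Q \in s -> (A Q `^ sig <= expR sig * A G `^ sig)%R.
  move=> Qs; have -> : (expR sig = expR 1 `^ sig)%R by rewrite -expRM mul1r.
  rewrite -powRM ?expR_ge0// ge0_ler_powR ?nnegrE ?mulr_ge0 ?expR_ge0 ?(ltW sig0)//.
  have /andP[_ h1] := lev _ Qs; have /andP[h2 _] := lev _ Gs.
  by rewrite (le_trans h1)// addrC expRD ler_wpM2l ?expR_ge0.
(* After normalisation by the averages over G, AM-GM with weights gm_i / gam separates the weights
   and leaves k sums of Kolmogorov type with exponent gam < 1. *)
have xE Q : Q \in s -> (\prod_i ravg (w i) Q `^ gm i <=
    \prod_i ravg (w i) G `^ gm i * \sum_i (ravg (w i) Q / ravg (w i) G) `^ gam)%R.
  move=> Qs.
  have -> : (\prod_i ravg (w i) Q `^ gm i =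
      \prod_i ravg (w i) G `^ gm i *
      \prod_i (ravg (w i) Q / ravg (w i) G) `^ gm i)%R.
    rewrite -big_split/=; apply: eq_bigr => i _.
    have [rG rQ] := (ltW (r0 i _ Gs), ltW (r0 i _ Qs)).
    have qG : (0 <= ravg (w i) Q / ravg (w i) G)%R by exact: divr_ge0.
    by rewrite -(powRM _ rG qG) mulrC divfK// gt_eqF ?r0.
  rewrite ler_wpM2l//; first by rewrite prodr_ge0// => i _; exact: powR_ge0.
  apply: le_trans (@prod_powR_le_sum R _
    (fun i => (ravg (w i) Q / ravg (w i) G) `^ gam)%R (fun i => gm i / gam)%R _ _ _).
  - rewrite le_eqVlt; apply/orP; left; apply/eqP/eq_bigr => i _.
    by rewrite -powRrM mulrCA mulfV ?mulr1// gt_eqF.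
  - by move=> i; exact: powR_ge0.
  - by move=> i; rewrite divr_ge0// ltW.
  - by rewrite -mulr_suml gmE mulfV// gt_eqF.
pose c := (expR sig * A G `^ sig * \prod_i ravg (w i) G `^ gm i)%R.
have c0 : (0 <= c)%R.
  rewrite !mulr_ge0 ?expR_ge0 ?powR_ge0// prodr_ge0// => i _; exact: powR_ge0.
pose s' := [seq Q <- s | subsetb Q G].
have s's Q : Q \in s' -> Q \in s by rewrite mem_filter => /andP[].
apply: (@le_trans _ _ (\sum_(Q <- s') c * \sum_i
    fine (mu Q) * (ravg (w i) Q / ravg (w i) G) `^ gam)%R).
  rewrite -big_filter -/s' big_seq [leRHS]big_seq; apply: ler_sum => Q /s's Qs.
  rewrite VE// rE// -mulr_sumr [leRHS]mulrCA ler_wpM2l ?(ltW (u0 _ Qs))//.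
  apply: le_trans (ler_pM _ (powR_ge0 _ _) (xE _ Qs) (AA _ Qs)) _.
    by rewrite prodr_ge0// => i _; exact: powR_ge0.
  by rewrite le_eqVlt /c; apply/orP; left; apply/eqP; ring.
rewrite -mulr_sumr exchange_big/=.
apply: (@le_trans _ _ (c * \sum_(i < k) kolmogorov_const eta gam * fine (mu G))%R).
  rewrite ler_wpM2l//; apply: ler_sum => i _.
  apply: (@kolmogorov_sum_le eta gam [set` s] E s' (w i) G) => //.
  - by rewrite gam0.
  - exact: filter_uniq.
  - exact: laminar_sub lam.
  - by move=> Q /s's; exact: ms.
  - exact: ms.
  - by move=> Q; rewrite mem_filter => /andP[/asboolP].
  - by move=> Q /s's/mus/andP[].
  - exact: mus.
  - exact: wpos.
rewrite VE// rE// /c sumr_const card_ord -mulr_natl le_eqVlt.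
by apply/orP; left; apply/eqP; ring.
Qed.

(** * Levels and jumps *)

(** A stopping condition: level j rises strictly on entering G from above. It holds vacuously when G
    has no proper superset in [s]. *)
Definition jumps (k : nat) s (kap : 'I_k -> set T -> int) (j : 'I_k) (G : set T) :=
  all (fun P => subsetb G P && (P != G) ==> (kap j P < kap j G)%R) s.

(** With G the largest cube above Q having the levels of Q, only the smallest proper superset [P0]
    of G matters. Some level j is different there, and by monotonicity it is lower on [P0] and on
    everything above. That level is not constant, so j lies in [Js]. If G has no proper superset,
    any j in [Js] will do. *)
Lemma exists_jump s (k : nat) (kap : 'I_k -> set T -> int) (Js : {set 'I_k})
    (Q : set T) :
  laminar s -> (forall P, P \in s -> P !=set0) ->
  (forall i P P', P \in s -> P' \in s -> subsetb P P' -> (kap i P' <= kap i P)%R) ->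
  (forall i P P', i \notin Js -> P \in s -> P' \in s -> kap i P = kap i P') ->
  Js != finset.set0 -> Q \in s ->
  exists j G, [/\ j \in Js, G \in s, subsetb Q G, forall i, kap i G = kap i Q &
    jumps s kap j G].
Proof.
move=> lam s0 kapa kapc Js0 Qs.
have [|G] := @seq_max_subset _ [seq P <- s | subsetb Q P && [forall i, kap i P == kap i Q]].
  rewrite -has_filter; apply/hasP; exists Q => //.
  by rewrite subsetb_refl/=; apply/forallP.
rewrite mem_filter => /andP[/andP[QG /forallP kG] Gs] Gmax.
have {}kG i : kap i G = kap i Q by exact/eqP.
have [y Gy] := s0 _ Gs.
have [hs|/hasPn hs] := boolP (has (fun P => subsetb G P && (P != G)) s); last first.
  have /set0Pn[j jJs] := Js0; exists j, G; split=> //.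
  by apply/allP => P /hs/negbTE ->.
have [|P0 [P0s /andP[GP0 P0G] P0min]] := laminar_smallest lam (x := y) _ hs.
  by move=> P _ /andP[/asboolP GP _]; exact: GP.
have [j kj] : exists j, kap j P0 != kap j Q.
  apply/existsP; apply: contraNT P0G; rewrite negb_exists => /forallP h.
  apply/eqP/Gmax => //; rewrite mem_filter P0s andbT (subsetb_trans QG GP0)/=.
  by apply/forallP => i; have := h i; rewrite negbK.
exists j, G; split=> //.
  by apply: contraNT kj => jJs; rewrite (kapc _ P0 Q).
apply/allP => P Ps; apply/implyP => PG.
have := kapa j _ _ P0s Ps (P0min _ Ps PG) => /le_lt_trans; apply.
by rewrite lt_neqAle kapa// andbT kG.
Qed.

(** Sets that meet are nested; if distinct, the smaller one would have a strictly higher level j,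
    yet both have level c. *)
Lemma jumps_trivIset s (k : nat) (kap : 'I_k -> set T -> int) (j : 'I_k) (c : int) :
  laminar s ->
  trivIset [set` [seq G <- s | jumps s kap j G & kap j G == c]] id.
Proof.
move=> lam P Q /=; rewrite !mem_filter => /andP[/andP[/allP jP /eqP cP] Ps].
move=> /andP[/andP[/allP jQ /eqP cQ] Qs] [x [Px Qx]].
apply/eqP; apply/negP => /negP PQ.
have /orP[h|h] := laminar_chain lam Ps Qs Px Qx.
  by have := jP _ Qs; rewrite h eq_sym PQ cP cQ ltxx.
by have := jQ _ Ps; rewrite h PQ cP cQ ltxx.
Qed.

Section level_data.
Variables (eta : R) (E : set T -> set T) (s : seq (set T)) (D : set (set T)).
Variables (m : nat) (w : 'I_m -> T -> R) (kap : 'I_m -> set T -> int).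
Variables (Z : 'I_m -> seq int) (Om : 'I_m -> int -> set T).
Hypotheses (eta0 : (0 < eta)%R) (sf : sparse_family eta E s).
Hypothesis sD : forall Q, Q \in s -> D Q.
Hypothesis ww : forall i, weight (w i).
Hypothesis wpos : forall i Q, Q \in s -> 0 < wmass mu (w i) Q < +oo.
Hypothesis kapa : forall i P Q, P \in s -> Q \in s -> subsetb P Q ->
  (kap i Q <= kap i P)%R.
Hypothesis kapZ : forall i Q, Q \in s -> kap i Q \in Z i.
Hypothesis mOm : forall i c, measurable (Om i c).
Hypothesis Omw : forall i c, c \in Z i -> wmass mu (w i) (Om i c) < +oo.
Hypothesis sOm : forall i Q, Q \in s -> Q `<=` Om i (kap i Q).

(** Levels, their values [Z i] and the sets [Om i c] are kept abstract, since a frozen index is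
    treated with a list [Z i] of one value. With N_i the sum over c of e^c times the indicator of
    [Om i c], a majorant of e^(kap i Q) on Q, [n i] is the integral of N_i w_i. *)
Let V i Q : R := fine (wmass mu (w i) Q).
Let y i Q : R := (V i Q * expR (kap i Q)%:~R)%R.
Let n i : R := (\sum_(c <- Z i) expR c%:~R * fine (wmass mu (w i) (Om i c)))%R.

Let Omfin i c : c \in Z i -> wmass mu (w i) (Om i c) \is a fin_num.
Proof. by move=> cZ; rewrite ge0_fin_numE ?wmass_ge0// Omw. Qed.

Lemma level_mass_gt0 i : s != [::] -> (0 < n i)%R.
Proof.
case: s sf wpos kapZ sOm => // Q0 s0 [_ _ ms _ _ _] wp kZ sO _.
have Qs : Q0 \in Q0 :: s0 by rewrite mem_head.
rewrite /n (big_rem _ (kZ i _ Qs))/= ltr_wpDr//.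
  by apply: sumr_ge0 => c _; rewrite mulr_ge0 ?expR_ge0// fine_ge0// wmass_ge0.
rewrite mulr_gt0 ?expR_gt0// fine_gt0// Omw ?kZ// andbT.
have /andP[w0 _] := wp i _ Qs; apply: lt_le_trans w0 _.
by apply: le_wmass => //; [exact: ms|exact: sO].
Qed.

Lemma jumps_sum_le j : (\sum_(G <- s | jumps s kap j G) y j G <= n j)%R.
Proof.
have [us lam ms mus SE tE] := sf; rewrite -big_filter.
pose s' := [seq G <- s | jumps s kap j G].
have s's G : G \in s' -> G \in s by rewrite mem_filter => /andP[].
have y0 G : (0 <= y j G)%R by rewrite mulr_ge0 ?expR_ge0// fine_ge0// wmass_ge0.
apply: le_trans (@ler_sum_cover _ _ _ s' (Z j) (fun G c => kap j G == c) _ _ _) _.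
- by move=> G _.
- by move=> G /s's Gs; apply/hasP; exists (kap j G) => //; exact: kapZ.
rewrite /n big_seq [leRHS]big_seq; apply: ler_sum => c cZ.
apply: (@le_trans _ _ (\sum_(G <- s' | kap j G == c) expR c%:~R * V j G)%R).
  by rewrite le_eqVlt; apply/orP; left; apply/eqP/eq_bigr => G /eqP <-; rewrite mulrC.
rewrite -mulr_sumr ler_wpM2l ?expR_ge0// -lee_fin fineK ?Omfin// -big_filter.
set s'' := [seq G <- s' | kap j G == c].
have s''s G : G \in s'' -> G \in s by rewrite mem_filter => /andP[_ /s's].
rewrite -sumEFin.
have -> : \sum_(G <- s'') (V j G)%:E = \sum_(G <- s'') wmass mu (w j) G.
  rewrite big_seq [RHS]big_seq; apply: eq_bigr => G /s''s Gs.
  by rewrite fineK// ge0_fin_numE ?wmass_ge0//; have /andP[] := wpos j Gs.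
apply: wmass_disjoint_sum_le => //.
- by rewrite !filter_uniq.
- apply: sub_trivIset (@jumps_trivIset s m kap j c lam) => G /=.
  by rewrite !mem_filter/= => /and3P[-> -> ->].
- by move=> G /s''s; exact: ms.
- by move=> G; rewrite mem_filter => /andP[/eqP <- /s's]; exact: sOm.
Qed.

(** Carleson embedding with respect to h, the geometric mean of the weights. Sparseness and the
    Fujii-Wilson bound give the Carleson condition, the level factor is monotone along inclusions,
    and Hölder's inequality integrates the product of the majorants. *)
Lemma carleson_sum_le (beta : 'I_m -> R) (K : R) :
  let b := (\sum_i beta i)%R in
  (forall i, (0 <= beta i)%R) -> (0 < b)%R -> (0 < K)%R ->
  s != [::] -> fujii_wilson mu D beta w <= K%:E ->
  (\sum_(G <- s) \prod_i y i G `^ (beta i / b) <=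
   eta^-1 * K `^ b^-1 * (m%:R * \prod_i n i `^ (beta i / b)))%R.
Proof.
move=> b beta0 b0 K0 s0 FW; have [us lam ms mus SE tE] := sf.
pose v i := (beta i / b)%R.
have v0 i : (0 <= v i)%R by rewrite divr_ge0// ltW.
have v1 : (\sum_i v i = 1)%R by rewrite -mulr_suml mulfV// gt_eqF.
have u0 Q : Q \in s -> (0 < fine (mu Q))%R by move=> /mus/fine_gt0.
have uf Q : Q \in s -> mu Q \is a fin_num.
  by move=> /mus/andP[h1 h2]; rewrite ge0_fin_numE.
have wf i Q : Q \in s -> wmass mu (w i) Q \is a fin_num.
  by move=> /(wpos i)/andP[h1 h2]; rewrite ge0_fin_numE// ltW.
have V0 i Q : Q \in s -> (0 < V i Q)%R by move=> /(wpos i)/fine_gt0.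
have r0 i Q : Q \in s -> (0 < ravg (w i) Q)%R by move=> Qs; rewrite divr_gt0 ?V0 ?u0.
(* As the [v i] add up to 1, the product of the [y i Q] factors into [c Q], which carries the
   weights, and [phi Q], which carries the levels. *)
pose c Q := (fine (mu Q) * \prod_i ravg (w i) Q `^ v i)%R.
pose phi Q := (\prod_i expR (kap i Q)%:~R `^ v i)%R.
pose h x := (\prod_i w i x `^ v i)%R.
pose N i x : R := (\sum_(c <- Z i) expR c%:~R * \1_(Om i c) x)%R.
have N0 i x : (0 <= N i x)%R.
  by apply: sumr_ge0 => e _; rewrite mulr_ge0 ?expR_ge0// indicE.
pose K1 := (eta^-1 * K `^ b^-1)%R.
have K10 : (0 <= K1)%R by rewrite mulr_ge0 ?powR_ge0// invr_ge0 ltW.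
have wh : weight h.
  split.
    apply: measurable_prod => i _.
    exact: (measurableT_comp (measurable_powR (v i)) (ww i).1).
  by move=> x; rewrite prodr_ge0// => i _; exact: powR_ge0.
have wN i : weight (N i).
  split=> //; apply: measurable_sum => e; apply: measurable_funM => //.
have cphi Q : Q \in s -> (\prod_i y i Q `^ v i = c Q * phi Q)%R.
  move=> Qs; rewrite /c /phi.
  have -> : (fine (mu Q) = \prod_i fine (mu Q) `^ v i)%R.
    by rewrite -powR_sum ?u0// v1 powRr1// ltW// u0.
  rewrite -!big_split/=; apply: eq_bigr => i _.
  rewrite /y powRM ?expR_ge0 ?(ltW (V0 i _ Qs))//; congr (_ * _)%R.
  have [uQ rQ] := (ltW (u0 _ Qs), ltW (r0 i _ Qs)).
  by rewrite -(powRM _ uQ rQ) mulrC divfK// gt_eqF// u0.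
have -> : (\sum_(G <- s) \prod_i y i G `^ v i = \sum_(G <- s) c G * phi G)%R.
  by rewrite big_seq [RHS]big_seq; apply: eq_bigr => G; exact: cphi.
have cK P : P \in s ->
    (\sum_(Q <- s | subsetb Q P) c Q)%R%:E <= K1%:E * wmass mu h P.
  move=> Ps.
  have := @sparse_sum_le_maximal eta [set` s] D E s m v w P us (fun Q Qs => Qs)
    sD ms (ms _ Ps) SE tE (ltW eta0).
  move=> /le_trans/(_ (fujii_wilson_integral_le (sD Ps) b0 K0 ww FW)).
  have -> : \sum_(Q <- s | subsetb Q P)
      mu Q * \prod_(i < m) average mu (w i) Q `^ v i =
      (\sum_(Q <- s | subsetb Q P) c Q)%R%:E.
    rewrite -sumEFin big_seq_cond [RHS]big_seq_cond; apply: eq_bigr => Q /andP[Qs _].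
    rewrite /c EFinM fineK ?uf//; congr (_ * _).
    rewrite -prodEFin; apply: eq_bigr => i _.
    rewrite -poweR_EFin /ravg /average -/(wmass mu (w i) Q) -(fineK (uf _ Qs)).
    by rewrite inver gt_eqF ?u0// -(fineK (wf i _ Qs)) -EFinM mulrC.
  move=> H; rewrite /K1 EFinM -muleA lee_pdivlMl//.
have s0' Q : Q \in s -> Q !=set0.
  move=> Qs; apply/set0P/negP => /eqP Q0.
  by have /andP[] := mus _ Qs; rewrite Q0 measure0 ltxx.
have phiN Q x : Q \in s -> Q x -> (phi Q <= \prod_i N i x `^ v i)%R.
  move=> Qs Qx; apply: ler_prod => i _; rewrite powR_ge0/=.
  rewrite ge0_ler_powR ?nnegrE ?expR_ge0//.
  rewrite /N (big_rem _ (kapZ i Qs))/= indicE mem_set ?mulr1; last exact: sOm.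
  by rewrite lerDl sumr_ge0// => e _; rewrite mulr_ge0 ?expR_ge0// indicE.
have := @carleson_embedding s c phi K1 h (fun x => \prod_i N i x `^ v i)%R us lam
  s0' ms wh K10.
move=> /(_ _ _ _ cK _ phiN) H.
rewrite -lee_fin; apply: le_trans (H _ _ _ _) _.
- move=> Q Qs; rewrite mulr_ge0 ?(ltW (u0 _ Qs))// prodr_ge0// => i _; exact: powR_ge0.
- by move=> Q Qs; rewrite prodr_ge0// => i _; exact: powR_ge0.
- move=> P Q Ps Qs PQ; apply: ler_prod => i _; rewrite powR_ge0/=.
  by rewrite ge0_ler_powR ?nnegrE ?expR_ge0// ler_expR ler_int kapa.
- by move=> x; rewrite prodr_ge0// => i _; exact: powR_ge0.
rewrite [leRHS]EFinM lee_wpmul2l ?lee_fin//.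
have -> : \int[mu]_x ((\prod_i N i x `^ v i) * h x)%R%:E =
    \int[mu]_x (\prod_(i < m) (N i x * w i x) `^ v i)%R%:E.
  apply: eq_integral => x _; congr (_%:E); rewrite -big_split/=.
  by apply: eq_bigr => i _; rewrite powRM//; exact: (ww i).2.
apply: integral_prod_powR_le => //.
- by move=> i; exact: weight_mul.
- by move=> i; exact: level_mass_gt0.
move=> i; rewrite /N /n.
have -> : \int[mu]_x ((\sum_(e <- Z i) expR e%:~R * \1_(Om i e) x) * w i x)%R%:E =
    \int[mu]_x \sum_(e <- Z i) (expR e%:~R)%:E * (\1_(Om i e) x * w i x)%R%:E.
  apply: eq_integral => x _; rewrite mulr_suml -sumEFin.
  by apply: eq_bigr => e _; rewrite -EFinM mulrA.
have wOm e : weight (fun x => \1_(Om i e) x * w i x)%R.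
  by apply: weight_mul => //; exact: weight_indic.
rewrite ge0_integral_sum_seq//; last 2 first.
- by move=> e _; apply: emeasurable_funM => //; apply/measurable_EFinP/(wOm e).1.
- by move=> e x _ _; rewrite mule_ge0 ?lee_fin ?expR_ge0//; exact: (wOm e).2.
rewrite -sumEFin big_seq [leRHS]big_seq; apply: lee_sum => e eZ.
rewrite ge0_integralZl_EFin ?expR_ge0//; last 2 first.
- by move=> x _; rewrite lee_fin; exact: (wOm e).2.
- by apply/measurable_EFinP/(wOm e).1.
by rewrite EFinM fineK ?Omfin// -[X in _ * X]/(wmass mu _ setT) wmass_indic// setTI.
Qed.

(** For each jumping index j, Hölder's inequality with exponents beta_j and 1 - beta_j joins the
    disjointness bound for w_j to the Carleson bound for the other weights. The latter carries [K j]
    to the power 1/(1 - beta_j), so [K j] ends up with power 1. *)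
Lemma core_sum_le (beta q : 'I_m -> R) (sig a : R) (Js : {set 'I_m})
    (K : 'I_m -> R) :
  (1 < m)%N -> (eta <= 1)%R -> (forall i, (0 < beta i)%R) ->
  (\sum_i beta i = 1)%R -> (forall i, (0 < q i)%R) ->
  (0 < sig)%R -> (forall i, (sig * q i < beta i)%R) ->
  (forall Q, Q \in s ->
    (expR a <= \prod_i ravg (w i) Q `^ q i <= expR (a + 1))%R) ->
  (forall i P Q, i \notin Js -> P \in s -> Q \in s -> kap i P = kap i Q) ->
  Js != finset.set0 -> (forall j, (0 < K j)%R) ->
  (forall j, j \in Js -> fujii_wilson mu D (omit j beta) w <= (K j)%:E) ->
  (\sum_(Q <- s) \prod_i y i Q `^ beta i <=
   expR sig * m%:R * kolmogorov_const eta (1 - sig * \sum_i q i) *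
   (2 * (m%:R / eta)) * (\sum_(j in Js) K j) * \prod_i n i `^ beta i)%R.
Proof.
move=> m1 eta1 beta0 b1 q0 sig0 sigq lev kapc Js0 K0 FW.
have [us lam ms mus SE tE] := sf.
have sumK0 : (0 <= \sum_(j in Js) K j)%R by apply: sumr_ge0 => j _; exact: ltW.
have mE : (0 <= m%:R / eta)%R by rewrite divr_ge0// ltW.
have gam0 : (0 < 1 - sig * \sum_i q i)%R.
  rewrite -b1 mulr_sumr -sumrB; have i0 : 'I_m by exact: Ordinal (ltnW m1).
  rewrite (bigD1 i0)//= ltr_wpDr ?subr_gt0// sumr_ge0// => i _.
  by rewrite subr_ge0 ltW.
have gam1 : (1 - sig * \sum_i q i < 1)%R.
  have i0 : 'I_m by exact: Ordinal (ltnW m1).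
  rewrite gtrBl mulr_gt0// (bigD1 i0)//= ltr_wpDr ?q0//.
  by rewrite sumr_ge0// => i _; exact: ltW.
set C1 := (expR sig * m%:R * _)%R.
have C10 : (0 <= C1)%R.
  rewrite !mulr_ge0 ?expR_ge0 ?invr_ge0 ?(ltW eta0)//.
  by rewrite subr_ge0 -[leRHS]expR0 ler_expR subr_le0 ltW.
have [s0|s0] := eqVneq s [::].
  rewrite s0 big_nil; apply: mulr_ge0; last first.
    by apply: prodr_ge0 => i _; exact: powR_ge0.
  by apply: mulr_ge0 => //; apply: mulr_ge0 => //; apply: mulr_ge0.
have n0 i : (0 < n i)%R := level_mass_gt0 i s0.
have V0 i Q : (0 <= V i Q)%R by rewrite fine_ge0// wmass_ge0.
have y0 i Q : (0 <= y i Q)%R by rewrite mulr_ge0 ?expR_ge0.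
have s0' Q : Q \in s -> Q !=set0.
  move=> Qs; apply/set0P/negP => /eqP Q0.
  by have /andP[] := mus _ Qs; rewrite Q0 measure0 ltxx.
pose F Q := (\prod_i y i Q `^ beta i)%R.
have F0 Q : (0 <= F Q)%R by rewrite prodr_ge0// => i _; exact: powR_ge0.
pose hit Q (p : 'I_m * set T) :=
  [&& subsetb Q p.2, [forall i, kap i p.2 == kap i Q] & jumps s kap p.1 p.2].
apply: le_trans (@ler_sum_cover _ _ _ s [seq (j, G) | j <- enum Js, G <- s] hit F _ _) _.
- by move=> Q _; exact: F0.
- move=> Q Qs; have [j [G [jJ Gs QG kG jG]]] := exists_jump lam s0' kapa kapc Js0 Qs.
  apply/hasP; exists (j, G); first by apply/allpairsP; exists (j, G); rewrite mem_enum.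
  by rewrite /hit/= QG jG andbT; apply/forallP => i; rewrite kG.
rewrite big_allpairs.
have -> : (C1 * (2 * (m%:R / eta)) * (\sum_(j in Js) K j) * \prod_i n i `^ beta i =
  \sum_(j <- enum Js) C1 * (2 * (m%:R / eta)) * K j * \prod_i n i `^ beta i)%R.
  by rewrite -mulr_suml -mulr_sumr big_enum.
rewrite big_seq [leRHS]big_seq; apply: ler_sum => j; rewrite mem_enum => jJs.
(* All cubes attached to G have the levels of G, so the exponential factors leave the inner sum and
   only masses of weights remain to be summed. *)
apply: (@le_trans _ _ (\sum_(G <- s | jumps s kap j G) C1 * F G)%R).
  rewrite [leRHS]big_mkcond big_seq [leRHS]big_seq; apply: ler_sum => G Gs.
  case: ifPn => jG; last by rewrite big1// => Q /and3P[_ _] /=; rewrite (negbTE jG).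
  apply: (@le_trans _ _ (\sum_(Q <- s | subsetb Q G)
      (\prod_i V i Q `^ beta i) * \prod_i expR (kap i G)%:~R `^ beta i)%R).
    rewrite big_mkcond [leRHS]big_mkcond; apply: ler_sum => Q _.
    rewrite /hit/= jG andbT; case: (subsetb Q G) => //=.
    case: forallP => [kG|_]; last first.
      rewrite mulr_ge0// prodr_ge0// => i _; exact: powR_ge0.
    rewrite -big_split/= le_eqVlt; apply/orP; left; apply/eqP/eq_bigr => i _.
    by rewrite (eqP (kG i)) /y powRM ?expR_ge0.
  rewrite -mulr_suml.
  have := level_sum_le eta0 (ltnW m1) sf ww wpos b1 q0 sig0 sigq lev Gs.
  rewrite -/C1 => H; apply: le_trans (ler_wpM2r _ H) _.
    by rewrite prodr_ge0// => i _; exact: powR_ge0.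
  rewrite -mulrA ler_wpM2l// -big_split/= le_eqVlt; apply/orP; left; apply/eqP.
  by apply: eq_bigr => i _; rewrite /y powRM ?expR_ge0.
rewrite -mulr_sumr; set S := (\sum_(G <- s | _) F G)%R.
suff : (S <= 2 * (m%:R / eta * (K j * \prod_i n i `^ beta i)))%R.
  by move=> /(ler_wpM2l C10)/le_trans; apply; rewrite !mulrA.
rewrite {}/S.
have omE : (\sum_i omit j beta i = 1 - beta j)%R.
  rewrite (bigD1 j)//= /omit eqxx add0r -[in RHS]b1 [in RHS](bigD1 j)//= addrAC subrr add0r.
  by apply: eq_bigr => i /negbTE ->.
(* This uses [m >= 2]: a second index takes a positive share of the total 1. *)
have bj1 : (beta j < 1)%R.
  have [i ij] : exists i, i != j.
    by case: m m1 j {jJs omE} => [|[|k]]// _ j; exists (if j == ord0 then lift ord0 ord0 else ord0);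
      case: ifPn => [/eqP ->|]; rewrite // eq_sym.
  rewrite -b1 (bigD1 j)//= ltrDl (bigD1 i)//= ltr_wpDr ?beta0//.
  by rewrite sumr_ge0// => l _; exact: ltW.
have om0 i : (0 <= omit j beta i)%R by rewrite /omit; case: ifP => // _; exact: ltW.
have bj0 : (0 < 1 - beta j)%R by rewrite subr_gt0.
have := @carleson_sum_le (omit j beta) (K j) om0.
rewrite omE => /(_ bj0 (K0 j) s0 (FW j jJs)).
set Y := (X in (_ <= X)%R) => HY.
have Kb0 : (0 < K j `^ (1 - beta j)^-1)%R by exact: powR_gt0.
have prodn0 (v : 'I_m -> R) : (0 < \prod_i n i `^ v i)%R.
  by apply: prodr_gt0 => i _; exact: powR_gt0.
have mR0 : (0 < m%:R :> R)%R by rewrite ltr0n (ltnW m1).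
have Y0 : (0 < Y)%R by rewrite !mulr_gt0 ?invr_gt0.
pose P G := (\prod_i y i G `^ (omit j beta i / (1 - beta j)))%R.
have P0 G : (0 <= P G)%R by rewrite prodr_ge0// => i _; exact: powR_ge0.
have prodE (z : 'I_m -> R) : (forall i, (0 <= z i)%R) ->
    (\prod_i z i `^ beta i = z j `^ beta j *
     (\prod_i z i `^ (omit j beta i / (1 - beta j))) `^ (1 - beta j))%R.
  move=> z0; rewrite powR_prod; last by move=> i; exact: powR_ge0.
  under [X in (_ = _ * X)%R]eq_bigr do rewrite -powRrM divfK ?(gt_eqF bj0)//.
  rewrite (bigD1 j)//= [X in (_ = _ * X)%R](bigD1 j)//= /omit eqxx powRr0 mul1r.
  by congr (_ * _)%R; apply: eq_bigr => i /negbTE ->.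
have FE G : F G = (y j G `^ beta j * P G `^ (1 - beta j))%R by exact: prodE.
have -> : (\sum_(G <- s | jumps s kap j G) F G =
    \sum_(G <- s | jumps s kap j G) y j G `^ beta j * P G `^ (1 - beta j))%R.
  by apply: eq_bigr => G _; exact: FE.
have bj01 : (0 < beta j < 1)%R by rewrite beta0 bj1.
have YP : (\sum_(G <- s | jumps s kap j G) P G <= Y)%R.
  apply: le_trans HY; rewrite big_mkcond; apply: ler_sum => G _.
  by case: ifP => // _; exact: P0.
apply: le_trans (sum_interp_le _ _ bj01 (n0 j) Y0 (jumps_sum_le j) YP) _ => //.
rewrite -!mulrA ler_wpM2l//.
rewrite (prodE n) => [|i]; last exact: ltW.
set Nv := (\prod_i _)%R; rewrite [leRHS](_ : _ = n j `^ beta j *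
  (m%:R / eta * K j * Nv `^ (1 - beta j)))%R; last by ring.
rewrite ler_wpM2l ?powR_ge0//.
have -> : Y = (m%:R / eta * K j `^ (1 - beta j)^-1 * Nv)%R by rewrite /Y /Nv; ring.
rewrite (powRM _ (mulr_ge0 mE (ltW Kb0)) (ltW (prodn0 _))).
rewrite ler_wpM2r ?powR_ge0// (powRM _ mE (ltW Kb0)).
(* Here [K j] regains power 1. The power 1 - beta_j of m/eta is then bounded by m/eta, which is at
   least 1 since eta is at most 1. *)
rewrite -powRrM mulVf ?(gt_eqF bj0)// powRr1 ?(ltW (K0 j))//.
rewrite ler_wpM2r ?(ltW (K0 j))// ler1_powR//.
  rewrite ler_pdivlMr// mul1r (le_trans eta1)// ler1n; exact: ltnW.
by rewrite gerBl ltW.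
Qed.

End level_data.

(** * Series of nonnegative terms and tails above a height *)

Lemma nneseries_le (x : (\bar R)^nat) (B : \bar R) : (forall n, 0 <= x n) ->
  (forall n, \sum_(0 <= i < n) x i <= B) -> \sum_(0 <= i <oo) x i <= B.
Proof.
move=> x0 xB; apply: lime_le; first by apply: is_cvg_nneseries => n _ _.
by apply: nearW => n; exact: xB.
Qed.

Lemma nneseries_term_le (x : (\bar R)^nat) (n : nat) : (forall n, 0 <= x n) ->
  x n <= \sum_(0 <= i <oo) x i.
Proof.
move=> x0; apply: le_trans (@nneseries_lim_ge R x xpredT 0 n.+1 _) => //.
by rewrite big_nat_recr//= leeDr// sume_ge0.
Qed.

Lemma nneseries_geom_le (e : R) : (0 < e)%R ->
  \sum_(0 <= l <oo) (expR (- (e * l%:R)))%:E <= ((1 - expR (- e))^-1)%:E.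
Proof.
move=> e0; apply: nneseries_le => [n|n]; first by rewrite lee_fin expR_ge0.
rewrite sumEFin lee_fin.
under eq_bigr do rewrite -mulNr expRM_natr.
by apply: sum_geom_le; rewrite ?iota_uniq// expR_ge0/= expR_lt1 oppr_lt0.
Qed.

(** For p at most 1 subadditivity would suffice; the exponential loss covers every p > 0. A single
    term of the right side bounds [x l] by expR (- e l / p) times the power 1/p of the whole, and
    these bounds form a geometric series. *)
Lemma series_poweR_le (p e : R) : (0 < p)%R -> (0 < e)%R ->
  exists2 C : R, (0 < C)%R & forall x : (\bar R)^nat, (forall l, 0 <= x l) ->
    (\sum_(0 <= l <oo) x l) `^ p <=
    C%:E * \sum_(0 <= l <oo) (expR (e * l%:R))%:E * x l `^ p.
Proof.
move=> p0 e0; pose G := (1 - expR (- (e / p)))^-1%R.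
have ep0 : (0 < e / p)%R by rewrite divr_gt0.
have G0 : (0 < G)%R by rewrite invr_gt0 subr_gt0 expR_lt1 oppr_lt0.
exists (G `^ p)%R; first exact: powR_gt0.
move=> x x0; set Y := \sum_(0 <= l <oo) (_ * _).
have t0 l : 0 <= (expR (e * l%:R))%:E * x l `^ p.
  by rewrite mule_ge0 ?poweR_ge0// lee_fin expR_ge0.
have Y0 : 0 <= Y by apply: nneseries_ge0 => l _ _; exact: t0.
have inoo (z : \bar R) : 0 <= z -> z \in `[0, +oo] by move=> z0; rewrite in_itv/= z0 leey.
have pinv : (0 <= p^-1)%R by rewrite invr_ge0 ltW.
have xY l : x l <= (expR (- (e / p * l%:R)))%:E * Y `^ p^-1.
  have h : x l `^ p <= (expR (- (e * l%:R)))%:E * Y.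
    have -> : x l `^ p = (expR (- (e * l%:R)))%:E * ((expR (e * l%:R))%:E * x l `^ p).
      by rewrite muleA -EFinM -expRD addNr expR0 mul1e.
    by rewrite lee_wpmul2l ?lee_fin ?expR_ge0//; exact: nneseries_term_le.
  have := gt0_ler_poweR pinv (inoo _ (poweR_ge0 _ _)) (inoo _ _) h.
  rewrite -poweRrM mulfV ?gt_eqF// poweRe1// poweRM ?lee_fin ?expR_ge0//.
  rewrite poweR_EFin -expRM => H; apply: le_trans (H _) _.
    by rewrite mule_ge0// lee_fin expR_ge0.
  by rewrite le_eqVlt; apply/orP; left; apply/eqP; congr ((expR _)%:E * _); field; rewrite gt_eqF.
have sxY : \sum_(0 <= l <oo) x l <= G%:E * Y `^ p^-1.
  have [->|Yy] := eqVneq Y +oo.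
    by rewrite poweRyr ?invr_eq0 ?gt_eqF// gt0_muley ?lte_fin// leey.
  have Yf : Y `^ p^-1 \is a fin_num by rewrite fin_num_poweR// ge0_fin_numE// ltey.
  apply: (@le_trans _ _ (\sum_(0 <= l <oo) (fine (Y `^ p^-1))%:E * (expR (- (e / p * l%:R)))%:E)).
    by apply: lee_nneseries => // l _; rewrite fineK// muleC xY.
  rewrite nneseriesZl => [|l _]; last by rewrite lee_fin expR_ge0.
  by rewrite fineK// muleC lee_wpmul2r ?poweR_ge0//; exact: nneseries_geom_le.
have := gt0_ler_poweR (ltW p0) (inoo _ _) (inoo _ _) sxY.
rewrite poweRM ?poweR_ge0 ?lee_fin ?(ltW G0)// -poweRrM mulVf ?gt_eqF// poweRe1//.
rewrite poweR_EFin; apply; first by apply: nneseries_ge0 => l _ _.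
by rewrite mule_ge0 ?poweR_ge0// lee_fin ltW.
Qed.

Lemma measurable_superlevel (f : T -> R) (c : R) : weight f -> measurable [set x | (c < f x)%R].
Proof.
move=> [mf _]; rewrite -[X in measurable X]setTI.
have -> : [set x | (c < f x)%R] = f @^-1` `]c, +oo[.
  by apply/seteqP; split=> x /=; rewrite in_itv/= andbT.
by apply: mf => //; exact: measurable_itv.
Qed.

Lemma le_wmass_fun w g (A : set T) : weight w ->
  (forall x, A x -> (w x <= g x)%R) -> wmass mu w A <= wmass mu g A.
Proof.
by move=> ww wg; apply: le_integral_ge0 => x Ax; rewrite lee_fin ?wg//; exact: ww.2.
Qed.

(** On a cube with w-average of f at least lam, the values of f up to lam / 2 account for at most
    half of it. Hence f cut off to {f > lam / 2} still has average at least lam / 2, and the weak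
    type bound is applied to that function. *)
Lemma wmass_level_le w f s (U : set T) (lam : R) : weight w -> weight f ->
  laminar s -> (forall Q, Q \in s -> measurable Q) -> (0 < lam)%R ->
  (forall Q, Q \in s -> wmass mu w Q < +oo) -> measurable U ->
  (forall x, U x -> exists Q, [/\ Q \in s, Q x &
    lam%:E * wmass mu w Q <= wmass mu (fun x => f x * w x)%R Q]) ->
  (lam / 2)%:E * wmass mu w U <=
  wmass mu (fun x => f x * w x)%R [set x | (lam / 2 < f x)%R].
Proof.
move=> ww wf lam_s ms lam0 wfin mU Us.
pose A := [set x | (lam / 2 < f x)%R].
have mA : measurable A by exact: measurable_superlevel.
have wfw : weight (fun x => f x * w x)%R by exact: weight_mul.
pose g x := (\1_A x * (f x * w x))%R.
have wg : weight g by apply: weight_mul => //; exact: weight_indic.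
pose s' := [seq Q <- s | lam%:E * wmass mu w Q <= wmass mu (fun x => f x * w x)%R Q].
have s's Q : Q \in s' -> Q \in s by rewrite mem_filter => /andP[].
have lam2 : (0 <= lam / 2)%R by rewrite divr_ge0// ltW.
have key Q : Q \in s' -> (lam / 2)%:E * wmass mu w Q <= wmass mu g Q.
  move=> Qs'; have Qs := s's _ Qs'; have mQ := ms _ Qs.
  have wQf : wmass mu w Q \is a fin_num by rewrite ge0_fin_numE ?wmass_ge0// wfin.
  move: Qs'; rewrite mem_filter => /andP[h _].
  have : wmass mu (fun x => f x * w x)%R Q <=
      (lam / 2)%:E * wmass mu w Q + wmass mu g Q.
    rewrite /wmass -ge0_integralZl_EFin//; last 2 first.
    - by move=> x _; rewrite lee_fin; exact: ww.2.
    - exact: weight_measurable.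
    rewrite -ge0_integralD//; last 4 first.
    - by move=> x _; rewrite mule_ge0// lee_fin; exact: ww.2.
    - by apply: emeasurable_funM => //; exact: weight_measurable.
    - by move=> x _; rewrite lee_fin; exact: wg.2.
    - by apply/measurable_EFinP; apply: measurable_funTS wg.1.
    apply: le_integral_ge0 => x _; first by rewrite lee_fin; exact: wfw.2.
    rewrite -EFinM -EFinD lee_fin /g indicE; have [xA|xA] := boolP (x \in A).
      by rewrite mul1r lerDr mulr_ge0//; exact: ww.2.
    rewrite mul0r addr0 ler_wpM2r//; first exact: ww.2.
    by rewrite leNgt; apply: contra xA => xA; rewrite inE.
  move=> /(le_trans h); rewrite {1}(splitr lam) EFinD ge0_muleDl ?lee_fin//.
  by rewrite leeD2lE// fin_numM.
have UU : U `<=` \big[setU/set0]_(Q <- s') Q.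
  move=> x /Us [Q [Qs Qx h]]; apply/bigsetU_seqP; exists Q => //.
  by rewrite mem_filter h.
have mB : measurable (\big[setU/set0]_(Q <- s') Q).
  by rewrite big_seq; apply: bigsetU_measurable => Q /s's; exact: ms.
apply: le_trans (lee_wpmul2l _ (le_wmass ww mU mB UU)) _; first by rewrite lee_fin.
apply: le_trans (laminar_wmass_le ww wg lam2 _ _ key) _.
- exact: laminar_sub lam_s.
- by move=> Q /s's; exact: ms.
have := wmass_indic (fun x => f x * w x)%R mB mA; rewrite -/g => ->.
by apply: le_wmass => //; exact: measurableI.
Qed.

(** Layer-cake bound with exponentially spaced heights: at each point a single term of the series
    dominates. *)
Lemma tail_le_series w f (c : R) : weight w -> weight f -> (0 < c)%R ->
  wmass mu (fun x => f x * w x)%R [set x | (c < f x)%R] <=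
  \sum_(0 <= l <oo) (expR (l%:R + 2) * c)%:E *
    wmass mu w [set x | (expR l%:R * c < f x)%R].
Proof.
move=> ww wf c0; pose A l := [set x | (expR l%:R * c < f x)%R].
have mA l : measurable (A l) by exact: measurable_superlevel.
have a0 l : (0 <= expR (l%:R + 2) * c)%R by rewrite mulr_ge0 ?expR_ge0// ltW.
have wA l : weight (fun x => \1_(A l) x * w x)%R.
  by apply: weight_mul => //; exact: weight_indic.
have -> : \sum_(0 <= l <oo) (expR (l%:R + 2) * c)%:E * wmass mu w (A l) =
    \int[mu]_x \sum_(0 <= l <oo) ((expR (l%:R + 2) * c)%:E * (\1_(A l) x * w x)%R%:E).
  rewrite integral_nneseries//; last 2 first.
  - by move=> l; apply: emeasurable_funM => //; apply/measurable_EFinP/(wA l).1.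
  - by move=> l x _; rewrite mule_ge0 ?lee_fin//; exact: (wA l).2.
  apply: eq_eseriesr => l _; rewrite ge0_integralZl_EFin//; last 2 first.
  - by move=> x _; rewrite lee_fin; exact: (wA l).2.
  - by apply/measurable_EFinP/(wA l).1.
  by rewrite -[X in _ = _ * X]/(wmass mu _ setT) wmass_indic// setTI.
rewrite /wmass integral_mkcond; apply: le_integral_ge0 => x _.
  by apply: erestrict_ge0 => z _; rewrite lee_fin mulr_ge0 ?wf.2 ?ww.2.
have t0 l : 0 <= (expR (l%:R + 2) * c)%:E * (\1_(A l) x * w x)%R%:E.
  by rewrite mule_ge0 ?lee_fin//; exact: (wA l).2.
rewrite patchE; case: ifPn => [|_]; last by apply: nneseries_ge0 => l _ _.
(* The predecessor keeps p < y even for integral y, as the superlevel sets are strict. Then y < p +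
   2, which is where the 2 in the exponent comes from. *)
rewrite inE/= => cf; pose y := ln (f x / c); pose p := (Num.truncn y).-1.
have fc1 : (1 < f x / c)%R by rewrite ltr_pdivlMr// mul1r.
have fc0 : (0 < f x / c)%R by rewrite (lt_trans _ fc1).
have y0 : (0 < y)%R by rewrite ln_gt0.
have fE : f x = (expR y * c)%R by rewrite lnK ?posrE// divfK// gt_eqF.
apply: le_trans (nneseries_term_le p t0).
rewrite -EFinM lee_fin indicE mem_set ?mul1r; last first.
  rewrite /A/= fE ltr_pM2r// ltr_expR /p.
  have [h|h] := posnP (Num.truncn y); first by rewrite h.
  apply: (@lt_le_trans _ _ (Num.truncn y)%:R); first by rewrite ltr_nat ltn_predL.
  by rewrite truncn_le ltW.
rewrite ler_wpM2r ?ww.2// fE ler_wpM2r ?(ltW c0)// ler_expR.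
apply: (@le_trans _ _ (Num.truncn y).+1%:R); first by apply: ltW; exact: truncnS_gt.
rewrite -natrD ler_nat /p; lia.
Qed.

End weighted_mass.

(** * Norms as sums over levels *)

(** Reciprocal of the loss on an interval from z expR (- a) to z: s^r is at least expR (- a r) z^r
    there, and the integral of ds/s is at least 1 - expR (- a). *)
Definition step_const (R : realType) (r a : R) : R :=
  (expR (a * r) / (1 - expR (- a)))%R.

(** The sum is a lower sum of the Lorentz integral over disjoint intervals whose endpoints form a
    geometric progression of ratio expR a. *)
Lemma lorentz_step_sum d (T : measurableType d) (R : realType)
    (mu : {measure set T -> \bar R}) (w f : T -> R) (r t a z0 : R) (K : seq int) :
  weight w -> weight f -> (0 < r)%R -> (0 < t)%R -> (0 < a)%R -> (0 < z0)%R ->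
  uniq K ->
  \sum_(k <- K) ((z0 * expR (k%:~R * a)) `^ r)%:E *
    wmass mu w [set x | (z0 * expR (k%:~R * a) < f x)%R] `^ (r / t) <=
  (step_const r a)%:E * \int[@lebesgue_measure R]_(s in `]0%R, +oo[)
     ((s%:E * distribution_function mu w f s `^ t^-1) `^ r * (s^-1)%:E).
Proof.
move=> ww wf r0 t0 a0 z00 uK.
pose z (k : int) : R := (z0 * expR (k%:~R * a))%R.
have z_gt0 k : (0 < z k)%R by rewrite mulr_gt0 ?expR_gt0.
pose lam c := wmass mu w [set x | (c < f x)%R].
have lam0 c : 0 <= lam c by exact: wmass_ge0.
have lam_le c c' : (c <= c')%R -> lam c' <= lam c.
  move=> cc'; apply: le_wmass => //; try exact: measurable_superlevel.
  by move=> x; exact: le_lt_trans.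
pose ea : R := expR (- a).
have ea1 : (0 < 1 - ea)%R by rewrite subr_gt0 expR_lt1 oppr_lt0.
pose I k : set R := `](z k * ea)%R, (z k)]%classic.
have mI k : measurable (I k) by exact: measurable_itv.
(* A lower bound of the integrand on [I k]: the increasing factor is taken at the left endpoint, the
   decreasing ones at the right endpoint. *)
pose m k : \bar R := ((z k * ea) `^ r)%:E * lam (z k) `^ (r / t) * ((z k)^-1)%:E.
have m0 k : 0 <= m k.
  rewrite !mule_ge0 ?poweR_ge0 ?lee_fin ?powR_ge0// invr_ge0 ltW//; exact: z_gt0.
have prt : (0 <= r / t)%R by rewrite divr_ge0// ltW.
have inoo (y : \bar R) : 0 <= y -> y \in `[0, +oo] by move=> y0; rewrite in_itv/= y0 leey.
set g := fun s : R => _ : \bar R.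
have mg k s : I k s -> m k <= g s.
  rewrite /I/= in_itv/= => /andP[s1 s2].
  have s0 : (0 < s)%R by rewrite (lt_trans _ s1)// mulr_gt0// expR_gt0.
  rewrite /g /m; apply: lee_pmul.
  - by rewrite mule_ge0 ?poweR_ge0// lee_fin powR_ge0.
  - by rewrite lee_fin invr_ge0 ltW.
  - rewrite poweRM ?lee_fin ?(ltW s0) ?poweR_ge0// -poweRrM (mulrC t^-1%R).
    apply: lee_pmul; rewrite ?poweR_ge0 ?lee_fin ?powR_ge0//.
      by rewrite ge0_ler_powR ?nnegrE ?(ltW r0) ?(ltW s0) ?(ltW s1)// mulr_ge0 ?expR_ge0// ltW.
    apply: gt0_ler_poweR => //; try exact: inoo.
    exact: lam_le.
  - by rewrite lee_fin lef_pV2 ?posrE.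
have tI : trivIset [set` K] I.
  move=> j k _ _ [s [/=]]; rewrite /I/= !in_itv/= => /andP[j1 j2] /andP[k1 k2].
  have key (i l : int) : (z i * ea < s)%R -> (s <= z l)%R -> (i <= l)%R.
    move=> h1 /(lt_le_trans h1); rewrite /z /ea -mulrA ltr_pM2l// -expRD ltr_expR.
    rewrite -[X in (_ - X < _)%R](mul1r a) -mulrBl ltr_pM2r// ltrBlDr -intrD1 ltr_int.
    by rewrite ltzD1.
  by apply/eqP; rewrite eq_le !key.
have Ipos k : I k `<=` `]0%R, +oo[.
  move=> s; rewrite /I/= !in_itv/= andbT => /andP[s1 _].
  by rewrite (lt_trans _ s1)// mulr_gt0// expR_gt0.
have muI k : @lebesgue_measure R (I k) = (z k * (1 - ea))%:E.
  rewrite /I lebesgue_measure_itv/= lte_fin gtr_pMr// expR_lt1 oppr_lt0 a0 -EFinB.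
  by rewrite mulrBr mulr1.
have step : \sum_(k <- K) m k * (z k * (1 - ea))%:E <=
    \int[@lebesgue_measure R]_(s in `]0%R, +oo[) g s.
  apply: (@le_trans _ _ (\int[@lebesgue_measure R]_(s in `]0%R, +oo[)
      \sum_(k <- K) m k * (\1_(I k) s)%:E)).
    rewrite ge0_integral_sum_seq//; last 2 first.
    - move=> k _; apply: emeasurable_funM => //.
      by apply/measurable_EFinP/measurable_indic; exact: mI.
    - by move=> k s _ _; rewrite mule_ge0// lee_fin.
    apply: lee_sum => k _; rewrite ge0_integralZl//; last first.
      by apply/measurable_EFinP/measurable_indic; exact: mI.
    rewrite integral_indic//; last exact: mI.
    apply: lee_wpmul2l => //; rewrite setIidl// le_eqVlt.
    by apply/orP; left; apply/eqP/esym; exact: muI.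
  apply: le_integral_ge0 => s; rewrite /= in_itv/= andbT => s0.
    by apply: sume_ge0 => k _; rewrite mule_ge0// lee_fin.
  apply: sum_disjoint_indic_le => //; last by move=> k _; exact: mg.
  by rewrite /g mule_ge0 ?poweR_ge0// lee_fin invr_ge0 ltW.
apply: le_trans (lee_wpmul2l _ step); last first.
  by rewrite lee_fin divr_ge0 ?expR_ge0// ltW.
rewrite ge0_sume_distrr => [|k _]; last first.
  by rewrite mule_ge0// lee_fin mulr_ge0// ltW.
rewrite le_eqVlt; apply/orP; left; apply/eqP; apply: eq_bigr => k _.
rewrite -/(z k) -/(lam (z k)) /m.
have -> : (z k `^ r = step_const r a *
    ((z k * ea) `^ r * ((z k)^-1 * (z k * (1 - ea)))))%R.
  rewrite powRM ?expR_ge0// ?(ltW (z_gt0 k))//.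
  have -> : (ea `^ r = (expR (a * r))^-1)%R by rewrite /ea -expRM mulNr expRN.
  rewrite /step_const -/ea; field.
  by rewrite !gt_eqF ?expR_gt0.
move: (step_const r a) (lam (z k) `^ _) => S P.
rewrite EFinM -!muleA; congr (_ * _); rewrite EFinM -!muleA; congr (_ * _).
by rewrite EFinM muleC.
Qed.

Lemma lorentz_norm_powE d (T : measurableType d) (R : realType)
    (mu : {measure set T -> \bar R}) (w f : T -> R) (r t : R) :
  (0 < r)%R -> (0 < t)%R ->
  lorentz_norm mu w t r f `^ r = t%:E * \int[@lebesgue_measure R]_(s in `]0%R, +oo[)
     ((s%:E * distribution_function mu w f s `^ t^-1) `^ r * (s^-1)%:E).
Proof.
move=> r0 t0; rewrite /lorentz_norm poweRM ?poweR_ge0 ?lee_fin ?powR_ge0//.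
rewrite poweR_EFin -powRrM -poweRrM mulVf ?gt_eqF// powRr1 ?(ltW t0)//.
rewrite poweRe1//; apply: integral_ge0 => s; rewrite /= in_itv/= andbT => s0.
by rewrite mule_ge0 ?poweR_ge0// lee_fin invr_ge0 ltW.
Qed.

(** The hypothesis bounds [V k] by a series of superlevel masses at the heights e^l times a base
    height. The power r / t is taken inside that series; for fixed l the sum over k is a lower sum
    of the Lorentz integral, scaled by e^(- r l). *)
Lemma lorentz_level_sum (R : realType) (r t : R) : (0 < r)%R -> (1 < t)%R ->
  exists2 C : R, (0 < C)%R & forall d (T : measurableType d)
    (mu : {measure set T -> \bar R}) (w f : T -> R) (K : seq int)
    (V : int -> \bar R), weight w -> weight f -> uniq K ->
    (forall k, 0 <= V k) ->
    (forall k, k \in K -> (expR (k%:~R * t^-1) / 2)%:E * V k <=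
      wmass mu (fun x => f x * w x)%R [set x | (expR (k%:~R * t^-1) / 2 < f x)%R]) ->
    \sum_(k <- K) ((expR k%:~R)%:E * V k) `^ (r / t) <=
    C%:E * lorentz_norm mu w t r f `^ r.
Proof.
move=> r0 t1; have t0 : (0 < t)%R by rewrite (lt_trans _ t1).
pose p : R := (r / t)%R; have p0 : (0 < p)%R by rewrite divr_gt0.
have pr : (p < r)%R by rewrite ltr_pdivrMr// ltr_pMr.
(* Half of the gap r - p, positive because t > 1, pays for taking the power inside the series; the
   other half keeps the series over l convergent. *)
pose e : R := ((r - p) / 2)%R; have e0 : (0 < e)%R by rewrite divr_gt0// subr_gt0.
have [C0 C00 HC0] := series_poweR_le p0 e0.
have tV0 : (0 < t^-1)%R by rewrite invr_gt0.
pose Cs : R := step_const r t^-1.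
have Cs0 : (0 < Cs)%R.
  by rewrite divr_gt0 ?expR_gt0// subr_gt0 expR_lt1 oppr_lt0.
pose G : R := ((1 - expR (- e))^-1)%R.
have G0 : (0 < G)%R by rewrite invr_gt0 subr_gt0 expR_lt1 oppr_lt0.
pose B : R := (C0 * expR (2 * p) * 2 `^ r * Cs)%R.
have B0 : (0 < B)%R.
  by rewrite mulr_gt0// mulr_gt0 ?powR_gt0// mulr_gt0 ?expR_gt0.
exists (B * G / t)%R; first by rewrite divr_gt0// mulr_gt0.
move=> d T mu w f K V ww wf uK V0 HV.
rewrite lorentz_norm_powE// muleA -EFinM divfK ?gt_eqF//.
set L := \int[_]_(s in _) _.
have L0 : 0 <= L.
  apply: integral_ge0 => s; rewrite /= in_itv/= andbT => s0.
  by rewrite mule_ge0 ?poweR_ge0// lee_fin invr_ge0 ltW.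
pose c (k : int) : R := (expR (k%:~R * t^-1) / 2)%R.
have c0 k : (0 < c k)%R by rewrite divr_gt0 ?expR_gt0.
pose lam y := wmass mu w [set x | (y < f x)%R].
have lam0 y : 0 <= lam y by exact: wmass_ge0.
have inoo (y : \bar R) : 0 <= y -> y \in `[0, +oo] by move=> y0; rewrite in_itv/= y0 leey.
have Vle k : k \in K -> V k <= \sum_(0 <= l <oo) (expR (l%:R + 2))%:E * lam (expR l%:R * c k)%R.
  move=> /HV/le_trans/(_ (tail_le_series mu ww wf (c0 k))) H.
  have -> : V k = ((c k)^-1)%:E * ((c k)%:E * V k).
    by rewrite muleA -EFinM mulVf ?mul1e// gt_eqF.
  rewrite lee_pdivrMl//; apply: le_trans H _; rewrite -nneseriesZl => [|l _]; last first.
    by rewrite mule_ge0// lee_fin expR_ge0.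
  apply: lee_nneseries => [l _ _|l _].
    by rewrite mule_ge0// ?lee_fin ?mulr_ge0 ?expR_ge0// ?(ltW (c0 k))//; exact: lam0.
  by rewrite [in leLHS]mulrC EFinM -muleA le_eqVlt eqxx.
pose A l : R := (C0 * (expR (e * l%:R) * expR (p * (l%:R + 2))))%R.
have A0 l : (0 <= A l)%R by rewrite !mulr_ge0 ?expR_ge0// ltW.
pose X k l := (expR (p * k%:~R))%:E * lam (expR l%:R * c k)%R `^ p.
have X0 k l : 0 <= X k l by rewrite mule_ge0 ?poweR_ge0// lee_fin expR_ge0.
have term k : k \in K -> ((expR k%:~R)%:E * V k) `^ p <=
    \sum_(0 <= l <oo) (A l)%:E * X k l.
  move=> kK; rewrite poweRM ?V0 ?lee_fin ?expR_ge0// poweR_EFin -expRM (mulrC _ p).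
  have s0 : 0 <= \sum_(0 <= l <oo) (expR (l%:R + 2))%:E * lam (expR l%:R * c k)%R.
    by apply: nneseries_ge0 => l _ _; rewrite mule_ge0// lee_fin expR_ge0.
  have := gt0_ler_poweR (ltW p0) (inoo _ (V0 k)) (inoo _ s0) (Vle k kK).
  move=> /le_trans/(_ (HC0 _ _)) H; apply: le_trans (lee_wpmul2l _ (H _)) _.
  - by rewrite lee_fin expR_ge0.
  - by move=> l; rewrite mule_ge0// lee_fin expR_ge0.
  have y0 l : 0 <= (expR (e * l%:R))%:E *
      ((expR (l%:R + 2))%:E * lam (expR l%:R * c k)%R) `^ p.
    by rewrite mule_ge0 ?poweR_ge0// lee_fin expR_ge0.
  rewrite muleA -EFinM -nneseriesZl//; apply: lee_nneseries => [l _ _|l _].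
    by rewrite mule_ge0// lee_fin mulr_ge0 ?expR_ge0// ltW.
  rewrite poweRM ?lee_fin ?expR_ge0// poweR_EFin -expRM (mulrC _ p) /A /X.
  rewrite !muleA -!EFinM le_eqVlt; apply/orP; left; apply/eqP; congr (_%:E * _); ring.
apply: (@le_trans _ _ (\sum_(k <- K) \sum_(0 <= l <oo) (A l)%:E * X k l)).
  by rewrite big_seq [leRHS]big_seq; apply: lee_sum => k; exact: term.
rewrite -nneseries_sum => [|k l _]; last by rewrite mule_ge0// lee_fin.
(* The exponents of growth in l are e from the power of the series, p from the heights and - r from
   scaling; they add up to - e. *)
have level l : \sum_(k <- K) (A l)%:E * X k l <= (B * expR (- (e * l%:R)))%:E * L.
  rewrite -ge0_sume_distrr//.
  have z00 : (0 < expR l%:R / 2 :> R)%R by rewrite divr_gt0 ?expR_gt0.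
  have H := lorentz_step_sum mu ww wf r0 t0 tV0 z00 uK.
  have -> : \sum_(k <- K) X k l = (2 `^ r * expR (- (r * l%:R)))%:E *
      \sum_(k <- K) ((expR l%:R / 2 * expR (k%:~R * t^-1)) `^ r)%:E *
        wmass mu w [set x | (expR l%:R / 2 * expR (k%:~R * t^-1) < f x)%R] `^ (r / t).
    rewrite ge0_sume_distrr => [|k _]; last by rewrite mule_ge0 ?poweR_ge0// lee_fin powR_ge0.
    apply: eq_bigr => k _; rewrite /X muleA -EFinM.
    have -> : (expR l%:R * c k = expR l%:R / 2 * expR (k%:~R * t^-1))%R by rewrite /c; ring.
    congr (_%:E * _).
    set x := (_ * _ * expR (k%:~R * t^-1))%R.
    have x0 : (0 <= x)%R by rewrite mulr_ge0 ?expR_ge0// ltW.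
    have h : (2 `^ r * x `^ r = expR (l%:R + k%:~R * t^-1) `^ r)%R.
      by rewrite -powRM//; congr (_ `^ _)%R; rewrite /x expRD; field.
    by rewrite [RHS]mulrAC h -expRM -expRD /p; congr expR; field; rewrite gt_eqF.
  rewrite muleA; apply: le_trans (lee_wpmul2l _ H) _.
    by rewrite lee_fin mulr_ge0// mulr_ge0 ?powR_ge0 ?expR_ge0.
  rewrite -/Cs -/L muleA -EFinM lee_wpmul2r// lee_fin le_eqVlt; apply/orP; left; apply/eqP.
  rewrite /A /B.
  have h : (expR (e * l%:R) * expR (p * (l%:R + 2)) * expR (- (r * l%:R)) =
      expR (2 * p) * expR (- (e * l%:R)))%R.
    by rewrite -!expRD; congr expR; rewrite /e; field.
  transitivity (C0 * 2 `^ r * Cs * (expR (e * l%:R) * expR (p * (l%:R + 2)) *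
    expR (- (r * l%:R))))%R; first by ring.
  by rewrite h; ring.
have [Ly|Ly] := eqVneq L +oo.
  by rewrite Ly gt0_muley ?leey// lte_fin mulr_gt0.
have Lf : L \is a fin_num by rewrite ge0_fin_numE// ltey.
apply: (@le_trans _ _ (\sum_(0 <= l <oo) (B * fine L)%:E * (expR (- (e * l%:R)))%:E)).
  apply: lee_nneseries => [l _ _|l _].
    by apply: sume_ge0 => k _; rewrite mule_ge0// lee_fin.
  apply: le_trans (level l) _; rewrite -(fineK Lf) -!EFinM lee_fin.
  by rewrite le_eqVlt; apply/orP; left; apply/eqP; ring.
rewrite nneseriesZl => [|l _]; last by rewrite lee_fin expR_ge0.
apply: le_trans (lee_wpmul2l _ (nneseries_geom_le e0)) _.
  by rewrite lee_fin mulr_ge0 ?fine_ge0// ltW.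
rewrite -/G -[in leRHS](fineK Lf) -!EFinM lee_fin.
by rewrite le_eqVlt; apply/orP; left; apply/eqP; ring.
Qed.

(** Sum and integral are exchanged. At a point only heights below f x count, and the geometric sum
    of e^((1 - 1/t) k) over them is of the order of (2 f x)^(t - 1). *)
Lemma Lt_level_sum (R : realType) (t : R) : (1 < t)%R ->
  exists2 C : R, (0 < C)%R & forall d (T : measurableType d)
    (mu : {measure set T -> \bar R}) (w f : T -> R) (K : seq int)
    (V : int -> \bar R), weight w -> weight f -> uniq K ->
    (forall k, k \in K -> (expR (k%:~R * t^-1) / 2)%:E * V k <=
      wmass mu (fun x => f x * w x)%R [set x | (expR (k%:~R * t^-1) / 2 < f x)%R]) ->
    \sum_(k <- K) (expR k%:~R)%:E * V k <=
    C%:E * \int[mu]_x (f x `^ t * w x)%R%:E.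
Proof.
move=> t1; have t0 : (0 < t)%R by rewrite (lt_trans _ t1).
pose a : R := (1 - t^-1)%R.
have a0 : (0 < a)%R by rewrite subr_gt0 invf_lt1.
have [C1 C10 HC1] := sum_expR_int_le a0.
pose C := (2 * C1 * 2 `^ (t - 1))%R.
have C0 : (0 < C)%R by rewrite !mulr_gt0 ?powR_gt0.
exists C => // d T mu w f K V ww wf uK HV.
pose c (k : int) : R := (expR (k%:~R * t^-1) / 2)%R.
have c0 k : (0 < c k)%R by rewrite divr_gt0 ?expR_gt0.
pose A k := [set x | (c k < f x)%R].
have mA k : measurable (A k) by exact: measurable_superlevel.
pose b (k : int) : R := (2 * expR (a * k%:~R))%R.
have b0 k : (0 <= b k)%R by rewrite mulr_ge0 ?expR_ge0.
have wfw : weight (fun x => f x * w x)%R by exact: weight_mul.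
have wA k : weight (fun x => \1_(A k) x * (f x * w x))%R.
  by apply: weight_mul => //; exact: weight_indic.
have wft : weight (fun x => f x `^ t * w x)%R.
  apply: weight_mul => //; split.
    exact: (measurableT_comp (measurable_powR t) wf.1).
  by move=> x; exact: powR_ge0.
have term k : k \in K -> (expR k%:~R)%:E * V k <=
    \int[mu]_x ((b k)%:E * (\1_(A k) x * (f x * w x))%R%:E).
  move=> kK; rewrite ge0_integralZl_EFin//; last 2 first.
  - by move=> x _; rewrite lee_fin; exact: (wA k).2.
  - by apply/measurable_EFinP/(wA k).1.
  have -> : (expR k%:~R = b k * c k)%R.
    transitivity (expR (a * k%:~R) * expR (k%:~R * t^-1))%R.
      by rewrite -expRD /a; congr expR; ring.
    by rewrite /b /c; field.
  rewrite EFinM -muleA lee_wpmul2l ?lee_fin//; apply: le_trans (HV k kK) _.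
  by rewrite -/(c k) -/(A k) -[leRHS]/(wmass mu _ setT) wmass_indic// setTI.
apply: (@le_trans _ _ (\sum_(k <- K) \int[mu]_x ((b k)%:E * (\1_(A k) x * (f x * w x))%R%:E))).
  by rewrite big_seq [leRHS]big_seq; apply: lee_sum => k; exact: term.
rewrite -ge0_integral_sum_seq//; last 2 first.
- by move=> k _; apply: emeasurable_funM => //; apply/measurable_EFinP/(wA k).1.
- by move=> k x _ _; rewrite mule_ge0 ?lee_fin//; exact: (wA k).2.
rewrite -ge0_integralZl_EFin ?(ltW C0)//; last 2 first.
- by move=> x _; rewrite lee_fin; exact: wft.2.
- by apply/measurable_EFinP/wft.1.
apply: le_integral_ge0 => x _.
  by apply: sume_ge0 => k _; rewrite mule_ge0 ?lee_fin//; exact: (wA k).2.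
under eq_bigr do rewrite -EFinM; rewrite sumEFin -EFinM lee_fin.
under eq_bigr do rewrite mulrA; rewrite -mulr_suml [leRHS]mulrA mulrA.
rewrite ler_wpM2r ?ww.2//.
have -> : (\sum_(k <- K) b k * \1_(A k) x = \sum_(k <- K | (c k < f x)%R) b k)%R.
  rewrite [RHS]big_mkcond/=; apply: eq_bigr => k _; rewrite indicE.
  case: ifPn => h; first by rewrite mem_set ?mulr1.
  by rewrite memNset ?mulr0// => /= h'; rewrite h' in h.
have [f0|f0] := leP (f x) 0%R.
  rewrite big1 => [|k ck].
    by rewrite mul0r; apply: mulr_ge0; [exact: ltW|exact: powR_ge0].
  by have := lt_le_trans ck f0; rewrite ltNge (ltW (c0 k)).
(* The condition [c k < f x] gives k at most z, and expR (a z) is the power t - 1 of 2 f x. *)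
pose z := (t * ln (2 * f x))%R.
have f20 : (0 < 2 * f x)%R by rewrite mulr_gt0.
have H : (\sum_(k <- K | (c k < f x)%R) b k <= 2 * (C1 * expR (a * z)))%R.
  rewrite -mulr_sumr ler_wpM2l// -big_filter; apply: HC1; first exact: filter_uniq.
  move=> k; rewrite mem_filter => /andP[ck _].
  rewrite /z -ler_pdivrMl// mulrC -ler_expR lnK ?posrE//.
  by rewrite [leRHS]mulrC -ler_pdivrMr// ltW.
apply: le_trans (ler_wpM2r (ltW f0) H) _.
have -> : (a * z = (t - 1) * ln (2 * f x))%R.
  by rewrite /a /z; field; rewrite gt_eqF.
have -> : (expR ((t - 1) * ln (2 * f x)) = (2 * f x) `^ (t - 1))%R.
  by rewrite /powR gt_eqF.
rewrite powRM ?(ltW f0)// -(mulr_powRB1 (ltW f0) t0) /C le_eqVlt.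
by apply/orP; left; apply/eqP; ring.
Qed.

(* B bounds the weak norm sup_k e^(k t) w(f > e^k), which both the L^t and the
   L^(t,r) norm control. *)
Lemma weak_finite d (T : measurableType d) (R : realType)
    (mu : {measure set T -> \bar R}) (w f : T -> R) (t B : R) (A : set T) :
  weight w -> weight f -> (1 < t)%R -> measurable A -> wmass mu w A < +oo ->
  (0 <= B)%R ->
  (forall k : int, (expR (k%:~R * t))%:E * wmass mu w [set x | (expR k%:~R < f x)%R]
    <= B%:E) ->
  wmass mu (fun x => f x * w x)%R A < +oo.
Proof.
move=> ww wf t1 mA wA B0 HB.
pose S := [set x | (1 < f x)%R].
have mS : measurable S by exact: measurable_superlevel.
have wfw : weight (fun x => f x * w x)%R by exact: weight_mul.
have AE : A `<=` (A `\` S) `|` S.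
  by move=> x Ax; have [|] := pselect (S x); [right|left].
have mAS : measurable (A `\` S) by exact: measurableD.
apply: (le_lt_trans (le_wmass _ wfw mA (measurableU _ _ mAS mS) AE)).
rewrite wmassU//; last by apply/seteqP; split=> x // [[_ h] /h].
apply: lte_add_pinfty.
  apply: (@le_lt_trans _ _ (wmass mu w A)) => //.
  apply: (@le_trans _ _ (wmass mu w (A `\` S))).
    apply: le_wmass_fun => // x [_ /negP]; rewrite /S/= -leNgt => fx.
    by rewrite ler_piMl//; exact: ww.2.
  by apply: le_wmass => // x [].
apply: (le_lt_trans (tail_le_series mu ww wf ltr01)).
have t10 : (0 < t - 1)%R by rewrite subr_gt0.
(* The weak bound gives decay e^(- t l) of the superlevel masses against growth e^l of the heights,
   so t > 1 gives convergence. *)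
apply: (@le_lt_trans _ _ (\sum_(0 <= l <oo) (expR 2 * B)%:E * (expR (- ((t - 1) * l%:R)))%:E)).
  apply: lee_nneseries => [l _ _|l _].
    by rewrite mule_ge0 ?wmass_ge0// lee_fin mulr1 expR_ge0.
  have := HB l%:Z; rewrite -pmulrn mulr1 => H.
  have -> : [set x | (expR l%:R * 1 < f x)%R] = [set x | (expR l%:R < f x)%R].
    by rewrite mulr1.
  have -> : (expR (l%:R + 2) = expR 2 * expR (- ((t - 1) * l%:R)) * expR (l%:R * t))%R.
    by rewrite -!expRD; congr expR; ring.
  rewrite EFinM -muleA; apply: le_trans (lee_wpmul2l _ H) _.
    by rewrite lee_fin mulr_ge0 ?expR_ge0.
  by rewrite -!EFinM lee_fin mulrAC.
rewrite nneseriesZl => [|l _]; last by rewrite lee_fin expR_ge0.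
apply: (@le_lt_trans _ _ ((expR 2 * B)%:E * ((1 - expR (- (t - 1)))^-1)%:E)).
  by rewrite lee_wpmul2l ?nneseries_geom_le// lee_fin mulr_ge0 ?expR_ge0.
by rewrite -EFinM ltry.
Qed.

(** The sets {f > e^(-n)} exhaust {f > 0}, and f w has mass 0 on each. Consequently a vanishing norm
    forces vanishing integrals. *)
Lemma weak_zero d (T : measurableType d) (R : realType)
    (mu : {measure set T -> \bar R}) (w f : T -> R) (A : set T) :
  weight w -> weight f -> measurable A ->
  (forall k : int, wmass mu w [set x | (expR k%:~R < f x)%R] = 0) ->
  wmass mu (fun x => f x * w x)%R A = 0.
Proof.
move=> ww wf mA H0.
have wfw : weight (fun x => f x * w x)%R by exact: weight_mul.
have tail0 (n : nat) :
    wmass mu (fun x => f x * w x)%R [set x | (expR (- n%:R) < f x)%R] = 0.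
  apply/eqP; rewrite eq_le wmass_ge0// andbT.
  apply: le_trans (tail_le_series mu ww wf (expR_gt0 _)) _.
  apply: nneseries_le => [l|l].
    by rewrite mule_ge0 ?wmass_ge0// lee_fin mulr_ge0 ?expR_ge0.
  rewrite big1// => i _.
  have -> : (expR i%:R * expR (- n%:R) = expR (i%:Z - n%:Z)%:~R :> R)%R.
    by rewrite -expRD intrB.
  by rewrite H0 mule0.
pose S (n : nat) := [set x | (expR (- n%:R) < f x)%R].
have mS n : measurable (S n) by exact: measurable_superlevel.
have wS n : weight (fun x => \1_(S n) x * (f x * w x))%R.
  by apply: weight_mul => //; exact: weight_indic.
apply/eqP; rewrite eq_le wmass_ge0// andbT.
apply: (@le_trans _ _ (\int[mu]_x \sum_(0 <= n <oo) (\1_(S n) x * (f x * w x))%R%:E)).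
  rewrite /wmass integral_mkcond; apply: le_integral_ge0 => x _.
    by apply: erestrict_ge0 => y _; rewrite lee_fin; exact: wfw.2.
  have t0 n : 0 <= (\1_(S n) x * (f x * w x))%R%:E by rewrite lee_fin; exact: (wS n).2.
  rewrite patchE; case: ifPn => _; last by apply: nneseries_ge0 => n _ _.
  have := wf.2 x; rewrite le_eqVlt => /predU1P[<-|f0].
    by rewrite mul0r; apply: nneseries_ge0 => n _ _.
  pose n := (Num.truncn (- ln (f x))).+1.
  apply: le_trans (nneseries_term_le n t0).
  rewrite indicE mem_set ?mul1r// /S/=.
  rewrite -[ltRHS](lnK (_ : f x \is Num.pos)) ?posrE// ltr_expR ltrNl.
  exact: truncnS_gt.
rewrite integral_nneseries//; last 2 first.
- by move=> n; apply/measurable_EFinP/(wS n).1.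
- by move=> n x _; rewrite lee_fin; exact: (wS n).2.
apply: nneseries_le => [n|n]; first by apply: integral_ge0 => x _; rewrite lee_fin; exact: (wS n).2.
rewrite big1// => i _.
by rewrite -[LHS]/(wmass mu _ setT) wmass_indic// setTI tail0.
Qed.

(** Chebyshev's inequality at the height e^k. *)
Lemma Lt_weak d (T : measurableType d) (R : realType)
    (mu : {measure set T -> \bar R}) (w f : T -> R) (t : R) (k : int) :
  weight w -> weight f -> (0 < t)%R ->
  (expR (k%:~R * t))%:E * wmass mu w [set x | (expR k%:~R < f x)%R] <=
  \int[mu]_x (f x `^ t * w x)%R%:E.
Proof.
move=> ww wf t0; pose S := [set x | (expR k%:~R < f x)%R].
have mS : measurable S by exact: measurable_superlevel.
have wS : weight (fun x => \1_S x * w x)%R by apply: weight_mul => //; exact: weight_indic.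
rewrite -/S -[S]setTI -wmass_indic// -ge0_integralZl_EFin ?expR_ge0//; last 2 first.
- by move=> x _; rewrite lee_fin; exact: wS.2.
- by apply/measurable_EFinP/wS.1.
apply: le_integral_ge0 => x _.
  by rewrite mule_ge0 ?lee_fin ?expR_ge0//; exact: wS.2.
rewrite -EFinM lee_fin mulrA ler_wpM2r ?ww.2// indicE.
have [xS|xS] := boolP (x \in S); last by rewrite mulr0 powR_ge0.
rewrite mulr1 expRM ge0_ler_powR ?nnegrE ?expR_ge0 ?wf.2// ?(ltW t0)//.
by move: xS; rewrite inE => /ltW.
Qed.

(** A single interval of the lower sum for the Lorentz integral, raised to the power t / r. *)
Lemma lorentz_weak d (T : measurableType d) (R : realType)
    (mu : {measure set T -> \bar R}) (w f : T -> R) (r t : R) (k : int) :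
  weight w -> weight f -> (0 < r)%R -> (0 < t)%R ->
  (expR (k%:~R * t))%:E * wmass mu w [set x | (expR k%:~R < f x)%R] <=
  ((step_const r 1 / t)%:E * lorentz_norm mu w t r f `^ r) `^ (t / r).
Proof.
move=> ww wf r0 t0; rewrite lorentz_norm_powE// muleA -EFinM divfK ?gt_eqF//.
have := lorentz_step_sum mu ww wf r0 t0 ltr01 ltr01 (isT : uniq [:: k]).
rewrite big_seq1 mul1r mulr1; set L := _ * \int[_]_(_ in _) _; set lam := wmass _ _ _ => H.
have lam0 : 0 <= lam by exact: wmass_ge0.
have inoo (y : \bar R) : 0 <= y -> y \in `[0, +oo] by move=> y0; rewrite in_itv/= y0 leey.
have l0 : 0 <= (expR k%:~R `^ r)%:E * lam `^ (r / t).
  by rewrite mule_ge0 ?poweR_ge0// lee_fin powR_ge0.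
have tr0 : (0 <= t / r)%R by rewrite divr_ge0// ltW.
have := gt0_ler_poweR tr0 (inoo _ l0) (inoo _ (le_trans l0 H)) H.
rewrite poweRM ?poweR_ge0 ?lee_fin ?powR_ge0// poweR_EFin -powRrM -poweRrM.
have -> : (r * (t / r) = t)%R by field; rewrite gt_eqF.
have -> : (r / t * (t / r) = 1)%R by field; rewrite !gt_eqF.
by rewrite poweRe1// -expRM.
Qed.

(** * Positivity and finiteness of the norms *)

Section norm_facts.
Context d (T : measurableType d) (R : realType) (mu : {measure set T -> \bar R}).
Variables (w f : T -> R) (r t : R) (A : set T).
Hypotheses (ww : weight w) (wf : weight f) (r0 : (0 < r)%R) (t1 : (1 < t)%R).
Hypothesis mA : measurable A.

Let t0 : (0 < t)%R. Proof. by rewrite (lt_trans _ t1). Qed.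
Let X := \int[mu]_x (f x `^ t * w x)%R%:E.
Let X0 : 0 <= X.
Proof. by apply: integral_ge0 => x _; rewrite lee_fin mulr_ge0 ?powR_ge0// ww.2. Qed.
Let wfw : weight (fun x => f x * w x)%R. Proof. exact: weight_mul. Qed.

Lemma weak_bound_finite (B : \bar R) : 0 <= B -> B < +oo ->
  (forall k : int, (expR (k%:~R * t))%:E * wmass mu w [set x | (expR k%:~R < f x)%R]
    <= B) ->
  wmass mu w A < +oo -> wmass mu (fun x => f x * w x)%R A < +oo.
Proof.
move=> B0 By H wA; have Bf : B \is a fin_num by rewrite ge0_fin_numE.
apply: (@weak_finite _ _ _ mu w f t (fine B) A) => //; first exact: fine_ge0.
by move=> k; rewrite fineK.
Qed.

Lemma weak_bound_zero :
  (forall k : int, (expR (k%:~R * t))%:E * wmass mu w [set x | (expR k%:~R < f x)%R]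
    <= 0) ->
  wmass mu (fun x => f x * w x)%R A = 0.
Proof.
move=> H; apply: weak_zero => // k; apply/eqP; rewrite eq_le wmass_ge0// andbT.
by have := H k; rewrite pmule_rle0// lte_fin expR_gt0.
Qed.

Lemma Lnorm_gt0 : 0 < wmass mu (fun x => f x * w x)%R A ->
  0 < weighted_Lnorm mu w t f.
Proof.
move=> F0; rewrite /weighted_Lnorm -/X poweR_gt0//.
rewrite lt_neqAle X0 andbT; apply: contraTN F0 => /eqP XE.
by rewrite weak_bound_zero ?ltxx// => k; rewrite XE; exact: Lt_weak.
Qed.

Lemma Lnorm_finite : weighted_Lnorm mu w t f < +oo -> wmass mu w A < +oo ->
  wmass mu (fun x => f x * w x)%R A < +oo.
Proof.
move=> /lty_poweRy Xy; apply: (weak_bound_finite X0) => [|k]; last exact: Lt_weak.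
by apply: Xy; rewrite invr_eq0 gt_eqF.
Qed.

Lemma lorentz_ge0 : 0 <= lorentz_norm mu w t r f.
Proof. by rewrite /lorentz_norm mule_ge0 ?poweR_ge0// lee_fin powR_ge0. Qed.

Lemma lorentz_gt0 : 0 < wmass mu (fun x => f x * w x)%R A ->
  0 < lorentz_norm mu w t r f.
Proof.
move=> F0; rewrite lt_neqAle lorentz_ge0 andbT; apply: contraTN F0 => /eqP XE.
rewrite weak_bound_zero ?ltxx// => k.
apply: le_trans (lorentz_weak mu k ww wf r0 t0) _.
by rewrite -XE poweR0r ?gt_eqF// mule0 poweR0r// gt_eqF// divr_gt0.
Qed.

Lemma lorentz_finite : lorentz_norm mu w t r f < +oo -> wmass mu w A < +oo ->
  wmass mu (fun x => f x * w x)%R A < +oo.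
Proof.
move=> Ny; apply: (@weak_bound_finite (((step_const r 1 / t)%:E *
  lorentz_norm mu w t r f `^ r) `^ (t / r))) => [||k]; last exact: lorentz_weak.
- exact: poweR_ge0.
have c0 : (0 <= step_const r 1 / t)%R.
  by rewrite divr_ge0 ?(ltW t0)// divr_ge0 ?expR_ge0// subr_ge0 -[leRHS]expR0 ler_expR oppr_le0.
apply: poweR_lty; have Nf : lorentz_norm mu w t r f \is a fin_num.
  by rewrite ge0_fin_numE// lorentz_ge0.
by rewrite -(fineK Nf) poweR_EFin -EFinM ltry.
Qed.

End norm_facts.

(** * Levels of the maximal weighted averages *)

Section level_sets.
Context d (T : measurableType d) (R : realType) (mu : {measure set T -> \bar R}).
Variables (w f : T -> R) (t : R) (s : seq (set T)).
Hypotheses (ww : weight w) (wf : weight f) (t0 : (0 < t)%R).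
Hypotheses (lam_s : laminar s) (ms : forall Q, Q \in s -> measurable Q).
Hypothesis wpos : forall Q, Q \in s -> 0 < wmass mu w Q < +oo.
Hypothesis fpos : forall Q, Q \in s -> 0 < wmass mu (fun x => f x * w x)%R Q < +oo.

Definition wavg Q : R :=
  (fine (wmass mu (fun x => f x * w x)%R Q) / fine (wmass mu w Q))%R.

Definition max_wavg Q : R := \big[Num.max/0%R]_(P <- s | subsetb Q P) wavg P.

(** The factor t makes e^level comparable to the t-th power of the average, so that e^k times the
    w-mass of level k sums to the t-th power of a norm. *)
Definition level Q : int := Num.floor (t * ln (max_wavg Q)).

Definition level_set (k : int) : set T := \big[setU/set0]_(Q <- s | level Q == k) Q.

Let wavg_gt0 Q : Q \in s -> (0 < wavg Q)%R.
Proof. by move=> Qs; rewrite divr_gt0// fine_gt0 ?fpos ?wpos. Qed.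

Lemma le_max_wavg P Q : P \in s -> subsetb Q P -> (wavg P <= max_wavg Q)%R.
Proof.
rewrite /max_wavg; elim: s => // a l IH; rewrite inE big_cons => /predU1P[<-|Pl] QP.
  by rewrite QP le_max lexx.
by case: ifP => _; rewrite ?le_max ?IH ?orbT.
Qed.

(** The default value 0 of the maximum is excluded, since Q itself takes part with a positive
    average. *)
Lemma max_wavg_attained Q : Q \in s ->
  exists P, [/\ P \in s, subsetb Q P & max_wavg Q = wavg P].
Proof.
move=> Qs; have [//|max0] : (exists P, [/\ P \in s, subsetb Q P & max_wavg Q = wavg P])
    \/ max_wavg Q = 0%R.
  rewrite /max_wavg; elim: (s) => [|a l [[P [Pl QP IH]]|IH]]; first by right; rewrite big_nil.
    rewrite big_cons IH; left; case: ifPn => Qa; last by exists P; rewrite inE Pl orbT.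
    case: (leP (wavg a) (wavg P)) => _; first by exists P; rewrite inE Pl orbT.
    by exists a; rewrite mem_head.
  rewrite big_cons IH; case: ifPn => Qa; last by right.
  case: (leP (wavg a) 0%R) => _; first by right.
  by left; exists a; rewrite mem_head.
have := le_max_wavg Qs (subsetb_refl Q); rewrite max0 leNgt.
by rewrite wavg_gt0.
Qed.

Lemma max_wavg_gt0 Q : Q \in s -> (0 < max_wavg Q)%R.
Proof.
by move=> Qs; rewrite (lt_le_trans (wavg_gt0 Qs))// le_max_wavg// subsetb_refl.
Qed.

Lemma level_anti P Q : P \in s -> Q \in s -> subsetb P Q -> (level Q <= level P)%R.
Proof.
move=> Ps Qs PQ; rewrite /level floor_ge_int.
apply: le_trans (floor_le _) _; rewrite ler_wpM2l ?(ltW t0)//.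
rewrite ler_ln ?posrE ?max_wavg_gt0//.
have [Q' [Q's QQ' ->]] := max_wavg_attained Qs.
by apply: le_max_wavg => //; exact: subsetb_trans PQ QQ'.
Qed.

Lemma wavg_powR_le Q (p : R) : Q \in s -> (0 <= p)%R ->
  (wavg Q `^ p <= expR (p / t) * expR (level Q)%:~R `^ (p / t))%R.
Proof.
move=> Qs p0; have m0 := max_wavg_gt0 Qs.
apply: (@le_trans _ _ (max_wavg Q `^ p)%R).
  by rewrite ge0_ler_powR ?nnegrE ?(ltW m0) ?(ltW (wavg_gt0 Qs))// le_max_wavg// subsetb_refl.
rewrite /powR gt_eqF// gt_eqF ?expR_gt0// expRK -expRD ler_expR.
have -> : (p * ln (max_wavg Q) = p / t * (t * ln (max_wavg Q)))%R.
  by field; rewrite gt_eqF.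
rewrite -[X in (_ <= X + _)%R]mulr1 -mulrDr ler_wpM2l ?divr_ge0 ?(ltW t0)//.
by rewrite addrC -intrD1 ltW// floorD1_gt.
Qed.

Lemma measurable_level_set k : measurable (level_set k).
Proof. by rewrite /level_set big_seq_cond; apply: bigsetU_measurable => Q /andP[/ms]. Qed.

Lemma sub_level_set Q : Q \in s -> Q `<=` level_set (level Q).
Proof.
move=> Qs x Qx; rewrite /level_set -big_filter; apply/bigsetU_seqP; exists Q => //.
by rewrite mem_filter eqxx.
Qed.

Lemma wmass_level_set_lty k : wmass mu w (level_set k) < +oo.
Proof.
rewrite /level_set -big_filter; set l := [seq Q <- s | level Q == k].
have : forall Q, Q \in l -> Q \in s by move=> Q; rewrite mem_filter => /andP[].
elim: l => [|Q l IH] ls; first by rewrite big_nil /wmass integral_set0.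
have Qs : Q \in s by rewrite ls// mem_head.
have mU : measurable (\big[setU/set0]_(P <- l) P).
  by rewrite big_seq; apply: bigsetU_measurable => P Pl; apply: ms; rewrite ls// inE Pl orbT.
set U := \big[setU/set0]_(P <- l) P in mU IH.
have QU : Q `<=` Q `|` U by move=> x; left.
rewrite big_cons -/U -(setDUK QU).
rewrite wmassU//; last 3 first.
- exact: ms.
- by apply: measurableD; [apply: measurableU => //; exact: ms|exact: ms].
- by rewrite setDIK.
apply: lte_add_pinfty; first by have /andP[] := wpos Qs.
apply: (@le_lt_trans _ _ (wmass mu w U)); last first.
  by apply: IH => P Pl; rewrite ls// inE Pl orbT.
apply: le_wmass => //; last by move=> x [[Qx|//] nQx].
by apply: measurableD; [apply: measurableU => //; exact: ms|exact: ms].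
Qed.

(** For a cube Q of level k, the cube P above Q that attains the maximum has average at least
    e^(k/t). Every point of the level set thus lies in such a P, and the truncated weak type bound
    applies. *)
Lemma level_set_le k :
  (expR (k%:~R * t^-1) / 2)%:E * wmass mu w (level_set k) <=
  wmass mu (fun x => f x * w x)%R [set x | (expR (k%:~R * t^-1) / 2 < f x)%R].
Proof.
apply: (wmass_level_le ww wf lam_s ms (expR_gt0 _)).
- by move=> Q /wpos/andP[].
- exact: measurable_level_set.
move=> x; rewrite /level_set -big_filter => /bigsetU_seqP[Q].
rewrite mem_filter => /andP[/eqP Qk Qs] Qx.
have [P [Ps QP AP]] := max_wavg_attained Qs.
exists P; split=> //; first by move/asboolP : QP; apply.
have /andP[W0 Wy] := wpos Ps; have /andP[F0 Fy] := fpos Ps.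
rewrite -(fineK (_ : wmass mu w P \is a fin_num)) ?ge0_fin_numE ?(ltW W0)//.
rewrite -(fineK (_ : wmass mu (fun x => f x * w x)%R P \is a fin_num)); last first.
  by rewrite ge0_fin_numE// ltW.
rewrite -EFinM lee_fin -ler_pdivlMr ?fine_gt0 ?wpos// -/(wavg P) -AP.
rewrite -[leRHS](lnK (_ : max_wavg Q \is Num.pos)) ?posrE ?max_wavg_gt0// ler_expR.
by rewrite mulrC ler_pdivrMl// -Qk floor_le.
Qed.

End level_sets.

(** * The sum over the cubes *)

(** The normalisation of the exponents lets the factor u be distributed as the product of u^(r_i
    (1/t_i - rho_i)). In each factor the powers of u then combine to - r_i/t_i', and W_i^(r_i)
    splits into the exponents r_i/t_i' and r_i/t_i. *)
Lemma sparse_term_le (R : realType) (m : nat) (r rho t W F e : 'I_m -> R) (u : R) :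
  (forall i, (0 < r i)%R) -> (forall i, (1 < t i)%R) ->
  (\sum_(i < m) r i * ((t i)^-1 - rho i) = 1)%R ->
  (0 < u)%R -> (forall i, (0 < W i)%R) -> (forall i, (0 < F i)%R) ->
  (forall i, (0 < e i)%R) ->
  (forall i, ((F i / W i) `^ r i <= expR (r i / t i) * e i `^ (r i / t i))%R) ->
  (u * \prod_(i < m) (u `^ (- (1 - rho i)) * F i) `^ r i <=
   expR (\sum_(i < m) r i / t i) *
   \prod_(i < m) (W i / u) `^ (r i / dual_exponent (t i)) *
   \prod_(i < m) (W i * e i) `^ (r i / t i))%R.
Proof.
move=> r0 t1 hsum u0 W0 F0 e0 Fe.
have uE : u = (\prod_(i < m) u `^ (r i * ((t i)^-1 - rho i)))%R.
  by rewrite -powR_sum// hsum powRr1// ltW.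
rewrite {1}uE expR_sum -!big_split/=; apply: ler_prod => i _.
rewrite mulr_ge0 ?powR_ge0//=.
have t0 : (t i != 0)%R by rewrite gt_eqF// (lt_trans _ (t1 i)).
have t10 : (t i - 1 != 0)%R by rewrite gt_eqF// subr_gt0.
have -> : ((u `^ (- (1 - rho i)) * F i) `^ r i =
    (u `^ (- (1 - rho i)) * W i) `^ r i * (F i / W i) `^ r i)%R.
  have h1 : (0 <= u `^ (- (1 - rho i)) * W i)%R by rewrite mulr_ge0 ?powR_ge0 ?ltW.
  have h2 : (0 <= F i / W i)%R by rewrite divr_ge0 ?ltW.
  rewrite -(powRM _ h1 h2); congr (_ `^ _)%R; rewrite -mulrA; congr (_ * _)%R.
  by rewrite mulrC divfK// gt_eqF.
rewrite mulrA; apply: le_trans (ler_wpM2l _ (Fe i)) _.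
  by rewrite mulr_ge0 ?powR_ge0.
rewrite le_eqVlt; apply/orP; left; apply/eqP.
(* With all quantities written as exponentials, the identity of powers becomes an identity of
   exponents. *)
have [a ->] : exists a, u = expR a by exists (ln u); rewrite lnK// posrE.
have [b ->] : exists b, W i = expR b by exists (ln (W i)); rewrite lnK// posrE.
have [c ->] : exists c, e i = expR c by exists (ln (e i)); rewrite lnK// posrE.
rewrite -!expRN -!expRM -!expRD -!expRM -!expRD; congr expR.
rewrite /dual_exponent; field.
by rewrite t0 t10.
Qed.

Lemma big_nth_ord (R : numDomainType) (Z : seq int) (h : int -> R) :
  (\sum_(k <- Z) h k = \sum_(j < size Z) h (nth 0%R Z j))%R.
Proof. by rewrite (big_nth 0%R) big_mkord. Qed.

(** The estimate between positive reals. [P i] stands for a power of the norm: for i in [Js] it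
    bounds a power of a sum over levels, otherwise a sum of powers. *)
Lemma main_sum_le (R : realType) (m : nat) (r rho t : 'I_m -> R) (eta : R) :
  (1 < m)%N -> (forall i, (0 < r i)%R) -> (forall i, (0 <= rho i)%R) ->
  (forall i, (1 < t i)%R) -> (forall i, (rho i < (t i)^-1)%R) ->
  (\sum_(i < m) r i * ((t i)^-1 - rho i) = 1)%R -> (0 < eta <= 1)%R ->
  exists2 C : R, (0 < C)%R & forall d (T : measurableType d)
    (mu : {measure set T -> \bar R}) (D : set (set T)) (E : set T -> set T)
    (s : seq (set T)) (Js : {set 'I_m}) (w f : 'I_m -> T -> R)
    (K P : 'I_m -> R) (M : R),
    sparse_family mu eta E s -> (forall Q, Q \in s -> D Q) ->
    (forall i, weight (w i)) -> (forall i, weight (f i)) ->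
    (forall i Q, Q \in s -> 0 < wmass mu (w i) Q < +oo) ->
    (forall i Q, Q \in s -> 0 < wmass mu (fun x => f i x * w i x)%R Q < +oo) ->
    Js != finset.set0 -> (forall j, (0 < K j)%R) -> (0 <= M)%R ->
    (forall j, j \in Js -> fujii_wilson mu D
       (omit j (fun i => (r i * ((t i)^-1 - rho i))%R)) w <= (K j)%:E) ->
    (forall Q, Q \in s ->
       (\prod_i ravg mu (w i) Q `^ (r i / dual_exponent (t i)) <= M)%R) ->
    (forall i, (0 <= P i)%R) ->
    (forall i Z, i \in Js -> uniq Z ->
       ((\sum_(k <- Z) expR k%:~R *
         fine (wmass mu (w i) (level_set mu (w i) (f i) (t i) s k))) `^ (r i / t i)
        <= P i)%R) ->
    (forall i Z, i \notin Js -> uniq Z ->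
       (\sum_(k <- Z) (expR k%:~R *
         fine (wmass mu (w i) (level_set mu (w i) (f i) (t i) s k))) `^ (r i / t i)
        <= P i)%R) ->
    (\sum_(Q <- s) fine (mu Q) * \prod_(i < m)
       (fine (mu Q) `^ (- (1 - rho i)) *
        fine (wmass mu (fun x => f i x * w i x)%R Q)) `^ r i <=
     C * M * (\sum_(j in Js) K j) * \prod_i P i)%R.
Proof.
move=> m1 r0 rho0 t1 rhot hsum /andP[eta0 eta1].
have t0 i : (0 < t i)%R by rewrite (lt_trans _ (t1 i)).
pose beta i : R := (r i * ((t i)^-1 - rho i))%R.
have beta0 i : (0 < beta i)%R by rewrite mulr_gt0// subr_gt0.
pose q i : R := (r i / dual_exponent (t i))%R.
have q0 i : (0 < q i)%R.
  by rewrite divr_gt0// /dual_exponent divr_gt0// subr_gt0.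
(* The inverse of [sig] exceeds every q_i / beta_i, so that each sig q_i stays below beta_i. *)
pose sig : R := (1 + \sum_i q i / beta i)^-1%R.
have sq0 : (0 <= \sum_i q i / beta i)%R by apply: sumr_ge0 => i _; rewrite divr_ge0// ltW.
have sig0 : (0 < sig)%R by rewrite invr_gt0 ltr_wpDr.
have sigq i : (sig * q i < beta i)%R.
  rewrite /sig mulrC ltr_pdivrMr ?ltr_wpDr// mulrC -ltr_pdivrMr//.
  rewrite (bigD1 i)//= addrCA ltrDl ltr_wpDr// sumr_ge0// => j _.
  by rewrite divr_ge0// ltW.
pose Cc : R := (expR sig * m%:R * kolmogorov_const eta (1 - sig * \sum_i q i) *
  (2 * (m%:R / eta)))%R.
have [Ca Ca0 HCa] := sum_expR_int_le (@ltr01 R).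
have Cc0 : (0 < Cc)%R.
  have mR0 : (0 < m%:R :> R)%R by rewrite ltr0n (ltnW m1).
  have i0 : 'I_m by exact: Ordinal (ltnW m1).
  have kc : (0 < kolmogorov_const eta (1 - sig * \sum_i q i))%R.
    rewrite mulr_gt0 ?invr_gt0// divr_gt0 ?expR_gt0// subr_gt0 expR_lt1.
    rewrite addrAC subrr add0r oppr_lt0 mulr_gt0// (bigD1 i0)//= ltr_wpDr ?q0//.
    by rewrite sumr_ge0// => i _; rewrite ltW.
  apply: mulr_gt0; last by rewrite mulr_gt0// divr_gt0.
  by apply: mulr_gt0 => //; rewrite mulr_gt0 ?expR_gt0.
pose Ct : R := expR (\sum_(i < m) r i / t i)%R.
have CC0 : (0 < Ct * Cc * (expR 1 * Ca))%R.
  apply: mulr_gt0; first by apply: mulr_gt0 => //; exact: expR_gt0.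
  by apply: mulr_gt0 => //; exact: expR_gt0.
exists (Ct * Cc * (expR 1 * Ca))%R => //.
move=> d T mu D E s Js w f K P M sf sD ww wf wpos fpos Js0 K0 M0 FW HM P0 HJs HJr.
have [us lam ms mus SE tE] := sf.
have SK0 : (0 < \sum_(j in Js) K j)%R.
  have /set0Pn[j jJs] := Js0; rewrite (bigD1 j)//= ltr_wpDr// sumr_ge0// => i _.
  exact: ltW.
pose u Q := fine (mu Q).
pose W i Q := fine (wmass mu (w i) Q).
pose F i Q := fine (wmass mu (fun x => f i x * w i x)%R Q).
have u0 Q : Q \in s -> (0 < u Q)%R by move=> /mus/fine_gt0.
have W0 i Q : Q \in s -> (0 < W i Q)%R by move=> /(wpos i)/fine_gt0.
have F0 i Q : Q \in s -> (0 < F i Q)%R by move=> /(fpos i)/fine_gt0.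
pose kap i Q := level mu (w i) (f i) (t i) s Q.
pose Om i := level_set mu (w i) (f i) (t i) s.
pose V i k : R := (expR k%:~R * fine (wmass mu (w i) (Om i k)))%R.
have V0 i k : (0 <= V i k)%R by rewrite mulr_ge0 ?expR_ge0// fine_ge0// wmass_ge0.
pose y i Q : R := (W i Q * expR (kap i Q)%:~R)%R.
have y0 i Q : Q \in s -> (0 < y i Q)%R by move=> Qs; rewrite mulr_gt0 ?expR_gt0 ?W0.
have yV i Q : Q \in s -> (y i Q <= V i (kap i Q))%R.
  move=> Qs; rewrite /y mulrC ler_wpM2l ?expR_ge0// fine_le.
  - by [].
  - by have /andP[h1 h2] := wpos i _ Qs; rewrite ge0_fin_numE// ltW.
  - by rewrite ge0_fin_numE ?wmass_ge0//; exact: wmass_level_set_lty (wpos i) _.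
  apply: le_wmass => //; [exact: ms|exact: measurable_level_set|exact: sub_level_set].
pose B Q := (\prod_i ravg mu (w i) Q `^ q i)%R.
have B0 Q : Q \in s -> (0 < B Q)%R.
  by move=> Qs; apply: prodr_gt0 => i _; rewrite powR_gt0// divr_gt0 ?W0 ?u0.
pose a Q := Num.floor (ln (B Q)).
have aB Q : Q \in s -> (expR (a Q)%:~R <= B Q <= expR ((a Q)%:~R + 1))%R.
  move=> Qs; rewrite -[B Q](lnK (_ : B Q \is Num.pos)) ?posrE ?B0// !ler_expR.
  by rewrite /a floor_le/= ltW// -intrD1 floorD1_gt.
pose G Q := (\prod_i y i Q `^ (r i / t i))%R.
have G0 Q : (0 <= G Q)%R by apply: prodr_ge0 => i _; exact: powR_ge0.
have term Q : Q \in s -> (u Q * \prod_(i < m) (u Q `^ (- (1 - rho i)) * F i Q) `^ r i <=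
    Ct * (expR 1 * expR (a Q)%:~R) * G Q)%R.
  move=> Qs; apply: le_trans (@sparse_term_le R m r rho t (fun i => W i Q)
    (fun i => F i Q) (fun i => expR (kap i Q)%:~R) (u Q) r0 t1 hsum (u0 _ Qs)
    (fun i => W0 i _ Qs) (fun i => F0 i _ Qs) (fun i => expR_gt0 _) _) _.
    by move=> i; apply: wavg_powR_le => //; [exact: wpos|exact: fpos|exact: ltW].
  rewrite -/Ct -/(G Q) ler_wpM2r// ler_wpM2l ?expR_ge0//.
  by have /andP[_] := aB _ Qs; rewrite addrC expRD.
have PP0 : (0 <= \prod_i P i)%R by apply: prodr_ge0.
have Ct0 : (0 <= Ct)%R by exact: expR_ge0.
have [s0|s0] := eqVneq s [::].
  rewrite {1}s0 big_nil; apply: mulr_ge0 => //.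
  by rewrite (mulr_ge0 (mulr_ge0 (ltW CC0) M0) (ltW SK0)).
(* One list for all indices, so that tuples of frozen levels are finite functions into its
   positions. *)
pose Z := undup [seq kap i Q | i <- enum 'I_m, Q <- s].
have uZ : uniq Z by exact: undup_uniq.
have kZ i Q : Q \in s -> kap i Q \in Z.
  move=> Qs; rewrite mem_undup; apply/allpairsP; exists (i, Q).
  by rewrite mem_enum.
have Z0 : (0 < size Z)%N.
  have [Q Qs] : exists Q, Q \in s by case: (s) s0 => // Q l _; exists Q; rewrite mem_head.
  by case: (Z) (kZ (Ordinal (ltnW m1)) Q Qs).
pose j0 : 'I_(size Z) := Ordinal Z0.
pose z (j : 'I_(size Z)) := nth 0%R Z j.
(* An index in [Js] is not frozen; it gets the dummy position [j0], the only one that contributes.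
   The sum over all tuples then factors uniformly over the indices. *)
pose F' i j : R := (if i \in Js then (j == j0)%:R * P i else V i (z j) `^ (r i / t i))%R.
pose hit Q (g : {ffun 'I_m -> 'I_(size Z)}) :=
  [forall i, if i \in Js then g i == j0 else kap i Q == z (g i)].
have hitE Q : Q \in s -> exists g, hit Q g.
  move=> Qs; pose idx i := Ordinal (etrans (index_mem (kap i Q) Z) (kZ i Q Qs)).
  exists [ffun i => if i \in Js then j0 else idx i]; apply/forallP => i.
  by rewrite ffunE; case: (i \in Js) => //; rewrite /z/= nth_index// kZ.
have fixed a0 g : (\sum_(Q <- s | (a Q == a0) && hit Q g) G Q <=
    Cc * (\sum_(j in Js) K j) * \prod_i F' i (g i))%R.
  pose s' := [seq Q <- s | (a Q == a0) && hit Q g].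
  rewrite -[leLHS]big_filter -/s'.
  have s's Q : Q \in s' -> Q \in s by rewrite mem_filter => /andP[].
  have sa Q : Q \in s' -> a Q = a0 by rewrite mem_filter => /andP[/andP[/eqP]].
  have sg Q i : Q \in s' -> i \notin Js -> kap i Q = z (g i).
    by rewrite mem_filter => /andP[/andP[_ /forallP/(_ i)]] + _ /negbTE iJ; rewrite iJ => /eqP.
  have [s'0|s'0] := eqVneq s' [::].
    rewrite s'0 big_nil; apply: mulr_ge0; first by rewrite mulr_ge0 ?ltW.
    apply: prodr_ge0 => i _; rewrite /F'; case: ifP => _; rewrite ?powR_ge0//.
    by rewrite mulr_ge0.
  have gJ i : i \in Js -> g i = j0.
    have [Q Qs] : exists Q, Q \in s'.
      by case: (s') s'0 => // Q l _; exists Q; rewrite mem_head.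
    move: Qs => + iJ; rewrite mem_filter => /andP[/andP[_ /forallP/(_ i)]].
    by rewrite iJ => /eqP.
  have sf' : sparse_family mu eta E s' by apply: sparse_family_sub sf _ s's; rewrite filter_uniq.
  (* For a frozen index the mass [n i] is reduced to the single term of its level. *)
  pose Z' i := if i \in Js then Z else [:: z (g i)].
  pose n i : R := (\sum_(c <- Z' i) expR c%:~R * fine (wmass mu (w i) (Om i c)))%R.
  have kZ' i Q : Q \in s' -> kap i Q \in Z' i.
    move=> Qs; rewrite /Z'; case: ifPn => iJ; first exact/kZ/s's.
    by rewrite inE (sg _ _ Qs iJ).
  have n0 i : (0 <= n i)%R.
    by apply: sumr_ge0 => c _; rewrite mulr_ge0 ?expR_ge0// fine_ge0// wmass_ge0.
  have yn i Q : Q \in s' -> (y i Q <= n i)%R.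
    move=> Qs; apply: le_trans (yV i _ (s's _ Qs)) _.
    rewrite /n (big_rem _ (kZ' i _ Qs))/= lerDl.
    by apply: sumr_ge0 => c _; exact: V0.
  have b1 : (\sum_i beta i = 1)%R by [].
  have core : (\sum_(Q <- s') \prod_i y i Q `^ beta i <=
      Cc * (\sum_(j in Js) K j) * \prod_i n i `^ beta i)%R.
    apply: (@core_sum_le d T R mu eta E s' D m w kap Z' Om eta0 sf' _ ww _ _ kZ' _ _ _
      beta q sig a0%:~R Js K m1 eta1 beta0 b1 q0 sig0 sigq _ _ Js0 K0 FW).
    - by move=> Q /s's; exact: sD.
    - by move=> i Q /s's; exact: wpos.
    - by move=> i A Q /s's As /s's Qs; apply: level_anti => //; [exact: wpos|exact: fpos].
    - by move=> i c; exact: measurable_level_set.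
    - by move=> i c _; apply: wmass_level_set_lty => //; exact: wpos.
    - by move=> i Q /s's; exact: sub_level_set.
    - by move=> Q Qs; rewrite -(sa _ Qs); apply: aB; exact: s's.
    - by move=> i A Q iJ As Qs; rewrite (sg _ _ As iJ) (sg _ _ Qs iJ).
  (* The excess of r_i/t_i over beta_i. Being nonnegative, it permits replacing [y i Q] by its bound
     [n i] in that part of the power. *)
  pose th i : R := (r i * rho i)%R.
  have th0 i : (0 <= th i)%R by rewrite mulr_ge0// ltW.
  have bth i : (r i / t i = beta i + th i)%R by rewrite /beta /th mulrBr subrK.
  have bth0 i : (beta i + th i != 0)%R by rewrite gt_eqF// ltr_wpDr.
  apply: (@le_trans _ _ (\sum_(Q <- s') (\prod_i y i Q `^ beta i) * \prod_i n i `^ th i)%R).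
    rewrite big_seq [leRHS]big_seq; apply: ler_sum => Q Qs.
    rewrite /G -big_split/=; apply: ler_prod => i _; rewrite powR_ge0/=.
    have yQ := y0 i _ (s's _ Qs).
    rewrite bth powRD; last by rewrite (negbTE (bth0 i)).
    by rewrite ler_wpM2l ?powR_ge0// ge0_ler_powR ?nnegrE ?(ltW yQ)// yn.
  rewrite -mulr_suml; apply: le_trans (ler_wpM2r _ core) _.
    by apply: prodr_ge0 => i _; exact: powR_ge0.
  rewrite -[leLHS]mulrA -big_split/=.
  apply: ler_wpM2l; first by rewrite (mulr_ge0 (ltW Cc0) (ltW SK0)).
  apply: ler_prod => i _; rewrite mulr_ge0 ?powR_ge0//=.
  rewrite -powRD ?(negbTE (bth0 i))// -bth /F' /n /Z'; case: ifPn => iJ.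
    by rewrite gJ// eqxx mul1r; exact: HJs.
  by rewrite big_seq1.
apply: (@le_trans _ _ (\sum_(Q <- s) Ct * (expR 1 * expR (a Q)%:~R) * G Q)%R).
  by rewrite big_seq [leRHS]big_seq; exact: ler_sum.
have tm0 Q : (0 <= Ct * (expR 1 * expR (a Q)%:~R) * G Q)%R.
  by rewrite mulr_ge0// mulr_ge0// mulr_ge0 ?expR_ge0.
pose A := undup (map a s).
apply: le_trans (@ler_sum_cover _ _ _ s A (fun Q b => a Q == b) _ _ _) _.
- by move=> Q _; exact: tm0.
- by move=> Q Qs; apply/hasP; exists (a Q) => //; rewrite mem_undup map_f.
pose L : R := (Ct * expR 1 * (Cc * (\sum_(j in Js) K j) * \prod_i P i))%R.
have L0 : (0 <= L)%R.
  apply: mulr_ge0; first by rewrite mulr_ge0 ?expR_ge0.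
  by apply: mulr_ge0 => //; rewrite mulr_ge0 ?ltW.
(* Every level b that occurs satisfies e^b at most M, so the sum of the e^b is at most a constant
   times M. As [s] is not empty, M is positive and has a logarithm. *)
apply: (@le_trans _ _ (\sum_(b <- A) L * expR (1 * b%:~R))%R); last first.
  rewrite -mulr_sumr.
  have M1 : (0 < M)%R.
    have [Q Qs] : exists Q, Q \in s by case: (s) s0 => // Q l _; exists Q; rewrite mem_head.
    exact: lt_le_trans (B0 _ Qs) (HM _ Qs).
  apply: le_trans (ler_wpM2l L0 (HCa A (ln M) (undup_uniq _) _)) _.
    move=> b; rewrite mem_undup => /mapP[Q Qs ->].
    rewrite -ler_expR lnK ?posrE//; apply: le_trans (HM _ Qs).
    by have /andP[] := aB _ Qs.
  rewrite mul1r lnK ?posrE// /L le_eqVlt; apply/orP; left; apply/eqP; ring.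
apply: ler_sum => b _; rewrite mul1r.
apply: (@le_trans _ _ (Ct * (expR 1 * expR b%:~R) * \sum_(Q <- s | a Q == b) G Q)%R).
  by rewrite mulr_sumr le_eqVlt; apply/orP; left; apply/eqP/eq_bigr => Q /eqP ->.
have -> : (L * expR b%:~R = Ct * (expR 1 * expR b%:~R) *
   (Cc * (\sum_(j in Js) K j) * \prod_i P i))%R by rewrite /L; ring.
rewrite ler_wpM2l ?mulr_ge0 ?expR_ge0//.
rewrite -[leLHS]big_filter.
apply: le_trans (@ler_sum_cover _ _ _ [seq Q <- s | a Q == b] (index_enum _) hit _ _ _) _.
- by move=> Q _; exact: G0.
- move=> Q; rewrite mem_filter => /andP[_ /hitE[g gQ]].
  by apply/hasP; exists g => //; rewrite mem_index_enum.
apply: (@le_trans _ _ (\sum_(g : {ffun 'I_m -> 'I_(size Z)})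
   Cc * (\sum_(j in Js) K j) * \prod_i F' i (g i))%R).
  by apply: ler_sum => g _; rewrite big_filter_cond.
(* The sum over tuples of products becomes the product over indices of sums, each of which is at
   most [P i]. *)
rewrite -mulr_sumr -bigA_distr_bigA; apply: ler_wpM2l.
  by rewrite (mulr_ge0 (ltW Cc0) (ltW SK0)).
apply: ler_prod => i _; apply/andP; split.
  apply: sumr_ge0 => j _; rewrite /F'; case: ifP => _; rewrite ?powR_ge0//.
  by rewrite mulr_ge0.
have [iJ|iJ] := boolP (i \in Js).
  by rewrite (bigD1 j0)//= big1 => [|j /negbTE jj]; rewrite /F' iJ ?eqxx ?mul1r ?addr0// jj mul0r.
under eq_bigr do rewrite /F' (negbTE iJ).
by have := HJr i Z iJ uZ; rewrite big_nth_ord.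
Qed.

(** * Passage from real numbers to extended reals *)

Lemma wmass_mul_gt0 d (T : measurableType d) (R : realType)
    (mu : {measure set T -> \bar R}) (w f : T -> R) (A : set T) :
  weight w -> weight f -> measurable A ->
  0 < wmass mu (fun x => f x * w x)%R A -> 0 < wmass mu w A.
Proof.
move=> ww wf mA; have wfw : weight (fun x => f x * w x)%R by exact: weight_mul.
rewrite !lt_neqAle !wmass_ge0// !andbT; apply: contra_neq => w0.
have ae0 : ae_eq mu A (EFin \o w) (cst 0).
  apply/ae_eq_integral_abs => //; first exact: weight_measurable.
  rewrite [RHS]w0; apply: eq_integral => x _.
  by rewrite gee0_abs// lee_fin; exact: ww.2.
rewrite /wmass (@ae_eq_integral _ _ _ mu A (cst 0) _ mA).
- by rewrite integral0.
- exact: weight_measurable.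
- exact: measurable_cst.
by apply: filterS ae0 => x /= H /H[->]; rewrite mulr0.
Qed.

Lemma mule_lty (R : realType) (x y : \bar R) : 0 < x -> 0 < y ->
  x * y < +oo -> x < +oo /\ y < +oo.
Proof.
by case: x y => [x| |] [y| |]//; rewrite ?ltry// => x0 y0; rewrite ?gt0_mulye ?gt0_muley.
Qed.

Lemma prode_lty (R : realType) (I : finType) (F : I -> \bar R) :
  (forall i, 0 < F i) -> \prod_i F i < +oo -> forall i, F i < +oo.
Proof.
move=> F0 + i; rewrite (bigD1 i)//= => /mule_lty-[]//.
by apply: prode_gt0 => j _.
Qed.

Lemma average_ravg d (T : measurableType d) (R : realType)
    (mu : {measure set T -> \bar R}) (w : T -> R) (Q : set T) :
  0 < mu Q < +oo -> wmass mu w Q \is a fin_num ->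
  average mu w Q = (ravg mu w Q)%:E.
Proof.
move=> muQ wf; have mu0 := fine_gt0 muQ; have /andP[h1 h2] := muQ.
rewrite /ravg /average -/(wmass mu w Q).
rewrite -(fineK (_ : mu Q \is a fin_num)) ?ge0_fin_numE ?(ltW h1)//.
by rewrite inver gt_eqF// -(fineK wf) -EFinM mulrC.
Qed.

Lemma average_gt0 d (T : measurableType d) (R : realType)
    (mu : {measure set T -> \bar R}) (w : T -> R) (Q : set T) :
  0 < mu Q < +oo -> 0 < wmass mu w Q -> 0 < average mu w Q.
Proof.
move=> /andP[h1 h2] w0; apply: mule_gt0; last exact: w0.
by rewrite inve_gt0 ?(gt_eqF h1)// (lt_eqF h2).
Qed.

(** When [s] is not empty, positivity of the integrals on one of its cubes makes every factor on the
    right positive. Unless the product is infinite, each factor is then finite, and so are all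
    masses on the cubes. *)
Lemma finite_sparse_sum_le (R : realType) (m : nat) (r rho t : 'I_m -> R) (eta : R) :
  (1 < m)%N -> (forall i, (0 < r i)%R) -> (forall i, (0 <= rho i)%R) ->
  (forall i, (1 < t i)%R) -> (forall i, (rho i < (t i)^-1)%R) ->
  (\sum_(i < m) r i * ((t i)^-1 - rho i) = 1)%R -> (0 < eta <= 1)%R ->
  exists2 C : R, (0 < C)%R & forall d (T : measurableType d)
    (mu : {measure set T -> \bar R}) (D : set (set T)) (E : set T -> set T)
    (s : seq (set T)) (Js : {set 'I_m}) (w f : 'I_m -> T -> R),
    sparse_family mu eta E s -> (forall Q, Q \in s -> D Q) ->
    (forall i, weight (w i)) -> (forall i, weight (f i)) -> Js != finset.set0 ->
    (forall i Q, Q \in s -> 0 < wmass mu (fun x => f i x * w i x)%R Q) ->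
    \sum_(Q <- s) mu Q * \prod_(i < m)
      (mu Q `^ (- (1 - rho i)) * wmass mu (fun x => f i x * w i x)%R Q) `^ r i <=
    C%:E * muckenhoupt mu D (fun i => (r i / dual_exponent (t i))%R) w *
    (\sum_(j in Js) fujii_wilson mu D
       (omit j (fun i => (r i * ((t i)^-1 - rho i))%R)) w) *
    \prod_(i < m) (if i \in Js then weighted_Lnorm mu (w i) (t i) (f i)
                   else lorentz_norm mu (w i) (t i) (r i) (f i)) `^ r i.
Proof.
move=> m1 r0 rho0 t1 rhot hsum heta.
have t0 i : (0 < t i)%R by rewrite (lt_trans _ (t1 i)).
have rt0 i : (0 < r i / t i)%R by rewrite divr_gt0.
have [Cm Cm0 HCm] := main_sum_le m1 r0 rho0 t1 rhot hsum heta.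
(* The constants are chosen per index before any measure space is introduced, which makes them
   uniform in space, weights and functions. *)
have /choice[cL HL] i : exists c : R, (0 < c)%R /\ forall d (T : measurableType d)
    (mu : {measure set T -> \bar R}) (w f : T -> R) (K : seq int)
    (V : int -> \bar R), weight w -> weight f -> uniq K ->
    (forall k, k \in K -> (expR (k%:~R * (t i)^-1) / 2)%:E * V k <=
      wmass mu (fun x => f x * w x)%R [set x | (expR (k%:~R * (t i)^-1) / 2 < f x)%R]) ->
    \sum_(k <- K) (expR k%:~R)%:E * V k <= c%:E * \int[mu]_x (f x `^ t i * w x)%R%:E.
  by have [c c0 Hc] := Lt_level_sum (t1 i); exists c.
have /choice[cR HR] i : exists c : R, (0 < c)%R /\ forall d (T : measurableType d)
    (mu : {measure set T -> \bar R}) (w f : T -> R) (K : seq int)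
    (V : int -> \bar R), weight w -> weight f -> uniq K ->
    (forall k, 0 <= V k) ->
    (forall k, k \in K -> (expR (k%:~R * (t i)^-1) / 2)%:E * V k <=
      wmass mu (fun x => f x * w x)%R [set x | (expR (k%:~R * (t i)^-1) / 2 < f x)%R]) ->
    \sum_(k <- K) ((expR k%:~R)%:E * V k) `^ (r i / t i) <=
    c%:E * lorentz_norm mu w (t i) (r i) f `^ r i.
  by have [c c0 Hc] := lorentz_level_sum (r0 i) (t1 i); exists c.
(* The sum of both constants serves whichever part of the partition contains i, so the final
   constant is independent of the partition. *)
pose c i : R := (cL i `^ (r i / t i) + cR i)%R.
have c0 i : (0 < c i)%R by rewrite ltr_wpDl ?powR_ge0// (HR i).1.
have pc0 : (0 < \prod_i c i)%R by exact: prodr_gt0.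
exists (Cm * \prod_i c i)%R; first exact: mulr_gt0.
move=> d T mu D E s Js w f sf sD ww wf Js0 F0.
have [us lam ms mus SE tE] := sf.
pose beta i : R := (r i * ((t i)^-1 - rho i))%R.
have beta0 i : (0 < beta i)%R by rewrite mulr_gt0// subr_gt0.
pose q i : R := (r i / dual_exponent (t i))%R.
have q0 i : (0 < q i)%R by rewrite divr_gt0// /dual_exponent divr_gt0// subr_gt0.
set A := muckenhoupt mu D _ w.
pose FW j := fujii_wilson mu D (omit j beta) w.
pose N i := (if i \in Js then weighted_Lnorm mu (w i) (t i) (f i)
             else lorentz_norm mu (w i) (t i) (r i) (f i)) `^ r i.
have A0 : 0 <= A by apply: ereal_sup_ubound; left.
have FW0 j : 0 <= FW j by apply: ereal_sup_ubound; left.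
have N0 i : 0 <= N i by exact: poweR_ge0.
rewrite -/(\prod_i N i).
have [s0|s0] := eqVneq s [::].
  rewrite {1}s0 big_nil !mule_ge0 ?prode_ge0// ?lee_fin; first exact/ltW/mulr_gt0.
  by apply: sume_ge0 => j _; exact: FW0.
have [Q0 Q0s] : exists Q, Q \in s by case: (s) s0 => // Q l _; exists Q; rewrite mem_head.
have W0 i Q : Q \in s -> 0 < wmass mu (w i) Q.
  by move=> Qs; apply: wmass_mul_gt0 (ww i) (wf i) (ms _ Qs) (F0 i _ Qs).
have avA Q : Q \in s -> \prod_i average mu (w i) Q `^ q i <= A.
  by move=> Qs; apply: ereal_sup_ubound; right; exists Q => //; exact: sD.
have av0 i Q : Q \in s -> 0 < average mu (w i) Q.
  by move=> Qs; apply: average_gt0; [exact: mus|exact: W0].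
have A1 : 0 < A.
  by apply: lt_le_trans (avA _ Q0s); apply: prode_gt0 => i _; rewrite poweR_gt0// av0.
have i0 : 'I_m := Ordinal (ltnW m1).
have beta1 j : (beta j < 1)%R.
  have [i ij] : exists i, i != j.
    by case: (m) (m1) j => [|[|k]]// _ j; exists (if j == ord0 then lift ord0 ord0 else ord0);
      case: ifPn => [/eqP ->|]; rewrite // eq_sym.
  rewrite -hsum -/(\sum_i beta i)%R (bigD1 j)//= ltrDl (bigD1 i)//= ltr_wpDr ?beta0//.
  by rewrite sumr_ge0// => l _; exact: ltW.
have FW1 j : 0 < FW j.
  apply: (fujii_wilson_gt0 (sD _ Q0s) (ms _ Q0s) (mus _ Q0s)) => //.
  - rewrite (bigD1 j)//= /omit eqxx add0r.
    rewrite (eq_bigr beta) => [|i /negbTE ->]; last by [].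
    rewrite -[ltLHS](subrr (beta j)) ltrBlDl.
    by move: (beta1 j); rewrite -hsum -/(\sum_i beta i)%R (bigD1 j).
  - by move=> i; rewrite /omit; case: ifP => // _; exact: ltW.
  - by move=> i; exact: W0.
have N1 i : 0 < N i.
  apply: poweR_gt0; case: ifP => _.
    exact: Lnorm_gt0 (ww i) (wf i) (t1 i) (ms _ Q0s) (F0 i _ Q0s).
  exact: lorentz_gt0 (ww i) (wf i) (r0 i) (t1 i) (ms _ Q0s) (F0 i _ Q0s).
pose SF := \sum_(j in Js) FW j.
have SF1 : 0 < SF.
  have /set0Pn[j jJs] := Js0; apply: lt_le_trans (FW1 j) _.
  by rewrite /SF (bigD1 j)//= leeDl// sume_ge0.
have PN1 : 0 < \prod_i N i by exact: prode_gt0.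
have CC0 : 0 < (Cm * \prod_i c i)%:E by rewrite lte_fin mulr_gt0.
have CA0 := mule_gt0 CC0 A1.
have [->|] := eqVneq ((Cm * \prod_i c i)%:E * A * SF * \prod_i N i) +oo.
  exact: leey.
rewrite -ltey => /(mule_lty (mule_gt0 CA0 SF1) PN1)[].
move=> /(mule_lty CA0 SF1)[/(mule_lty CC0 A1)[_ Ay] SFy] PNy.
have Ny := prode_lty N1 PNy.
have FWy j : j \in Js -> FW j < +oo.
  move=> jJs; apply: le_lt_trans SFy; rewrite /SF (bigD1 j)//= leeDl// sume_ge0//.
have Af : A \is a fin_num by rewrite ge0_fin_numE.
have FWf j : j \in Js -> FW j \is a fin_num by move=> jJs; rewrite ge0_fin_numE// FWy.
have Nf i : N i \is a fin_num by rewrite ge0_fin_numE.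
have Wpos i Q : Q \in s -> 0 < wmass mu (w i) Q < +oo.
  move=> Qs; rewrite W0//=.
  have av1 j : 0 < average mu (w j) Q `^ q j by rewrite poweR_gt0// av0.
  have := prode_lty av1 (le_lt_trans (avA _ Qs) Ay) i.
  move=> /lty_poweRy; rewrite gt_eqF// => /(_ isT) /mule_lty[]//; last exact: W0.
  have /andP[h1 h2] := mus _ Qs; by rewrite inve_gt0 ?(gt_eqF h1)// (lt_eqF h2).
have Fpos i Q : Q \in s -> 0 < wmass mu (fun x => f i x * w i x)%R Q < +oo.
  move=> Qs; rewrite F0//=; have /andP[_ Wy] := Wpos i _ Qs.
  have := Ny i; rewrite /N; case: ifP => _ /lty_poweRy; rewrite gt_eqF// => /(_ isT) H.
    exact: Lnorm_finite (ww i) (wf i) (t1 i) (ms _ Qs) H Wy.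
  exact: lorentz_finite (ww i) (wf i) (r0 i) (t1 i) (ms _ Qs) H Wy.
have Wf i Q : Q \in s -> wmass mu (w i) Q \is a fin_num.
  by move=> /(Wpos i)/andP[h1 h2]; rewrite ge0_fin_numE// ltW.
have Ff i Q : Q \in s -> wmass mu (fun x => f i x * w i x)%R Q \is a fin_num.
  by move=> /(Fpos i)/andP[h1 h2]; rewrite ge0_fin_numE// ltW.
have uf Q : Q \in s -> mu Q \is a fin_num.
  by move=> /mus/andP[h1 h2]; rewrite ge0_fin_numE// ltW.
pose X i := \int[mu]_x (f i x `^ t i * w i x)%R%:E.
have X0 i : 0 <= X i.
  by apply: integral_ge0 => x _; rewrite lee_fin mulr_ge0 ?powR_ge0//; exact: (ww i).2.
have Xf i : i \in Js -> X i \is a fin_num.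
  move=> iJ; rewrite ge0_fin_numE//; have := Ny i; rewrite /N iJ.
  move=> /lty_poweRy; rewrite gt_eqF// => /(_ isT); rewrite /weighted_Lnorm -/(X i).
  by move=> /lty_poweRy; apply; rewrite invr_eq0 gt_eqF.
have XN i : i \in Js -> (fine (X i) `^ (r i / t i) = fine (N i))%R.
  move=> iJ; rewrite /N iJ /weighted_Lnorm -/(X i) -(fineK (Xf i iJ)) !poweR_EFin/=.
  by rewrite -powRrM mulrC.
(* Outside [Js] the characteristic may be infinite; the value 1 only keeps [K] positive there. *)
pose K j : R := if j \in Js then fine (FW j) else 1%R.
have K0 j : (0 < K j)%R.
  by rewrite /K; case: ifPn => // jJs; rewrite fine_gt0// FW1 FWy.
pose P i : R := (c i * fine (N i))%R.
have fN0 i : (0 <= fine (N i))%R by exact: fine_ge0.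
have lev i : forall k, (expR (k%:~R * (t i)^-1) / 2)%:E *
    wmass mu (w i) (level_set mu (w i) (f i) (t i) s k) <=
    wmass mu (fun x => f i x * w i x)%R [set x | (expR (k%:~R * (t i)^-1) / 2 < f i x)%R].
  by move=> k; apply: level_set_le => //; [exact: Wpos|exact: Fpos].
have levf i k : wmass mu (w i) (level_set mu (w i) (f i) (t i) s k) \is a fin_num.
  by rewrite ge0_fin_numE ?wmass_ge0//; apply: wmass_level_set_lty => //; exact: Wpos.
have lev0 i k : (0 <= expR k%:~R * fine (wmass mu (w i) (level_set mu (w i) (f i) (t i) s k)))%R.
  by rewrite mulr_ge0 ?expR_ge0// fine_ge0// wmass_ge0.
have main := HCm d T mu D E s Js w f K P (fine A) sf sD ww wf Wpos Fpos Js0 K0.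
rewrite (_ : \sum_(Q <- s) _ = (\sum_(Q <- s) fine (mu Q) * \prod_(i < m)
   (fine (mu Q) `^ (- (1 - rho i)) *
    fine (wmass mu (fun x => f i x * w i x)%R Q)) `^ r i)%R%:E); last first.
  rewrite -sumEFin big_seq [RHS]big_seq; apply: eq_bigr => Q Qs.
  rewrite EFinM -prodEFin fineK ?uf//; congr (_ * _); apply: eq_bigr => i _.
  by rewrite -poweR_EFin EFinM -poweR_EFin fineK ?uf// fineK ?Ff.
have SFE : SF = (\sum_(j in Js) K j)%R%:E.
  by rewrite -sumEFin; apply: eq_bigr => j jJs; rewrite /K jJs fineK// FWf.
have PNE : \prod_i N i = (\prod_i fine (N i))%R%:E.
  by rewrite -prodEFin; apply: eq_bigr => i _; rewrite fineK.
rewrite -[X in _ <= _ * X * _]/SF SFE PNE -(fineK Af) -!EFinM lee_fin.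
rewrite [leRHS](_ : _ = Cm * fine A * (\sum_(j in Js) K j) * \prod_i P i)%R; last first.
  by rewrite big_split/=; ring.
apply: main.
- exact: fine_ge0.
- by move=> j jJs; rewrite /K jJs fineK ?FWf.
- move=> Q Qs; rewrite -lee_fin fineK//; apply: le_trans (avA _ Qs).
  rewrite -prodEFin le_eqVlt; apply/orP; left; apply/eqP; apply: eq_bigr => i _.
  by rewrite -poweR_EFin average_ravg ?Wf ?mus.
- by move=> i; rewrite mulr_ge0// ltW.
- move=> i Z iJ uZ; have [cL0 H] := HL i.
  have := H d T mu (w i) (f i) Z _ (ww i) (wf i) uZ (fun k _ => lev i k).
  rewrite -/(X i) -(fineK (Xf i iJ)) -EFinM.
  rewrite (_ : \sum_(k <- Z) _ = (\sum_(k <- Z) expR k%:~R *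
     fine (wmass mu (w i) (level_set mu (w i) (f i) (t i) s k)))%R%:E); last first.
    by rewrite -sumEFin; apply: eq_bigr => k _; rewrite EFinM fineK.
  have fX0 : (0 <= fine (X i))%R by exact: fine_ge0.
  rewrite lee_fin => {}H.
  apply: (@le_trans _ _ ((cL i * fine (X i)) `^ (r i / t i))%R).
    rewrite ge0_ler_powR ?nnegrE ?(ltW (rt0 i))//; first exact: sumr_ge0.
    by rewrite mulr_ge0// ltW.
  rewrite powRM ?(ltW cL0)// XN// /P ler_wpM2r// /c lerDl; exact: ltW (HR i).1.
- move=> i Z iJ uZ; have [cR0 H] := HR i.
  have := H d T mu (w i) (f i) Z _ (ww i) (wf i) uZ _ (fun k _ => lev i k).
  move=> /(_ (fun k => wmass_ge0 _ _ (ww i))).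
  have -> : lorentz_norm mu (w i) (t i) (r i) (f i) `^ r i = (fine (N i))%:E.
    by rewrite fineK// /N (negbTE iJ).
  rewrite (_ : \sum_(k <- Z) _ = (\sum_(k <- Z) (expR k%:~R *
     fine (wmass mu (w i) (level_set mu (w i) (f i) (t i) s k))) `^ (r i / t i))%R%:E); last first.
    by rewrite -sumEFin; apply: eq_bigr => k _; rewrite -poweR_EFin EFinM fineK.
  rewrite -EFinM lee_fin => /le_trans; apply.
  by rewrite /P ler_wpM2r// /c lerDr powR_ge0.
Qed.

Theorem theorem1p11 (R : realType) (m : nat) (hm : (2 <= m)%N)
    (r rho t : 'I_m -> R) (eta : R)
    (hr : forall i, (0 < r i)%R)
    (hrho : forall i, (0 <= rho i < 1)%R)
    (ht1 : forall i, (1 < t i)%R)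
    (ht : forall i, (t i)%:E < ((rho i)%:E)^-1)
    (hsum : (\sum_(i < m) r i * ((t i)^-1 - rho i))%R = 1%R)
    (heta : (0 < eta <= 1)%R) :
  exists C : R, (0 < C)%R /\
  forall (d : measure_display) (T : measurableType d)
    (mu : {measure set T -> \bar R}) (D S : set (set T))
    (Js Jr : {set 'I_m}) (w f : 'I_m -> T -> R),
    nonatomic mu ->
    dyadic_grid mu D ->
    S `<=` D ->
    sparse mu eta S ->
    Js != finset.set0 ->
    Js :|: Jr = finset.setT ->
    Js :&: Jr = finset.set0 ->
    (forall i, weight (w i)) ->
    (forall i, measurable_fun setT (f i) /\ forall x, (0 <= f i x)%R) ->
    sparse_form mu D r rho (\1_S) (fun i x => (f i x * w i x)%R)
    <= C%:E
       * muckenhoupt mu D (fun i => (r i / dual_exponent (t i))%R) w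
       * (\sum_(j in Js)
            fujii_wilson mu D
              (omit j (fun i => (r i * ((t i)^-1 - rho i))%R)) w)
       * (\prod_(i in Js) weighted_Lnorm mu (w i) (t i) (f i) `^ r i)
       * (\prod_(i in Jr) lorentz_norm mu (w i) (t i) (r i) (f i) `^ r i).
Proof.
have t0 i : (0 < t i)%R by rewrite (lt_trans _ (ht1 i)).
have rho0 i : (0 <= rho i)%R by have /andP[] := hrho i.
have rhot i : (rho i < (t i)^-1)%R.
  (* For [rho i = 0] the extended inverse is [+oo], and the claim reduces to positivity of the
     inverse of [t i]. *)
  have := ht i; rewrite inver; case: eqVneq => [->|rhoi]; first by rewrite invr_gt0.
  have rhoi0 : (0 < rho i)%R by rewrite lt_neqAle eq_sym rhoi rho0.
  by rewrite lte_fin -[X in (_ -> X < _)%R]invrK ltf_pV2 ?posrE ?invr_gt0.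
have [C C0 HC] := finite_sparse_sum_le hm hr rho0 ht1 rhot hsum heta.
exists C; split=> // d T mu D S Js Jr w f _ [_ DQ lamD] SD [E [SE tE]] Js0 JU JI ww wf.
have NE : \prod_(i < m) (if i \in Js then weighted_Lnorm mu (w i) (t i) (f i)
      else lorentz_norm mu (w i) (t i) (r i) (f i)) `^ r i =
    \prod_(i in Js) weighted_Lnorm mu (w i) (t i) (f i) `^ r i *
    \prod_(i in Jr) lorentz_norm mu (w i) (t i) (r i) (f i) `^ r i.
  have JrE i : (i \in Jr) = (i \notin Js).
    have := finset.in_setT i; rewrite -JU finset.in_setU.
    have := finset.in_set0 i; rewrite -JI finset.in_setI.
    by case: (i \in Js); case: (i \in Jr).
  rewrite (bigID (fun i => i \in Js))/=; congr (_ * _); first by apply: eq_bigr => i ->.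
  by apply: eq_big => [i|i /negbTE ->//]; rewrite JrE.
(* [\esum] is a supremum over finite subsets of the grid, so a bound uniform in the finite set A
   suffices. *)
rewrite -muleA -NE; apply: ge_ereal_sup => _ [A [finA AD] <-].
rewrite fsbig_finite//.
pose F i Q := wmass mu (fun x => f i x * w i x)%R Q.
(* The other cubes contribute 0: either the indicator of [S] vanishes, or some integral is 0 and its
   positive power [r i] annihilates the product. *)
pose good Q := (Q \in S) && [forall i, 0 < F i Q].
rewrite (bigID good)/= [X in _ + X]big1 ?adde0 => [|Q]; last first.
  rewrite negb_and => /orP[QS|]; first by rewrite indicE (negbTE QS) !mul0e.
  rewrite negb_forall => /existsP[i]; rewrite -leNgt => Fi.
  rewrite (bigD1 i)//=; have -> : \int[mu]_(x in Q) (f i x * w i x)%:E = 0.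
    apply/eqP; rewrite eq_le [X in X && _]Fi integral_ge0// => x _.
    by rewrite lee_fin mulr_ge0//; [exact: (wf i).2|exact: (ww i).2].
  by rewrite mule0 poweR0r ?gt_eqF// mul0e mule0.
pose s := [seq Q <- finmap.enum_fset (fset_set A) | good Q].
rewrite -[leLHS]big_filter -/s.
have sS Q : Q \in s -> S Q by rewrite mem_filter => /andP[/andP[/set_mem]].
have sf : sparse_family mu eta E s.
  split.
  - by rewrite filter_uniq// finmap.fset_uniq.
  - by move=> P Q /sS/SD DP /sS/SD DQ'; exact: lamD.
  - by move=> Q /sS/SD/DQ[].
  - by move=> Q /sS/SD/DQ[].
  - by move=> Q /sS; exact: SE.
  - by apply: sub_trivIset tE => Q /= /sS.
apply: le_trans (HC d T mu D E s Js w f sf _ ww wf Js0 _).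
- rewrite big_seq [leRHS]big_seq; apply: lee_sum => Q Qs.
  by rewrite indicE mem_set ?mul1e//; exact: sS.
- by move=> Q /sS/SD.
- by move=> i Q; rewrite mem_filter => /andP[/andP[_ /forallP/(_ i)]].
Qed.
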